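(* Let $\lambda>0$ and let $f$ be a locally univalent analytic function in $\mathbb{D}$ (i.e. $f\in\mathcal{L}(\mathbb{D})$). Then $f$ is univalent in $\mathbb{D}$ if and only if, for all $\zeta\in\mathbb{D}$, $$\sum_{n=1}^{\infty}(n-\lambda)\left|A_n(f;\zeta)\right|^2\leq\lambda .$$
   Context: $\mathbb{D}=\{z\in\mathbb{C}:|z|<1\}$. $\mathcal{L}(\mathbb{D})$ is the class of analytic functions $f$ in $\mathbb{D}$ with $f'(z)\neq 0$ for all $z\in\mathbb{D}$. ''Univalent'' means one-to-one. Mixed Aharonov sequence: for $f\in\mathcal{L}(\mathbb{D})$, $\lambda>0$ and $z\in\mathbb{D}$, the numbers $\Phi_n(f;z)=\Phi_{\lambda,n}(f;z)$, $n\ge 0$, are defined by the expansion, for $w$ close to $z$, $$\left[\frac{f'(z)(w-z)}{f(w)-f(z)}\right]^{\lambda}=\sum_{n=0}^{\infty}\Phi_{\lambda,n}(f;z)(w-z)^n,$$ where the quotient is given the value $1$ at $w=z$ and the branch of the power is the one equal to $1$ at $w=z$ (so $\Phi_{0}\equiv 1$). For real $\alpha$ and integer $m\ge 0$, $\binom{\alpha}{m}=\frac{\alpha(\alpha-1)\cdots(\alpha-m+1)}{m!}$, with $\binom{\alpha}{0}=1$ (in particular $\binom{-1}{0}=1$). The convention $0^0=1$ is used. For $n\ge 0$ and $\zeta\in\mathbb{D}$, $$A_n(f;\zeta):=\sum_{j=0}^{n}(-1)^{n-j}\binom{\lambda}{n-j}\sum_{k=0}^{j}\binom{j-1}{j-k}(-\bar{\zeta})^{n-k}(1-|\zeta|^2)^{k}\,\Phi_{\lambda,k}(f;\zeta).$$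 *)

(* Defs.v *)
From Stdlib Require Import Reals Factorial ClassicalEpsilon.
From Coquelicot Require Import Coquelicot.
Open Scope R_scope.

Definition in_disk (z : C) : Prop := Cmod z < 1.

Definition locally_univalent (f : C -> C) : Prop :=
  forall z : C, in_disk z ->
    ex_derive (K := C_AbsRing) (V := C_NormedModule) f z
    /\ C_derive f z <> RtoC 0.

Definition univalent (f : C -> C) : Prop :=
  forall z w : C, in_disk z -> in_disk w -> f z = f w -> z = w.

Definition Cexp (z : C) : C :=
  (exp (Re z) * cos (Im z), exp (Re z) * sin (Im z)).

                                                                    
                                             
Definition Clog (z : C) : C :=
  (ln (Cmod z), 2 * atan (Im z / (Cmod z + Re z))).

Definition Cpower (z : C) (a : R) : C := Cexp (RtoC a * Clog z)%C.

Definition aharonov_quotient (f : C -> C) (z w : C) : C :=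
  if Ceq_dec w z then RtoC 1
  else (C_derive f z * (w - z) / (f w - f z))%C.

                                                                         
                                                     
Definition is_aharonov_expansion (lambda : R) (f : C -> C) (z : C)
    (a : nat -> C) : Prop :=
  locally (T := C_UniformSpace) z (fun w : C =>
    is_pseries (K := C_AbsRing) (V := C_NormedModule) a (w - z)%C
      (Cpower (aharonov_quotient f z w) lambda)).

                                                                          
                                                                               
Definition Phi (lambda : R) (f : C -> C) (z : C) : nat -> C :=
  epsilon (inhabits (fun _ : nat => RtoC 0))
    (is_aharonov_expansion lambda f z).

Fixpoint falling (a : R) (m : nat) : R :=
  match m with
  | O => 1
  | S p => falling a p * (a - INR p)
  end.

Definition gbinom (a : R) (m : nat) : R := falling a m / INR (fact m).

                                                                    
Definition A (lambda : R) (f : C -> C) (zeta : C) (n : nat) : C :=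
  sum_n (G := C_AbelianGroup) (fun j : nat =>
    RtoC ((-1) ^ (n - j) * gbinom lambda (n - j)) *
    sum_n (G := C_AbelianGroup) (fun k : nat =>
      RtoC (gbinom (INR j - 1) (j - k)) * Cpow (- Cconj zeta) (n - k) *
      RtoC ((1 - Cmod zeta ^ 2) ^ k) * Phi lambda f zeta k) j)%C n.

Definition area_term (lambda : R) (f : C -> C) (zeta : C) (n : nat) : R :=
  (INR n - lambda) * Cmod (A lambda f zeta n) ^ 2.

(* Main.v *)
(* Precomposing [f] with the disk automorphism z -> (z + zeta) / (1 + conj zeta z) and
   subtracting [f zeta] gives a function [G] with [G 0 = 0], and [A n] is the n-th Taylor
   coefficient at 0 of [H = (G'(0) z / G)^lambda].

   Sufficiency only uses the convergence of the series: it bounds the [A n], so [H] extends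
   to the whole disk, where z G H' = lambda H (G - z G') by the identity theorem. Hence
   |H|^2 |G / z|^(2 lambda) is constant on a radius up to the first zero of [G], which is
   impossible if there is one, because [H] stays bounded.

   Necessity is Prawitz's area theorem. On |z| = r, with w = G, Parseval's identity turns
   sum (n - lambda) |A n|^2 r^(2n) into a negative multiple of the integral of
   |w|^(-2 lambda) d(arg w), and one has to show that the latter is nonnegative. The curve w
   has winding number 0 or 1 around each point u off the curve, and 1 around 0, so the
   integral of dw / w - dw / (w - u) = dw / (w (1 - w / u)) over 2 pi i is nonnegative.
   Integrating this against |u|^(-2 lambda - 2) over the plane in polar coordinates
   u = e^(s + i phi) and exchanging the integrals gives the claim, because the mean over phi
   of 1 / (1 - w / u) is 1 for |w| < |u| and 0 for |w| > |u|. Instead of the singular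
   kernel, its truncation at distance d is used: the points u at distance O(d) from the
   curve have area O(d), and there the truncated integral is o(1 / d), since the curve is
   injective. *)
Require Import Defs.
From Stdlib Require Import Reals ZArith Factorial Lra Lia Psatz ClassicalEpsilon FunctionalExtensionality.
From Coquelicot Require Import Coquelicot.
Open Scope R_scope.


(** * Complex derivatives and the exponential *)

(** The Jordan curve theorem is avoided: the image of a circle enters only as a Lipschitz loop
    without self-intersections, and its winding number around a point u off the loop is found by
    counting the solutions of G z = u, of which univalence allows at most one. The price is paid
    near the loop, where the truncated integral may be negative, though not below -o(1/d). There a
    nonnegative bump is added, whose integral along the loop is of order d; with a coefficient of
    order e/d^2 it restores positivity. For a fixed point of the loop the bump has mass of order d^2
    in (s, phi), so the total cost is of order e, whatever d is. The same o(1/d), applied to the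
    unit circle as loop, controls the mean over phi where |w| and |u| are nearly equal. Branches are
    carried by logarithms: each power is exp(lambda l) with l holomorphic and l(0) = 0, and the
    relation exp(l) G = K z is kept free of divisions. The principal branch of the definition has to
    be matched only near the centre, where l is small. *)

Definition cderiv (f : C -> C) (z l : C) : Prop :=
  is_derive (K := C_AbsRing) (V := C_NormedModule) f z l.

(** Epsilon-delta in terms of [Cmod], so that the choice of a uniform structure on [C] never
    matters. *)
Definition ccont (f : C -> C) (z : C) : Prop :=
  forall e, 0 < e -> exists d, 0 < d /\
    forall w, Cmod (w - z) < d -> Cmod (f w - f z) < e.

Definition rcont (f : R -> C) (x : R) : Prop :=
  forall e, 0 < e -> exists d, 0 < d /\
    forall y, Rabs (y - x) < d -> Cmod (f y - f x) < e.

(** Balls of [C_UniformSpace] are squares; the one of half-side [d / sqrt 2] lies in the disc of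
    radius [d]. *)
Lemma locally_C_intro (z : C) (P : C -> Prop) (d : R) :
  0 < d -> (forall w, Cmod (w - z) < d -> P w) -> locally (T := C_UniformSpace) z P.
Proof.
intros Hd H.
assert (Hs : 0 < sqrt 2) by (apply sqrt_lt_R0; lra).
assert (He : 0 < d / sqrt 2) by (apply Rdiv_lt_0_compat; lra).
exists (mkposreal _ He); intros w Hw.
apply H.
assert (H2 := C_NormedModule_mixin_compat2 z w (mkposreal _ He) Hw).
simpl in H2. replace (sqrt 2 * (d / sqrt 2)) with d in H2 by (field; lra).
exact H2.
Qed.

Lemma locally_C_elim (z : C) (P : C -> Prop) :
  locally (T := C_UniformSpace) z P ->
  exists d, 0 < d /\ forall w, Cmod (w - z) < d -> P w.
Proof.
intros [e He]. exists e; split; [apply cond_pos|].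
intros w Hw; apply He.
apply C_NormedModule_mixin_compat1; exact Hw.
Qed.

Lemma locally_AbsC_elim (z : C) (P : C -> Prop) :
  locally (T := AbsRing_UniformSpace C_AbsRing) z P ->
  exists d, 0 < d /\ forall w, Cmod (w - z) < d -> P w.
Proof.
intros [e He]. exists e; split; [apply cond_pos|].
intros w Hw; apply He. exact Hw.
Qed.

Lemma locally_AbsC_intro (z : C) (P : C -> Prop) (d : R) :
  0 < d -> (forall w, Cmod (w - z) < d -> P w) ->
  locally (T := AbsRing_UniformSpace C_AbsRing) z P.
Proof.
intros Hd H. exists (mkposreal _ Hd). intros w Hw; apply H; exact Hw.
Qed.

Lemma cderiv_eps (f : C -> C) (z l : C) :
  cderiv f z l <->
  forall e, 0 < e -> exists d, 0 < d /\
    forall w, Cmod (w - z) < d -> Cmod (f w - f z - l * (w - z)) <= e * Cmod (w - z).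
Proof.
split.
- intros [_ H] e He.
  assert (H0 := H z (fun P HP => HP) (mkposreal _ He)).
  apply locally_AbsC_elim in H0. destruct H0 as [d [Hd H0]].
  exists d; split; [exact Hd|]. intros w Hw.
  generalize (H0 w Hw). 
  change (Cmod (f w - f z - (w - z) * l) <= e * Cmod (w - z) ->
    Cmod (f w - f z - l * (w - z)) <= e * Cmod (w - z)).
  now rewrite (Cmult_comm (w - z) l).
- intros H. split.
  + apply is_linear_scal_l.
  + intros x Hx. 
    assert (Hxz : z = x).
    { apply (is_filter_lim_locally_unique (K:=C_AbsRing) (V := AbsRing_NormedModule C_AbsRing)). exact Hx. }
    subst x. intros e. destruct (H e (cond_pos e)) as [d [Hd H0]].
    apply (locally_AbsC_intro _ _ d Hd). intros w Hw.
    change (Cmod (f w - f z - (w - z) * l) <= e * Cmod (w - z)).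
    rewrite (Cmult_comm (w - z) l). now apply H0.
Qed.

Lemma cderiv_unique (f : C -> C) (z l l' : C) :
  cderiv f z l -> cderiv f z l' -> l = l'.
Proof.
intros H H'. rewrite <- (is_C_derive_unique f z l H).
now apply is_C_derive_unique.
Qed.

Lemma cderiv_const (c z : C) : cderiv (fun _ => c) z 0.
Proof. exact (is_derive_const (K := C_AbsRing) (V := C_NormedModule) c z). Qed.

(* [C] carries two uniform structures in Coquelicot, the product one and the one
   induced by [Cmod]; the library product rule only speaks about the second. *)
Lemma cderiv_AbsRing (f : C -> C) (z l : C) :
  cderiv f z l <->
  is_derive (K := C_AbsRing) (V := AbsRing_NormedModule C_AbsRing) f z l.
Proof.
split.
- intros H. rewrite cderiv_eps in H. split.
  + apply (is_linear_scal_l (V := AbsRing_NormedModule C_AbsRing)).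
  + intros x Hx.
    assert (Hxz : z = x).
    { apply (is_filter_lim_locally_unique (K:=C_AbsRing) (V := AbsRing_NormedModule C_AbsRing)). exact Hx. }
    subst x. intros e. destruct (H e (cond_pos e)) as [d [Hd H0]].
    apply (locally_AbsC_intro _ _ d Hd). intros w Hw.
    change (Cmod (f w - f z - (w - z) * l) <= e * Cmod (w - z)).
    rewrite (Cmult_comm (w - z) l). now apply H0.
- intros [_ H]. apply cderiv_eps. intros e He.
  assert (H0 := H z (fun P HP => HP) (mkposreal _ He)).
  apply locally_AbsC_elim in H0. destruct H0 as [d [Hd H0]].
  exists d; split; [exact Hd|]. intros w Hw.
  generalize (H0 w Hw).
  change (Cmod (f w - f z - (w - z) * l) <= e * Cmod (w - z) ->
    Cmod (f w - f z - l * (w - z)) <= e * Cmod (w - z)).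
  now rewrite (Cmult_comm (w - z) l).
Qed.

Lemma cderiv_id (z : C) : cderiv (fun w => w) z 1.
Proof. apply cderiv_AbsRing. exact (is_derive_id (K := C_AbsRing) z). Qed.

Lemma cderiv_plus (f g : C -> C) (z a b : C) :
  cderiv f z a -> cderiv g z b -> cderiv (fun w => f w + g w)%C z (a + b)%C.
Proof. exact (is_derive_plus (K := C_AbsRing) (V := C_NormedModule) f g z a b). Qed.

Lemma cderiv_mult (f g : C -> C) (z a b : C) :
  cderiv f z a -> cderiv g z b ->
  cderiv (fun w => f w * g w)%C z (a * g z + f z * b)%C.
Proof.
rewrite !cderiv_AbsRing. intros Hf Hg.
exact (is_derive_mult (K := C_AbsRing) f g z a b Hf Hg Cmult_comm).
Qed.

Lemma cderiv_comp (f g : C -> C) (z a b : C) :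
  cderiv f (g z) a -> cderiv g z b -> cderiv (fun w => f (g w)) z (b * a)%C.
Proof.
intros Hf Hg. apply cderiv_AbsRing in Hg.
exact (is_derive_comp (K := C_AbsRing) (V := C_NormedModule) f g z a b Hf Hg).
Qed.

Lemma cderiv_scal (c : C) (f : C -> C) (z a : C) :
  cderiv f z a -> cderiv (fun w => c * f w)%C z (c * a)%C.
Proof.
intros H. replace (c * a)%C with (0 * f z + c * a)%C by ring.
apply (cderiv_mult (fun _ => c)); [apply cderiv_const|exact H].
Qed.

Lemma cderiv_ext_loc (f g : C -> C) (z l : C) (r : R) :
  0 < r -> (forall w, Cmod (w - z) < r -> f w = g w) ->
  cderiv f z l -> cderiv g z l.
Proof.
intros Hr He H. apply cderiv_eps. rewrite cderiv_eps in H.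
intros e Hep. destruct (H e Hep) as [d [Hd H1]].
exists (Rmin d r). split; [now apply Rmin_glb_lt|].
intros w Hw. rewrite <- (He w), <- (He z).
- apply H1. eapply Rlt_le_trans; [exact Hw|apply Rmin_l].
- replace (z - z)%C with (RtoC 0) by ring. now rewrite Cmod_0.
- eapply Rlt_le_trans; [exact Hw|apply Rmin_r].
Qed.

Lemma cderiv_ext (f g : C -> C) (z l l' : C) :
  (forall w, f w = g w) -> l = l' -> cderiv f z l -> cderiv g z l'.
Proof.
intros H <-. apply (cderiv_ext_loc f g z l 1 Rlt_0_1). intros; apply H.
Qed.

Lemma Cmod_triangle_sub (a b c : C) : Cmod (a - c) <= Cmod (a - b) + Cmod (b - c).
Proof.
replace (a - c)%C with ((a - b) + (b - c))%C by ring. apply Cmod_triangle.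
Qed.

Lemma Cmod_sub_comm (a b : C) : Cmod (a - b) = Cmod (b - a).
Proof. rewrite <- Cmod_opp. f_equal; ring. Qed.

Lemma Cmod_triangle_inv (a b : C) : Cmod a - Cmod b <= Cmod (a - b).
Proof.
assert (H := Cmod_triangle (a - b) b). replace (a - b + b)%C with a in H by ring. lra.
Qed.

Lemma Cmod_0_lt (z : C) : z <> 0 -> 0 < Cmod z.
Proof. apply Cmod_gt_0. Qed.

Lemma cderiv_cont (f : C -> C) (z l : C) : cderiv f z l -> ccont f z.
Proof.
intros H e He. rewrite cderiv_eps in H.
destruct (H 1 Rlt_0_1) as [d [Hd H1]].
assert (Hl := Cmod_ge_0 l).
assert (Hk : 0 < e / (2 + Cmod l)) by (apply Rdiv_lt_0_compat; lra).
exists (Rmin d (e / (2 + Cmod l))). split; [now apply Rmin_glb_lt|].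
intros w Hw.
assert (Hw1 : Cmod (w - z) < d) by (eapply Rlt_le_trans; [exact Hw|apply Rmin_l]).
assert (Hw2 : Cmod (w - z) < e / (2 + Cmod l)) by (eapply Rlt_le_trans; [exact Hw|apply Rmin_r]).
specialize (H1 w Hw1).
assert (H2 := Cmod_triangle (f w - f z - l * (w - z)) (l * (w - z))).
replace (f w - f z - l * (w - z) + l * (w - z))%C with (f w - f z)%C in H2 by ring.
rewrite Cmod_mult in H2.
assert (H3 : Cmod (w - z) * (2 + Cmod l) < e).
{ apply Rlt_div_r in Hw2; lra. }
assert (H4 := Cmod_ge_0 (w - z)). nra.
Qed.

Lemma ccont_const (c z : C) : ccont (fun _ => c) z.
Proof. exact (cderiv_cont _ _ _ (cderiv_const c z)). Qed.

Lemma cderiv_inv_id (z : C) : z <> 0 -> cderiv (fun w => / w)%C z (- / (z * z))%C.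
Proof.
intros Hz. apply cderiv_eps. intros e He.
assert (Hm := Cmod_0_lt z Hz). set (m := Cmod z) in *.
assert (Hp : 0 < e * (m * m * m) / 2).
{ apply Rdiv_lt_0_compat; [|lra]. repeat apply Rmult_lt_0_compat; assumption. }
(* The error is (w - z)^2 / (w z^2). The first radius keeps |w| above m / 2, so the error is at most
   2 |w - z|^2 / m^3, whence the second radius. *)
exists (Rmin (m / 2) (e * (m * m * m) / 2)).
split; [apply Rmin_glb_lt; lra|].
intros w Hw.
assert (Hw1 : Cmod (w - z) < m / 2) by (eapply Rlt_le_trans; [exact Hw|apply Rmin_l]).
assert (Hw2 : Cmod (w - z) < e * (m * m * m) / 2) by (eapply Rlt_le_trans; [exact Hw|apply Rmin_r]).
assert (Hwm : m / 2 < Cmod w).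
{ assert (H := Cmod_triangle_inv z w). rewrite Cmod_sub_comm in H. fold m in H. lra. }
assert (Hw0 : w <> 0) by (apply Cmod_gt_0; lra).
replace (/ w - / z - - / (z * z) * (w - z))%C with ((w - z) * ((w - z) / (w * z * z)))%C
  by (field; auto).
rewrite Cmod_mult, Rmult_comm. apply Rmult_le_compat_r; [apply Cmod_ge_0|].
rewrite Cmod_div by (repeat apply Cmult_neq_0; assumption).
rewrite !Cmod_mult. fold m.
assert (0 < m * m) by nra.
apply Rle_div_l; [apply Rmult_lt_0_compat; nra|].
assert (m / 2 * (m * m) <= Cmod w * (m * m)) by (apply Rmult_le_compat_r; lra).
assert (e * (m / 2 * (m * m)) <= e * (Cmod w * (m * m))) by (apply Rmult_le_compat_l; lra).
nra.
Qed.

Lemma cderiv_inv (f : C -> C) (z l : C) :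
  f z <> 0 -> cderiv f z l -> cderiv (fun w => / f w)%C z (- l / (f z * f z))%C.
Proof.
intros H0 H.
apply (cderiv_ext (fun w => / f w)%C _ _ (l * - / (f z * f z))%C); auto.
- field; auto.
- now apply (cderiv_comp (fun w => / w)%C f); [apply cderiv_inv_id|].
Qed.

Lemma cderiv_minus (f g : C -> C) (z a b : C) :
  cderiv f z a -> cderiv g z b -> cderiv (fun w => f w - g w)%C z (a - b)%C.
Proof.
intros Hf Hg.
apply (cderiv_ext (fun w => f w + (-(1)) * g w)%C _ _ (a + (-(1)) * b)%C);
 [intros; ring|ring|].
apply cderiv_plus; [assumption|now apply cderiv_scal].
Qed.

Lemma Cexp_plus (a b : C) : Cexp (a + b) = (Cexp a * Cexp b)%C.
Proof.
unfold Cexp. destruct a as [a1 a2], b as [b1 b2]; simpl.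
rewrite exp_plus, cos_plus, sin_plus.
unfold Cmult; simpl. f_equal; ring.
Qed.

Lemma Cexp_0 : Cexp 0 = 1.
Proof. unfold Cexp; simpl. rewrite exp_0, cos_0, sin_0. unfold RtoC. f_equal; ring. Qed.

Lemma Cmod_Cexp (z : C) : Cmod (Cexp z) = exp (Re z).
Proof.
unfold Cexp, Cmod; simpl.
replace (_ + _) with (exp (Re z) * exp (Re z) * (Rsqr (sin (Im z)) + Rsqr (cos (Im z)))) by (unfold Rsqr; ring).
rewrite sin2_cos2, Rmult_1_r. apply sqrt_square. left; apply exp_pos.
Qed.

Lemma Cexp_neq_0 (z : C) : Cexp z <> 0.
Proof. apply Cmod_gt_0. rewrite Cmod_Cexp. apply exp_pos. Qed.

Lemma Cexp_opp (z : C) : Cexp (- z) = (/ Cexp z)%C.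
Proof.
assert (H : (Cexp (- z) * Cexp z)%C = 1).
{ rewrite <- Cexp_plus. replace (- z + z)%C with (RtoC 0) by ring. apply Cexp_0. }
rewrite <- (Cmult_1_l (/ Cexp z)), <- H. field. apply Cexp_neq_0.
Qed.

Lemma Cmod_le_Rabs (z : C) : Cmod z <= Rabs (fst z) + Rabs (snd z).
Proof.
destruct z as [x y]; simpl.
replace ((x, y) : C) with (RtoC x + Ci * RtoC y)%C
 by (unfold RtoC, Ci, Cmult, Cplus; simpl; f_equal; ring).
eapply Rle_trans; [apply Cmod_triangle|].
rewrite Cmod_mult, Cmod_Ci, !Cmod_R. lra.
Qed.

Lemma Rabs_fst_le (z : C) : Rabs (fst z) <= Cmod z.
Proof. eapply Rle_trans; [|apply Rmax_Cmod]. apply Rmax_l. Qed.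

Lemma Rabs_snd_le (z : C) : Rabs (snd z) <= Cmod z.
Proof. eapply Rle_trans; [|apply Rmax_Cmod]. apply Rmax_r. Qed.

Lemma rderiv_0_eps (f : R -> R) (l : R) :
  is_derive f 0 l -> forall e, 0 < e -> exists d, 0 < d /\
   forall x, Rabs x < d -> Rabs (f x - f 0 - l * x) <= e * Rabs x.
Proof.
intros H e He. apply is_derive_Reals in H.
destruct (H e He) as [d Hd]. exists d; split; [apply cond_pos|].
intros x Hx. destruct (Req_dec x 0) as [->|Hx0].
- replace (f 0 - f 0 - l * 0) with 0 by ring. rewrite Rabs_R0. lra.
- specialize (Hd x Hx0 Hx). rewrite Rplus_0_l in Hd.
  replace (f x - f 0 - l * x) with (((f x - f 0) / x - l) * x) by (field; auto).
  rewrite Rabs_mult. apply Rmult_le_compat_r; [apply Rabs_pos|lra].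
Qed.

Lemma cderiv_Cexp_0 : cderiv Cexp 0 1.
Proof.
apply cderiv_eps. intros e He.
assert (He3 : 0 < Rmin (e / 8) 1) by (apply Rmin_glb_lt; lra).
(* The two coordinates of the error add up to at most seven terms [e' * m], hence the 8; the bound 1
   keeps |1 + x| below 2. *)
set (e' := Rmin (e / 8) 1) in *.
assert (He' : e' <= e / 8) by apply Rmin_l.
assert (He1 : e' <= 1) by apply Rmin_r.
clearbody e'.
destruct (rderiv_0_eps exp 1) with (e := e') as [d1 [Hd1 H1]]; [|assumption|].
{ replace 1 with (exp 0) by apply exp_0. apply is_derive_exp. }
destruct (rderiv_0_eps cos 0) with (e := e') as [d2 [Hd2 H2]]; [|assumption|].
{ replace 0 with (- sin 0) at 2 by (rewrite sin_0; ring). apply is_derive_cos. }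
destruct (rderiv_0_eps sin 1) with (e := e') as [d3 [Hd3 H3]]; [|assumption|].
{ replace 1 with (cos 0) by apply cos_0. apply is_derive_sin. }
assert (Hd : 0 < Rmin (Rmin d1 d2) (Rmin d3 e')).
{ repeat apply Rmin_glb_lt; assumption. }
exists (Rmin (Rmin d1 d2) (Rmin d3 e')). split; [exact Hd|].
intros [x y] Hw. rewrite Cexp_0.
replace ((x, y) - 0)%C with ((x, y) : C) in * by (unfold RtoC, Cminus, Cplus, Copp; simpl; f_equal; ring).
set (h := ((x, y) : C)) in *. set (m := Cmod h) in *.
assert (Hmin1 := Rmin_l (Rmin d1 d2) (Rmin d3 e')).
assert (Hmin2 := Rmin_r (Rmin d1 d2) (Rmin d3 e')).
assert (Hmin3 := Rmin_l d1 d2). assert (Hmin4 := Rmin_r d1 d2).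
assert (Hmin5 := Rmin_l d3 e'). assert (Hmin6 := Rmin_r d3 e').
assert (Hx : Rabs x <= m) by apply (Rabs_fst_le h).
assert (Hy : Rabs y <= m) by apply (Rabs_snd_le h).
specialize (H1 x ltac:(lra)). specialize (H2 y ltac:(lra)). specialize (H3 y ltac:(lra)).
rewrite exp_0 in H1. rewrite cos_0 in H2. rewrite sin_0 in H3.
assert (Hm : m < e') by lra.
assert (Hm0 : 0 <= m) by apply Cmod_ge_0.
eapply Rle_trans; [apply Cmod_le_Rabs|].
unfold Cexp, h; simpl.
(* Each coordinate is rewritten so that every term contains a first-order remainder of exp, cos or
   sin; the only other term is x y, small because |x| <= e'. *)
replace (exp x * cos y + - (1) + - (1 * x - 0 * y))
  with ((exp x - 1 - 1 * x) * cos y + (1 + x) * (cos y - 1 - 0 * y) ) by ring.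
replace (exp x * sin y + - 0 + - (1 * y + 0 * x))
  with ((exp x - 1 - 1 * x) * sin y + (sin y - 0 - 1 * y) + x * (sin y - 0 - 1 * y) + x * y) by ring.
assert (Hc : Rabs (cos y) <= 1) by (apply Rabs_le; split; apply COS_bound).
assert (Hs : Rabs (sin y) <= 1) by (apply Rabs_le; split; apply SIN_bound).
assert (P : forall a b p q, Rabs a <= p -> Rabs b <= q -> Rabs (a * b) <= p * q).
{ intros. rewrite Rabs_mult. apply Rmult_le_compat; auto using Rabs_pos. }
assert (Em : e' * Rabs x <= e' * m) by (apply Rmult_le_compat_l; lra).
assert (Em' : e' * Rabs y <= e' * m) by (apply Rmult_le_compat_l; lra).
assert (H1x : Rabs (1 + x) <= 2).
{ eapply Rle_trans; [apply Rabs_triang|]. rewrite Rabs_R1; lra. }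
assert (Q1 := P _ _ _ _ H1 Hc). assert (Q2 := P _ _ _ _ H1x H2).
assert (Q3 := P _ _ _ _ H1 Hs).
assert (Hx1 : Rabs x <= 1) by lra.
assert (Q4 := P _ _ _ _ Hx1 H3).
assert (Hxe : Rabs x <= e') by lra.
assert (Q5 := P _ _ _ _ Hxe Hy).
assert (T1 := Rabs_triang ((exp x - 1 - 1 * x) * cos y) ((1 + x) * (cos y - 1 - 0 * y))).
assert (T2 := Rabs_triang ((exp x - 1 - 1 * x) * sin y + (sin y - 0 - 1 * y) + x * (sin y - 0 - 1 * y)) (x * y)).
assert (T3 := Rabs_triang ((exp x - 1 - 1 * x) * sin y + (sin y - 0 - 1 * y)) (x * (sin y - 0 - 1 * y))).
assert (T4 := Rabs_triang ((exp x - 1 - 1 * x) * sin y) (sin y - 0 - 1 * y)).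
assert (e' * m <= e / 8 * m) by (apply Rmult_le_compat_r; lra).
clearbody m. clear - T1 T2 T3 T4 Em Em' Q1 Q2 Q3 Q4 Q5 H H3.
assert (0 <= e' * Rabs x).
{ assert (0 <= Rabs ((exp x - 1 - 1 * x) * cos y)) by apply Rabs_pos. lra. }
lra.
Qed.

Lemma cderiv_Cexp (z : C) : cderiv Cexp z (Cexp z).
Proof.
apply (cderiv_ext (fun w => Cexp z * Cexp (w - z))%C _ _ (Cexp z * ((1 - 0) * 1))%C).
- intros w. rewrite <- Cexp_plus. f_equal; ring.
- ring.
- apply cderiv_scal. apply (cderiv_comp Cexp (fun w => w - z)%C).
  + replace (z - z)%C with (RtoC 0) by ring. apply cderiv_Cexp_0.
  + apply cderiv_minus; [apply cderiv_id|apply cderiv_const].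
Qed.


(** * Integrals of complex functions of a real variable *)

Lemma rcont_continuous (f : R -> C) (x : R) :
  rcont f x -> continuous (U := C_R_NormedModule) f x.
Proof.
intros H P [e He].
destruct (H e (cond_pos e)) as [d [Hd H1]].
exists (mkposreal d Hd). intros y Hy. apply He.
apply C_NormedModule_mixin_compat1. apply H1. exact Hy.
Qed.

Lemma rcont_comp (f : C -> C) (h : R -> C) (x : R) :
  ccont f (h x) -> rcont h x -> rcont (fun t => f (h t)) x.
Proof.
intros Hf Hh e He. destruct (Hf e He) as [d [Hd H1]].
destruct (Hh d Hd) as [d' [Hd' H2]]. exists d'; split; auto.
Qed.

Lemma rcont_const (c : C) (x : R) : rcont (fun _ => c) x.
Proof.
intros e He. exists 1; split; [lra|]. intros.
replace (c - c)%C with (RtoC 0) by ring. now rewrite Cmod_0.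
Qed.

Lemma rcont_plus (f g : R -> C) (x : R) :
  rcont f x -> rcont g x -> rcont (fun t => f t + g t)%C x.
Proof.
intros Hf Hg e He.
destruct (Hf (e/2) ltac:(lra)) as [d [Hd H1]].
destruct (Hg (e/2) ltac:(lra)) as [d' [Hd' H2]].
exists (Rmin d d'). split; [now apply Rmin_glb_lt|]. intros y Hy.
replace (f y + g y - (f x + g x))%C with ((f y - f x) + (g y - g x))%C by ring.
eapply Rle_lt_trans; [apply Cmod_triangle|].
assert (Cmod (f y - f x) < e/2) by (apply H1; eapply Rlt_le_trans; [exact Hy|apply Rmin_l]).
assert (Cmod (g y - g x) < e/2) by (apply H2; eapply Rlt_le_trans; [exact Hy|apply Rmin_r]).
lra.
Qed.

Lemma rcont_mult (f g : R -> C) (x : R) :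
  rcont f x -> rcont g x -> rcont (fun t => f t * g t)%C x.
Proof.
intros Hf Hg e He.
set (M := Cmod (f x) + Cmod (g x) + 1).
assert (Ha := Cmod_ge_0 (f x)). assert (Hb := Cmod_ge_0 (g x)).
assert (HM : 0 < M) by (unfold M; lra).
assert (Hk : 0 < Rmin 1 (e / (2 * M))).
{ apply Rmin_glb_lt; [lra|]. apply Rdiv_lt_0_compat; lra. }
destruct (Hf _ Hk) as [d [Hd H1]]. destruct (Hg _ Hk) as [d' [Hd' H2]].
exists (Rmin d d'). split; [now apply Rmin_glb_lt|]. intros y Hy.
replace (f y * g y - (f x * g x))%C
 with ((f y - f x) * (g y - g x) + ((f y - f x) * g x + f x * (g y - g x)))%C by ring.
specialize (H1 y ltac:(eapply Rlt_le_trans; [exact Hy|apply Rmin_l])).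
specialize (H2 y ltac:(eapply Rlt_le_trans; [exact Hy|apply Rmin_r])).
set (k := Rmin 1 (e / (2 * M))) in *.
assert (Hk1 : k <= 1) by apply Rmin_l.
assert (Hk2 : k <= e / (2 * M)) by apply Rmin_r.
eapply Rle_lt_trans; [apply Cmod_triangle|].
eapply Rle_lt_trans; [apply Rplus_le_compat_l, Cmod_triangle|].
rewrite !Cmod_mult.
assert (HkM : k * M <= e / 2).
{ replace (e / 2) with (e / (2 * M) * M) by (field; lra). apply Rmult_le_compat_r; lra. }
unfold M in HkM.
assert (H3 := Cmod_ge_0 (f y - f x)). assert (H4 := Cmod_ge_0 (g y - g x)).
assert (Cmod (f y - f x) * Cmod (g y - g x) <= k * 1).
{ apply Rmult_le_compat; lra. }
assert (Cmod (f y - f x) * Cmod (g x) <= k * Cmod (g x)) by (apply Rmult_le_compat_r; lra).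
assert (Cmod (f x) * Cmod (g y - g x) <= Cmod (f x) * k) by (apply Rmult_le_compat_l; lra).
lra.
Qed.

Lemma rcont_opp (f : R -> C) (x : R) : rcont f x -> rcont (fun t => - f t)%C x.
Proof.
intros Hf e He. destruct (Hf e He) as [d [Hd H]].
exists d; split; [exact Hd|]. intros y Hy.
replace (- f y - - f x)%C with (- (f y - f x))%C by ring. rewrite Cmod_opp. auto.
Qed.

Lemma rcont_minus (f g : R -> C) (x : R) :
  rcont f x -> rcont g x -> rcont (fun t => f t - g t)%C x.
Proof. intros Hf Hg. apply rcont_plus; [exact Hf|now apply rcont_opp]. Qed.

Lemma rcont_inv (f : R -> C) (x : R) :
  f x <> 0 -> rcont f x -> rcont (fun t => / f t)%C x.
Proof.
intros H0 Hf. apply (rcont_comp Cinv f); [|exact Hf].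
exact (cderiv_cont _ _ _ (cderiv_inv_id _ H0)).
Qed.

Lemma rcont_conj (f : R -> C) (x : R) : rcont f x -> rcont (fun t => Cconj (f t)) x.
Proof.
intros Hf e He. destruct (Hf e He) as [d [Hd H]].
exists d; split; [exact Hd|]. intros y Hy.
replace (Cconj (f y) - Cconj (f x))%C with (Cconj (f y - f x)).
- rewrite Cmod_conj. auto.
- unfold Cconj, Cminus, Cplus, Copp; simpl; f_equal; ring.
Qed.

Lemma rcont_pair (f g : R -> R) (x : R) :
  continuity_pt f x -> continuity_pt g x -> rcont (fun t => (f t, g t)) x.
Proof.
intros Hf Hg e He.
destruct (Hf (e/2) ltac:(lra)) as [d [Hd H1]].
destruct (Hg (e/2) ltac:(lra)) as [d' [Hd' H2]].
exists (Rmin d d'). split; [now apply Rmin_glb_lt|]. intros y Hy.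
assert (G : forall k dd, (forall x0, D_x no_cond x x0 /\ R_dist x0 x < dd ->
    R_dist (k x0) (k x) < e/2) -> Rabs (y - x) < dd -> Rabs (k y - k x) < e / 2).
{ intros k dd Hk Hyd. destruct (Req_dec y x) as [->|Hne].
  - replace (k x - k x) with 0 by ring. rewrite Rabs_R0. lra.
  - apply Hk. split; [|exact Hyd]. split; [exact I|auto]. }
eapply Rle_lt_trans; [apply Cmod_le_Rabs|]. simpl.
assert (A := G f d H1 ltac:(eapply Rlt_le_trans; [exact Hy|apply Rmin_l])).
assert (B := G g d' H2 ltac:(eapply Rlt_le_trans; [exact Hy|apply Rmin_r])).
unfold Rminus in A, B. lra.
Qed.

Lemma continuity_pt_cst (c x : R) : continuity_pt (fun _ => c) x.
Proof. apply continuity_pt_const. intros a b; reflexivity. Qed.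

Ltac continuity_elem :=
  apply derivable_continuous_pt; eexists; apply is_derive_Reals; auto_derive; [auto|reflexivity].

Lemma rcont_RtoC (f : R -> R) (x : R) : continuity_pt f x -> rcont (fun t => RtoC (f t)) x.
Proof.
intros H. apply rcont_pair; [exact H|].
apply continuity_pt_cst.
Qed.

Lemma rcont_eps_pt (f : R -> R) (x : R) :
  (forall e, 0 < e -> exists d, 0 < d /\ forall y, Rabs (y - x) < d -> Rabs (f y - f x) < e) ->
  continuity_pt f x.
Proof.
intros H e He. destruct (H e He) as [d [Hd H1]]. exists d; split; [exact Hd|].
intros y [_ Hy]. apply H1, Hy.
Qed.

Lemma rcont_fst (f : R -> C) (x : R) : rcont f x -> continuity_pt (fun t => fst (f t)) x.
Proof.
intros H. apply rcont_eps_pt. intros e He. destruct (H e He) as [d [Hd H1]].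
exists d; split; [exact Hd|]. intros y Hy.
eapply Rle_lt_trans; [|apply H1, Hy]. apply (Rabs_fst_le (f y - f x)).
Qed.

Lemma rcont_snd (f : R -> C) (x : R) : rcont f x -> continuity_pt (fun t => snd (f t)) x.
Proof.
intros H. apply rcont_eps_pt. intros e He. destruct (H e He) as [d [Hd H1]].
exists d; split; [exact Hd|]. intros y Hy.
eapply Rle_lt_trans; [|apply H1, Hy]. apply (Rabs_snd_le (f y - f x)).
Qed.

Lemma rcont_Cmod (f : R -> C) (x : R) : rcont f x -> continuity_pt (fun t => Cmod (f t)) x.
Proof.
intros H. apply rcont_eps_pt. intros e He. destruct (H e He) as [d [Hd H1]].
exists d; split; [exact Hd|]. intros y Hy.
eapply Rle_lt_trans; [|apply H1, Hy].
apply Rabs_le. assert (A := Cmod_triangle_inv (f y) (f x)).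
assert (B := Cmod_triangle_inv (f x) (f y)). rewrite Cmod_sub_comm in B. lra.
Qed.

Definition CInt (f : R -> C) (a b : R) : C := RInt (V := C_R_CompleteNormedModule) f a b.
Definition is_CInt (f : R -> C) (a b : R) (l : C) : Prop :=
  is_RInt (V := C_R_NormedModule) f a b l.
Definition rcont_on (f : R -> C) (a b : R) : Prop := forall x, a <= x <= b -> rcont f x.

Lemma is_CInt_unique (f : R -> C) (a b : R) (l : C) : is_CInt f a b l -> CInt f a b = l.
Proof. exact (is_RInt_unique (V := C_R_CompleteNormedModule) f a b l). Qed.

Lemma CInt_correct (f : R -> C) (a b : R) :
  a <= b -> rcont_on f a b -> is_CInt f a b (CInt f a b).
Proof.
intros Hab H. apply (RInt_correct (V := C_R_CompleteNormedModule)).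
apply (ex_RInt_continuous (V := C_R_CompleteNormedModule)). intros x.
rewrite Rmin_left, Rmax_right by exact Hab. intros Hx. now apply rcont_continuous, H.
Qed.

Lemma is_CInt_pair (f : R -> C) (a b p q : R) :
  is_RInt (fun t => fst (f t)) a b p -> is_RInt (fun t => snd (f t)) a b q ->
  is_CInt f a b (p, q).
Proof. exact (is_RInt_fct_extend_pair (U := R_NormedModule) (V := R_NormedModule) f a b p q). Qed.

Lemma is_CInt_fst (f : R -> C) (a b : R) (l : C) :
  is_CInt f a b l -> is_RInt (fun t => fst (f t)) a b (fst l).
Proof. exact (is_RInt_fct_extend_fst (U := R_NormedModule) (V := R_NormedModule) f a b l). Qed.

Lemma is_CInt_snd (f : R -> C) (a b : R) (l : C) :
  is_CInt f a b l -> is_RInt (fun t => snd (f t)) a b (snd l).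
Proof. exact (is_RInt_fct_extend_snd (U := R_NormedModule) (V := R_NormedModule) f a b l). Qed.

Lemma is_CInt_plus (f g : R -> C) (a b : R) (l m : C) :
  is_CInt f a b l -> is_CInt g a b m -> is_CInt (fun t => f t + g t)%C a b (l + m)%C.
Proof. exact (is_RInt_plus (V := C_R_NormedModule) f g a b l m). Qed.

(** The integral is taken in a real normed module, so a complex factor is distributed over the two
    coordinates. *)
Lemma is_CInt_scal (c : C) (f : R -> C) (a b : R) (l : C) :
  is_CInt f a b l -> is_CInt (fun t => c * f t)%C a b (c * l)%C.
Proof.
intros H. assert (H1 := is_CInt_fst _ _ _ _ H). assert (H2 := is_CInt_snd _ _ _ _ H).
assert (A := fun k => is_RInt_scal _ _ _ k _ H1). assert (B := fun k => is_RInt_scal _ _ _ k _ H2).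
apply is_CInt_pair.
- exact (is_RInt_minus _ _ _ _ _ _ (A (fst c)) (B (snd c))).
- exact (is_RInt_plus _ _ _ _ _ _ (B (fst c)) (A (snd c))).
Qed.

Lemma is_CInt_minus (f g : R -> C) (a b : R) (l m : C) :
  is_CInt f a b l -> is_CInt g a b m -> is_CInt (fun t => f t - g t)%C a b (l - m)%C.
Proof. exact (is_RInt_minus (V := C_R_NormedModule) f g a b l m). Qed.

Lemma is_CInt_const (c : C) (a b : R) : is_CInt (fun _ => c) a b (RtoC (b - a) * c)%C.
Proof.
assert (H := is_RInt_const (V := C_R_NormedModule) a b c).
replace (RtoC (b - a) * c)%C with (scal (V := C_R_NormedModule) (b - a) c); [exact H|].
destruct c; unfold RtoC, Cmult; simpl.
unfold scal; simpl; unfold prod_scal; simpl; unfold scal; simpl; unfold mult; simpl.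
f_equal; ring.
Qed.

Lemma is_CInt_ext (f g : R -> C) (a b : R) (l : C) :
  a <= b -> (forall t, a <= t <= b -> f t = g t) -> is_CInt f a b l -> is_CInt g a b l.
Proof.
intros Hab H. apply (is_RInt_ext (V := C_R_NormedModule)). intros t.
rewrite Rmin_left, Rmax_right by exact Hab. intros Ht. apply H; lra.
Qed.

Lemma is_CInt_Chasles (f : R -> C) (a b c : R) (l m : C) :
  is_CInt f a b l -> is_CInt f b c m -> is_CInt f a c (l + m)%C.
Proof. exact (is_RInt_Chasles (V := C_R_NormedModule) f a b c l m). Qed.

Lemma Cmod_prod_norm (x : C) : Cmod x = norm (V := C_R_NormedModule) x.
Proof. exact (Cmod_norm x). Qed.

Lemma is_CInt_bound (f : R -> C) (g : R -> R) (a b : R) (l : C) (m : R) :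
  a <= b -> (forall t, a <= t <= b -> Cmod (f t) <= g t) ->
  is_CInt f a b l -> is_RInt g a b m -> Cmod l <= m.
Proof.
intros Hab H Hf Hg. rewrite Cmod_prod_norm.
apply (norm_RInt_le (V := C_R_NormedModule) f g a b l m Hab); auto.
intros t Ht. rewrite <- Cmod_prod_norm. auto.
Qed.

Lemma is_CInt_bound_const (f : R -> C) (a b : R) (l : C) (m : R) :
  a <= b -> (forall t, a <= t <= b -> Cmod (f t) <= m) ->
  is_CInt f a b l -> Cmod l <= (b - a) * m.
Proof.
intros Hab H Hf. rewrite Cmod_prod_norm.
apply (norm_RInt_le_const (V := C_R_NormedModule) f a b l m Hab); auto.
intros t Ht. rewrite <- Cmod_prod_norm. auto.
Qed.

Lemma is_CInt_derive (F f : R -> C) (a b : R) :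
  a <= b ->
  (forall t, a <= t <= b -> is_derive (fun t => fst (F t)) t (fst (f t))) ->
  (forall t, a <= t <= b -> is_derive (fun t => snd (F t)) t (snd (f t))) ->
  rcont_on f a b -> is_CInt f a b (F b - F a)%C.
Proof.
intros Hab H1 H2 Hc.
apply is_CInt_pair.
- apply (is_RInt_derive (V := R_CompleteNormedModule) (fun t => fst (F t)));
  intros t; rewrite Rmin_left, Rmax_right by exact Hab; intros Ht; [now apply H1|].
  apply continuity_pt_filterlim. now apply rcont_fst, Hc.
- apply (is_RInt_derive (V := R_CompleteNormedModule) (fun t => snd (F t)));
  intros t; rewrite Rmin_left, Rmax_right by exact Hab; intros Ht; [now apply H2|].
  apply continuity_pt_filterlim. now apply rcont_snd, Hc.
Qed.


(** * Goursat's lemma *)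

Lemma nested_intervals (a b : nat -> R) :
  (forall n, a n <= a (S n)) -> (forall n, b (S n) <= b n) -> (forall n, a n <= b n) ->
  exists x, forall n, a n <= x <= b n.
Proof.
intros Ha Hb Hab.
assert (Ha' : forall n k, a n <= a (n + k)%nat).
{ intros n k; induction k; [rewrite Nat.add_0_r; lra|].
  rewrite Nat.add_succ_r. specialize (Ha (n + k)%nat). lra. }
assert (Hb' : forall n k, b (n + k)%nat <= b n).
{ intros n k; induction k; [rewrite Nat.add_0_r; lra|].
  rewrite Nat.add_succ_r. specialize (Hb (n + k)%nat). lra. }
assert (H : forall n m, a n <= b m).
{ intros n m. specialize (Ha' n m). specialize (Hb' m n).
  specialize (Hab (n + m)%nat). rewrite (Nat.add_comm m n) in Hb'. lra. }
destruct (completeness (fun x => exists n, x = a n)) as [x [Hx1 Hx2]].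
- exists (b 0%nat). intros y [n ->]. apply H.
- exists (a 0%nat), 0%nat. reflexivity.
- exists x. intros n. split.
  + apply Hx1. now exists n.
  + apply Hx2. intros y [m ->]. apply H.
Qed.

(** [p] is the lower left corner of a box with sides [L / 2 ^ n] and [M / 2 ^ n]. The result is the
    corner of a quarter carrying at least a fourth of |mu|. The last quarter is the default: when
    the other three fail, it qualifies by additivity. *)
Definition quadrisect (mu : R -> R -> R -> R -> C) (L M : R) (n : nat) (p : R * R) : R * R :=
  let l := L / 2 ^ S n in let m := M / 2 ^ S n in
  let a := fst p in let c := snd p in
  let big a' c' := Rle_dec (Cmod (mu a (a + L / 2 ^ n) c (c + M / 2 ^ n)) / 4)
    (Cmod (mu a' (a' + l) c' (c' + m))) in
  if big a c then (a, c) else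
  if big (a + l) c then (a + l, c) else
  if big a (c + m) then (a, c + m) else (a + l, c + m).

Fixpoint quadrisection (mu : R -> R -> R -> R -> C) (L M : R) (p : R * R) (n : nat) : R * R :=
  match n with
  | O => p
  | S k => quadrisect mu L M k (quadrisection mu L M p k)
  end.

(* Goursat's bisection argument, for an arbitrary additive function of rectangles. *)
Lemma goursat (mu : R -> R -> R -> R -> C) (a b c d : R) :
  a <= b -> c <= d ->
  (forall a' m b' c' n d', a <= a' <= m -> m <= b' <= b -> c <= c' <= n -> n <= d' <= d ->
    mu a' b' c' d' = (mu a' m c' n + mu m b' c' n + mu a' m n d' + mu m b' n d')%C) ->
  (forall x y, a <= x <= b -> c <= y <= d -> forall e, 0 < e -> exists r, 0 < r /\
    forall a' b' c' d', a <= a' <= x -> x <= b' <= b -> c <= c' <= y -> y <= d' <= d ->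
      b' - a' < r -> d' - c' < r ->
      Cmod (mu a' b' c' d') <= e * ((b' - a') + (d' - c')) ^ 2) ->
  mu a b c d = 0.
Proof.
intros Hab Hcd Hadd Hloc.
set (L := b - a). set (M := d - c).
assert (HL : 0 <= L) by (unfold L; lra). assert (HM : 0 <= M) by (unfold M; lra).
set (q := quadrisection mu L M (a, c)).
set (sx := fun n => fst (q n)). set (sy := fun n => snd (q n)).
assert (H2 : forall n, 0 < 2 ^ n) by (intros; apply pow_lt; lra).
assert (HLs : forall K n, K / 2 ^ n = K / 2 ^ S n + K / 2 ^ S n).
{ intros K n. simpl. field. specialize (H2 n); lra. }
assert (HLp : forall n, 0 <= L / 2 ^ n) by (intros; apply Rdiv_le_0_compat; auto).
assert (HMp : forall n, 0 <= M / 2 ^ n) by (intros; apply Rdiv_le_0_compat; auto).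
assert (Hstep : forall n, (sx (S n) = sx n \/ sx (S n) = sx n + L / 2 ^ S n) /\
  (sy (S n) = sy n \/ sy (S n) = sy n + M / 2 ^ S n)).
{ intros n. unfold sx, sy, q. simpl quadrisection. unfold quadrisect.
  repeat destruct Rle_dec; cbn [fst snd]; auto. }
assert (Hxa : forall n, sx n <= sx (S n)).
{ intros n. destruct (Hstep n) as [[-> | ->] _]; specialize (HLp (S n)); lra. }
assert (Hya : forall n, sy n <= sy (S n)).
{ intros n. destruct (Hstep n) as [_ [-> | ->]]; specialize (HMp (S n)); lra. }
assert (Hxb : forall n, sx (S n) + L / 2 ^ S n <= sx n + L / 2 ^ n).
{ intros n. rewrite (HLs L n). destruct (Hstep n) as [[-> | ->] _]; specialize (HLp (S n)); lra. }
assert (Hyb : forall n, sy (S n) + M / 2 ^ S n <= sy n + M / 2 ^ n).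
{ intros n. rewrite (HLs M n). destruct (Hstep n) as [_ [-> | ->]]; specialize (HMp (S n)); lra. }
destruct (nested_intervals sx (fun n => sx n + L / 2 ^ n)) as [x Hx]; auto.
{ intros n; specialize (HLp n); lra. }
destruct (nested_intervals sy (fun n => sy n + M / 2 ^ n)) as [y Hy]; auto.
{ intros n; specialize (HMp n); lra. }
assert (Hin : forall n, a <= sx n /\ sx n + L / 2 ^ n <= b /\ c <= sy n /\ sy n + M / 2 ^ n <= d).
{ induction n.
  - unfold sx, sy, q, L, M; simpl. repeat split; lra.
  - specialize (Hxa n). specialize (Hxb n). specialize (Hya n). specialize (Hyb n). lra. }
assert (Hbig : forall n, Cmod (mu a b c d) <=
   4 ^ n * Cmod (mu (sx n) (sx n + L / 2 ^ n) (sy n) (sy n + M / 2 ^ n))).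
{ induction n.
  - unfold sx, sy, q; simpl. 
    replace (a + L / 1) with b by (unfold L; field).
    replace (c + M / 1) with d by (unfold M; field). lra.
  - eapply Rle_trans; [exact IHn|].
    assert (E : Cmod (mu (sx n) (sx n + L / 2 ^ n) (sy n) (sy n + M / 2 ^ n)) / 4 <=
       Cmod (mu (sx (S n)) (sx (S n) + L / 2 ^ S n) (sy (S n)) (sy (S n) + M / 2 ^ S n))).
    { unfold sx at 3 4, sy at 3 4, q. simpl quadrisection. unfold quadrisect.
      fold q. fold (sx n). fold (sy n).
      repeat destruct Rle_dec; cbn [fst snd]; auto.
      specialize (Hin n). specialize (HLp (S n)). specialize (HMp (S n)).
      assert (E := Hadd (sx n) (sx n + L / 2 ^ S n) (sx n + L / 2 ^ n)
        (sy n) (sy n + M / 2 ^ S n) (sy n + M / 2 ^ n)).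
      rewrite (HLs L n), (HLs M n) in E. rewrite (HLs L n), (HLs M n) in Hin.
      specialize (E ltac:(lra) ltac:(lra) ltac:(lra) ltac:(lra)).
      rewrite (HLs L n), (HLs M n) in *. rewrite <- !Rplus_assoc in *. 
      set (m1 := mu (sx n) (sx n + L / 2 ^ S n) (sy n) (sy n + M / 2 ^ S n)) in *.
      set (m2 := mu (sx n + L / 2 ^ S n) (sx n + L / 2 ^ S n + L / 2 ^ S n) (sy n) (sy n + M / 2 ^ S n)) in *.
      set (m3 := mu (sx n) (sx n + L / 2 ^ S n) (sy n + M / 2 ^ S n) (sy n + M / 2 ^ S n + M / 2 ^ S n)) in *.
      assert (T1 := Cmod_triangle (m1 + m2 + m3) (mu (sx n + L / 2 ^ S n) (sx n + L / 2 ^ S n + L / 2 ^ S n) (sy n + M / 2 ^ S n) (sy n + M / 2 ^ S n + M / 2 ^ S n))).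
      assert (T2 := Cmod_triangle (m1 + m2) m3). assert (T3 := Cmod_triangle m1 m2).
      rewrite <- E in T1. lra. }
    assert (0 < 4 ^ n) by (apply pow_lt; lra). replace (4 ^ S n) with (4 ^ n * 4) by (simpl; ring).
    rewrite Rmult_assoc. apply Rmult_le_compat_l; lra. }
apply Cmod_eq_0. apply Rle_antisym; [|apply Cmod_ge_0].
apply le_epsilon. intros e He. rewrite Rplus_0_l.
(* On the n-th box the local estimate is proportional to ((L + M) / 2^n)^2, which exactly offsets
   the factor 4^n. The + 1 covers the degenerate box L = M = 0. *)
assert (HLM : 0 < (L + M) ^ 2 + 1) by (assert (0 <= (L+M)^2) by apply pow2_ge_0; lra).
destruct (Hloc x y) with (e := e / ((L + M) ^ 2 + 1)) as [r [Hr Hr1]].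
{ specialize (Hin 0%nat); specialize (Hx 0%nat). lra. }
{ specialize (Hin 0%nat); specialize (Hy 0%nat). lra. }
{ now apply Rdiv_lt_0_compat. }
assert (HN : exists n, L / 2 ^ n < r /\ M / 2 ^ n < r).
{ destruct (pow_lt_1_zero (/2) ltac:(rewrite Rabs_pos_eq; lra) (r / (L + M + 1))) as [n Hn].
  { apply Rdiv_lt_0_compat; lra. }
  specialize (Hn n (le_n n)). exists n.
  rewrite Rabs_pos_eq in Hn by (apply pow_le; lra).
  apply Rlt_div_r in Hn; [|lra]. rewrite pow_inv in Hn.
  assert (0 < / 2 ^ n) by (apply Rinv_0_lt_compat; auto).
  unfold Rdiv. split; nra. }
destruct HN as [n [HnL HnM]].
eapply Rle_trans; [apply (Hbig n)|].
specialize (Hr1 (sx n) (sx n + L / 2 ^ n) (sy n) (sy n + M / 2 ^ n)).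
specialize (Hin n). specialize (Hx n). specialize (Hy n).
specialize (Hr1 ltac:(lra) ltac:(lra) ltac:(lra) ltac:(lra) ltac:(lra) ltac:(lra)).
replace (sx n + L / 2 ^ n - sx n + (sy n + M / 2 ^ n - sy n)) with ((L + M) / 2 ^ n) in Hr1
 by (field; specialize (H2 n); lra).
assert (H4 : 0 < 4 ^ n) by (apply pow_lt; lra).
apply Rmult_le_compat_l with (r := 4 ^ n) in Hr1; [|lra].
eapply Rle_trans; [exact Hr1|].
replace (4 ^ n) with (2 ^ n * 2 ^ n) by (rewrite <- Rpow_mult_distr; f_equal; ring).
assert (N1 : 2 ^ n <> 0) by (apply Rgt_not_eq, H2). assert (N2 : (L + M) ^ 2 + 1 <> 0) by lra.
replace (2 ^ n * 2 ^ n * (e / ((L + M) ^ 2 + 1) * ((L + M) / 2 ^ n) ^ 2)) with (e * ((L + M) ^ 2 / ((L + M) ^ 2 + 1))) by (field; auto).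
rewrite <- (Rmult_1_r e) at 2. apply Rmult_le_compat_l; [lra|].
apply Rle_div_l; lra.
Qed.


(** * The Cauchy kernel on the circle *)

Definition cis (t : R) : C := (cos t, sin t).

Lemma cis_plus (s t : R) : cis (s + t) = (cis s * cis t)%C.
Proof. unfold cis, Cmult; simpl. rewrite cos_plus, sin_plus. f_equal; ring. Qed.

Lemma cis_0 : cis 0 = 1.
Proof. unfold cis. now rewrite cos_0, sin_0. Qed.

Lemma cis_2PI : cis (2 * PI) = 1.
Proof. unfold cis. now rewrite cos_2PI, sin_2PI. Qed.

Lemma Cmod_cis (t : R) : Cmod (cis t) = 1.
Proof.
unfold cis, Cmod; simpl. rewrite !Rmult_1_r, Rplus_comm.
change (sqrt (Rsqr (sin t) + Rsqr (cos t)) = 1). now rewrite sin2_cos2, sqrt_1.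
Qed.

Lemma cis_neq_0 (t : R) : cis t <> 0.
Proof. apply Cmod_gt_0. rewrite Cmod_cis; lra. Qed.

Lemma cis_opp (t : R) : cis (- t) = (/ cis t)%C.
Proof.
assert (H : (cis (- t) * cis t)%C = 1).
{ rewrite <- cis_plus, Rplus_opp_l. apply cis_0. }
rewrite <- (Cmult_1_l (/ cis t)), <- H. field. apply cis_neq_0.
Qed.

Lemma cis_conj (t : R) : Cconj (cis t) = cis (- t).
Proof. unfold cis, Cconj; simpl. now rewrite cos_neg, sin_neg. Qed.

Lemma rcont_cis (t : R) : rcont cis t.
Proof. apply rcont_pair; [apply continuity_cos|apply continuity_sin]. Qed.

Lemma rcont_cis_opp (t : R) : rcont (fun t => cis (- t)) t.
Proof.
apply (rcont_pair (fun t => cos (- t)) (fun t => sin (- t))).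
- apply (continuity_pt_comp Ropp); [apply (continuity_pt_opp id), continuity_pt_id|apply continuity_cos].
- apply (continuity_pt_comp Ropp); [apply (continuity_pt_opp id), continuity_pt_id|apply continuity_sin].
Qed.

Lemma is_CInt_dcis (a b : R) : a <= b -> is_CInt (fun t => Ci * cis t)%C a b (cis b - cis a)%C.
Proof.
intros Hab. apply is_CInt_derive; [exact Hab| | |].
- intros t _. unfold cis; simpl. replace (0 * cos t - 1 * sin t) with (- sin t) by ring.
  apply is_derive_cos.
- intros t _. unfold cis; simpl. replace (0 * sin t + 1 * cos t) with (cos t) by ring.
  apply is_derive_sin.
- intros t _. apply rcont_mult; [apply rcont_const|apply rcont_cis].
Qed.

Lemma Cmod_cis_sub (a b : R) : Cmod (cis b - cis a) <= Rabs (b - a).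
Proof.
assert (G : forall a b, a <= b -> Cmod (cis b - cis a) <= b - a).
{ clear. intros a b Hab.
  replace (b - a) with ((b - a) * 1) by ring.
  apply (is_CInt_bound_const (fun t => Ci * cis t)%C a b); [exact Hab| |now apply is_CInt_dcis].
  intros. rewrite Cmod_mult, Cmod_Ci, Cmod_cis. lra. }
destruct (Rle_dec a b).
- rewrite Rabs_pos_eq; [auto|lra].
- rewrite Cmod_sub_comm, Rabs_left by lra. replace (- (b - a)) with (a - b) by ring. apply G; lra.
Qed.

Lemma rcont_bounded (f : R -> C) (a b : R) :
  a <= b -> rcont_on f a b -> exists M, 0 <= M /\ forall t, a <= t <= b -> Cmod (f t) <= M.
Proof.
intros Hab H. destruct (continuity_ab_maj (fun t => Cmod (f t)) a b Hab) as [m [Hm _]].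
{ intros c Hc. now apply rcont_Cmod, H. }
exists (Cmod (f m)). split; [apply Cmod_ge_0|exact Hm].
Qed.

(** * Complex series, and the expansion of the Cauchy kernel *)

Definition Cser (a : nat -> C) (l : C) : Prop :=
  is_series (K := C_AbsRing) (V := C_NormedModule) a l.
Definition Csum (a : nat -> C) (n : nat) : C := sum_n (G := C_AbelianGroup) a n.

Lemma Csum_0 (a : nat -> C) : Csum a 0 = a 0%nat.
Proof. exact (sum_O (G := C_AbelianGroup) a). Qed.

Lemma Csum_S (a : nat -> C) (n : nat) : Csum a (S n) = (Csum a n + a (S n))%C.
Proof. exact (sum_Sn (G := C_AbelianGroup) a n). Qed.

Lemma Cser_eps (a : nat -> C) (l : C) :
  Cser a l <-> forall e, 0 < e -> exists N, forall n, (N <= n)%nat -> Cmod (Csum a n - l) < e.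
Proof.
split.
- intros H e He.
  assert (H1 := H (fun w => Cmod (w - l) < e) (locally_C_intro l _ e He (fun w Hw => Hw))).
  exact H1.
- intros H P HP. apply locally_C_elim in HP. destruct HP as [d [Hd HP]].
  destruct (H d Hd) as [N HN]. exists N. intros n Hn. apply HP, HN, Hn.
Qed.

Lemma Cser_unique (a : nat -> C) (l m : C) : Cser a l -> Cser a m -> l = m.
Proof.
rewrite !Cser_eps. intros H1 H2.
assert (H : Cmod (l - m) = 0).
{ apply Rle_antisym; [|apply Cmod_ge_0]. apply le_epsilon. intros e He. rewrite Rplus_0_l.
  destruct (H1 (e/2) ltac:(lra)) as [N1 HN1]. destruct (H2 (e/2) ltac:(lra)) as [N2 HN2].
  specialize (HN1 (N1 + N2)%nat ltac:(lia)). specialize (HN2 (N1 + N2)%nat ltac:(lia)).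
  assert (T := Cmod_triangle_sub l (Csum a (N1 + N2)) m).
  rewrite (Cmod_sub_comm l (Csum a (N1 + N2))) in T. lra. }
apply Cmod_eq_0 in H. replace l with (l - m + m)%C by ring. rewrite H. ring.
Qed.

Lemma pow_small (q e : R) : 0 <= q < 1 -> 0 < e ->
  exists N, forall n, (N <= n)%nat -> q ^ n < e.
Proof.
intros Hq He. destruct (pow_lt_1_zero q ltac:(rewrite Rabs_pos_eq; lra) e He) as [N HN].
exists N. intros n Hn. specialize (HN n Hn).
eapply Rle_lt_trans; [apply Rle_abs|exact HN].
Qed.

Lemma one_minus_neq_0 (x : C) : Cmod x < 1 -> (1 - x)%C <> 0.
Proof.
intros H E. assert (x = 1) by (replace x with (1 - (1 - x))%C by ring; rewrite E; ring).
subst x. rewrite Cmod_1 in H. lra.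
Qed.

Lemma Cmod_one_minus (x : C) : 1 - Cmod x <= Cmod (1 - x).
Proof. rewrite <- Cmod_1 at 1. apply Cmod_triangle_inv. Qed.

Lemma Cmod_mul_cis (x : C) (t : R) : Cmod (x * cis t) = Cmod x.
Proof. rewrite Cmod_mult, Cmod_cis. ring. Qed.

Definition fourier (F : R -> C) (n : nat) : C :=
  CInt (fun t => F t * cis (- t) ^ n)%C 0 (2 * PI).

Lemma rcont_pow (f : R -> C) (n : nat) (t : R) : rcont f t -> rcont (fun t => f t ^ n)%C t.
Proof.
intros H. induction n as [|n IH]; simpl; [apply rcont_const|now apply rcont_mult].
Qed.

Lemma PI2_pos : 0 < 2 * PI.
Proof. assert (H := PI_RGT_0). lra. Qed.

Lemma rcont_cauchy_kernel (x : C) (t : R) :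
  Cmod x < 1 -> rcont (fun t => / (1 - x * cis (- t)))%C t.
Proof.
intros Hx. apply rcont_inv.
- apply one_minus_neq_0. now rewrite Cmod_mul_cis.
- apply rcont_minus; [apply rcont_const|]. apply rcont_mult; [apply rcont_const|apply rcont_cis_opp].
Qed.

(** The geometric series in y = x e^(-it) is integrated term by term. Its exact remainder y^(n+1) /
    (1 - y) is bounded by a constant times |x|^(n+1), so no theorem on uniform convergence is called
    for. *)
Lemma cauchy_kernel_series (F : R -> C) (x : C) :
  rcont_on F 0 (2 * PI) -> Cmod x < 1 ->
  Cser (fun n => fourier F n * x ^ n)%C
    (CInt (fun t => F t / (1 - x * cis (- t)))%C 0 (2 * PI)).
Proof.
intros HF Hx. assert (HP := PI2_pos).
destruct (rcont_bounded F 0 (2 * PI)) as [M [HM0 HM]]; [lra|exact HF|].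
set (y := fun t => (x * cis (- t))%C).
assert (Hy : forall t, Cmod (y t) = Cmod x) by (intros; apply Cmod_mul_cis).
assert (Hyc : forall t, rcont y t).
{ intros t. apply rcont_mult; [apply rcont_const|apply rcont_cis_opp]. }
assert (Hint : forall n, is_CInt (fun t => F t * y t ^ n / (1 - y t))%C 0 (2 * PI)
   (CInt (fun t => F t * y t ^ n / (1 - y t))%C 0 (2 * PI))).
{ intros n. apply CInt_correct; [lra|]. intros t Ht.
  apply rcont_mult; [|now apply rcont_cauchy_kernel].
  apply rcont_mult; [now apply HF|apply rcont_pow, Hyc]. }
assert (Hfou : forall n, is_CInt (fun t => F t * y t ^ n)%C 0 (2 * PI) (fourier F n * x ^ n)%C).
{ intros n. apply (is_CInt_ext (fun t => x ^ n * (F t * cis (- t) ^ n))%C); [lra| |].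
  - intros t _. unfold y. rewrite Cpow_mult_l. ring.
  - replace (fourier F n * x ^ n)%C with (x ^ n * fourier F n)%C by ring.
    apply is_CInt_scal. apply CInt_correct; [lra|]. intros t Ht.
    apply rcont_mult; [now apply HF|apply rcont_pow, rcont_cis_opp]. }
assert (Hrem : forall n, Csum (fun n => fourier F n * x ^ n)%C n =
  (CInt (fun t => F t / (1 - x * cis (- t)))%C 0 (2 * PI) -
   CInt (fun t => F t * y t ^ S n / (1 - y t))%C 0 (2 * PI))%C).
{ assert (E : forall n, CInt (fun t => F t * y t ^ S n / (1 - y t))%C 0 (2 * PI) =
     (CInt (fun t => F t * y t ^ n / (1 - y t))%C 0 (2 * PI) - fourier F n * x ^ n)%C).
  { intros n. apply is_CInt_unique.
    apply (is_CInt_ext (fun t => F t * y t ^ n / (1 - y t) - F t * y t ^ n)%C); [lra| |].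
    - intros t _. simpl. field. apply one_minus_neq_0. now rewrite Hy.
    - apply is_CInt_minus; auto. }
  induction n as [|n IH].
  - rewrite Csum_0, E.
    replace (CInt (fun t => F t * y t ^ 0 / (1 - y t))%C 0 (2 * PI))
      with (CInt (fun t => F t / (1 - x * cis (- t)))%C 0 (2 * PI)).
    + ring.
    + f_equal. apply functional_extensionality. intros t. unfold y; simpl. now rewrite Cmult_1_r.
  - rewrite Csum_S, IH, (E (S n)). ring. }
apply Cser_eps. intros e He.
assert (Hx0 := Cmod_ge_0 x).
destruct (pow_small (Cmod x) (e / (2 * PI * (M / (1 - Cmod x)) + 1))) as [N HN]; [lra| |].
{ apply Rdiv_lt_0_compat; [lra|].
  assert (0 <= 2 * PI * (M / (1 - Cmod x))); [|lra].
  apply Rmult_le_pos; [lra|]. apply Rdiv_le_0_compat; lra. }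
exists N. intros n Hn. rewrite Hrem.
set (J := CInt (fun t => F t * y t ^ S n / (1 - y t))%C 0 (2 * PI)).
replace (_ - J - _)%C with (- J)%C by ring. rewrite Cmod_opp.
assert (HJ : Cmod J <= (2 * PI - 0) * (M * Cmod x ^ S n / (1 - Cmod x))).
{ apply (is_CInt_bound_const _ 0 (2 * PI) J _ ltac:(lra)) with (2 := Hint (S n)).
  intros t Ht. rewrite Cmod_div by (apply one_minus_neq_0; now rewrite Hy).
  rewrite Cmod_mult, Cmod_pow, Hy. unfold Rdiv. apply Rmult_le_compat.
  - apply Rmult_le_pos; [apply Cmod_ge_0|apply pow_le, Cmod_ge_0].
  - left. apply Rinv_0_lt_compat. apply Cmod_0_lt, one_minus_neq_0. now rewrite Hy.
  - apply Rmult_le_compat_r; [apply pow_le, Cmod_ge_0|now apply HM].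
  - apply Rinv_le_contravar; [lra|]. rewrite <- (Hy t). apply Cmod_one_minus. }
specialize (HN (S n) ltac:(lia)).
set (K := 2 * PI * (M / (1 - Cmod x))) in *.
assert (HK : 0 <= K).
{ apply Rmult_le_pos; [lra|]. apply Rdiv_le_0_compat; lra. }
apply Rlt_div_r in HN; [|lra].
replace ((2 * PI - 0) * (M * Cmod x ^ S n / (1 - Cmod x))) with (K * Cmod x ^ S n) in HJ
  by (unfold K; field; lra).
assert (0 <= Cmod x ^ S n) by (apply pow_le, Cmod_ge_0). lra.
Qed.

Lemma cis_pow (n : nat) (t : R) : (cis t ^ n)%C = cis (INR n * t).
Proof.
induction n as [|n IH].
- simpl. now rewrite Rmult_0_l, cis_0.
- rewrite S_INR, Cpow_S, IH, <- cis_plus. f_equal; ring.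
Qed.

Lemma is_derive_cos_lin (k t : R) : is_derive (fun t => cos (k * t)) t (- k * sin (k * t)).
Proof. auto_derive; [auto|ring]. Qed.
Lemma is_derive_sin_lin (k t : R) : is_derive (fun t => sin (k * t)) t (k * cos (k * t)).
Proof. auto_derive; [auto|ring]. Qed.

Lemma rcont_cis_lin (k t : R) : rcont (fun t => cis (k * t)) t.
Proof.
apply (rcont_pair (fun t => cos (k * t)) (fun t => sin (k * t)));
apply derivable_continuous_pt; eexists; apply is_derive_Reals;
 [apply is_derive_cos_lin|apply is_derive_sin_lin].
Qed.

Lemma is_CInt_cis_period (n : Z) : (n <> 0)%Z -> is_CInt (fun t => cis (IZR n * t)) 0 (2 * PI) 0.
Proof.
intros Hn. assert (HP := PI2_pos).
assert (Hn' : IZR n <> 0) by now apply not_0_IZR.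
assert (Hn2 : RtoC (IZR n) <> 0).
{ intros E. apply Hn'. now apply RtoC_inj. }
assert (H : is_CInt (fun t => Ci * IZR n * cis (IZR n * t))%C 0 (2 * PI)
   (cis (IZR n * (2 * PI)) - cis (IZR n * 0))%C).
{ apply (is_CInt_derive (fun t => cis (IZR n * t))); [lra| | |].
  - intros t _. unfold cis; simpl.
    replace (_ - _) with (- IZR n * sin (IZR n * t)) by ring. apply is_derive_cos_lin.
  - intros t _. unfold cis; simpl.
    replace (_ + _) with (IZR n * cos (IZR n * t)) by ring. apply is_derive_sin_lin.
  - intros t _. apply rcont_mult; [apply rcont_const|apply rcont_cis_lin]. }
assert (E : cis (IZR n * (2 * PI)) = 1).
{ assert (G : forall m : nat, cis (INR m * (2 * PI)) = 1).
  { intros m. rewrite <- cis_pow, cis_2PI. apply Cpow_1_l. }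
  destruct (Z_le_dec 0 n) as [Hz|Hz].
  - rewrite <- (Z2Nat.id n Hz), <- INR_IZR_INZ. apply G.
  - replace (IZR n * (2 * PI)) with (- (INR (Z.to_nat (- n)) * (2 * PI))).
    + rewrite cis_opp, G. rewrite <- (Cmult_1_l (/ 1)). apply Cinv_r. intros E'. injection E'. lra.
    + rewrite INR_IZR_INZ, Z2Nat.id, opp_IZR by lia. ring. }
rewrite E, Rmult_0_r, cis_0 in H.
apply (is_CInt_scal (/ (Ci * IZR n))) in H.
replace (/ (Ci * IZR n) * (1 - 1))%C with (RtoC 0) in H by ring.
revert H. apply is_CInt_ext; [lra|]. intros t _.
field. split; [exact Hn2|]. intros E'. injection E'. lra.
Qed.

Lemma fourier_1_0 : fourier (fun _ => 1) 0 = RtoC (2 * PI).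
Proof.
unfold fourier. apply is_CInt_unique.
apply (is_CInt_ext (fun _ => 1)); [assert (H := PI2_pos); lra|intros; simpl; ring|].
replace (RtoC (2 * PI)) with (RtoC (2 * PI - 0) * 1)%C by (rewrite Rminus_0_r; ring).
apply is_CInt_const.
Qed.

Lemma fourier_1_S (n : nat) : fourier (fun _ => 1) (S n) = 0.
Proof.
unfold fourier. apply is_CInt_unique.
apply (is_CInt_ext (fun t => cis (IZR (- Z.of_nat (S n)) * t))).
- assert (H := PI2_pos); lra.
- intros t _. rewrite cis_pow, Cmult_1_l, opp_IZR, <- INR_IZR_INZ. f_equal; ring.
- apply is_CInt_cis_period. lia.
Qed.

(** For the constant function 1 only the Fourier coefficient of order 0 survives, so the series of
    [cauchy_kernel_series] reduces to one term. *)
Lemma mean_cauchy_kernel (x : C) : Cmod x < 1 ->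
  is_CInt (fun t => / (1 - x * cis (- t)))%C 0 (2 * PI) (RtoC (2 * PI)).
Proof.
intros Hx. assert (HP := PI2_pos).
assert (H := cauchy_kernel_series (fun _ => 1) x (fun t _ => rcont_const 1 t) Hx).
assert (H2 : Cser (fun n => fourier (fun _ => 1) n * x ^ n)%C (RtoC (2 * PI))).
{ apply Cser_eps. intros e He. exists 0%nat. intros n _.
  replace (Csum _ n) with (RtoC (2 * PI)).
  - replace (RtoC (2 * PI) - RtoC (2 * PI))%C with (RtoC 0) by ring. now rewrite Cmod_0.
  - induction n as [|n IH].
    + rewrite Csum_0, fourier_1_0. simpl. ring.
    + rewrite Csum_S, <- IH, fourier_1_S. ring. }
rewrite (Cser_unique _ _ _ H2 H).
apply (is_CInt_ext (fun t => 1 / (1 - x * cis (- t)))%C); [lra| |].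
- intros t _. unfold Cdiv. ring.
- apply CInt_correct; [lra|]. intros t _. apply rcont_mult; [apply rcont_const|].
  now apply rcont_cauchy_kernel.
Qed.


(** * Cauchy's formula *)

Definition holo (f : C -> C) (r : R) : Prop :=
  forall z, Cmod z < r -> exists l, cderiv f z l.

Lemma holo_cont (f : C -> C) (r : R) (z : C) : holo f r -> Cmod z < r -> ccont f z.
Proof. intros H Hz. destruct (H z Hz) as [l Hl]. exact (cderiv_cont _ _ _ Hl). Qed.

Lemma exp_sub_le (s t : R) : s <= 0 -> t <= 0 -> Rabs (exp s - exp t) <= Rabs (s - t).
Proof.
assert (G : forall s t, s <= t -> t <= 0 -> exp t - exp s <= t - s).
{ clear. intros s t Hst Ht.
  destruct (Req_dec s t) as [->|Hne]; [lra|].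
  destruct (MVT_cor2 exp exp s t) as [c [Hc Hc']]; [lra|intros; apply derivable_pt_lim_exp|].
  rewrite Hc. assert (exp c <= 1).
  { rewrite <- exp_0. left. apply exp_increasing. lra. }
  nra. }
intros Hs Ht. destruct (Rle_dec s t) as [Hle|Hle].
- rewrite !(Rabs_minus_sym _ (exp t)), (Rabs_minus_sym s).
  rewrite !Rabs_pos_eq; [now apply G|lra|].
  destruct Hle as [Hlt| ->]; [apply exp_increasing in Hlt|]; lra.
- rewrite !Rabs_pos_eq; [apply G; lra|lra|].
  assert (exp t < exp s) by (apply exp_increasing; lra). lra.
Qed.

Lemma is_CInt_exp (a b : R) : a <= b -> is_CInt (fun s => RtoC (exp s)) a b (RtoC (exp b - exp a)).
Proof.
intros Hab. rewrite RtoC_minus.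
apply (is_CInt_derive (fun s => RtoC (exp s))); [exact Hab| | |].
- intros t _. apply is_derive_exp.
- intros t _. simpl. apply (is_derive_const (K := R_AbsRing) (V := R_NormedModule)).
- intros t _. apply rcont_RtoC. apply derivable_continuous, derivable_exp.
Qed.

(** For fixed [t], the segment from [z] (as [s] tends to minus infinity) to the point of the circle
    of radius [rho] (at [s = 0]), with a logarithmic parameter. *)
Definition ray (rho : R) (z : C) (s t : R) : C := (z + exp s * (rho * cis t - z))%C.
Definition ray_arg (rho : R) (z : C) (t : R) : C := (Ci * rho * cis t / (rho * cis t - z))%C.

Lemma circle_sub_ge (rho : R) (z : C) (t : R) : 0 <= rho ->
  rho - Cmod z <= Cmod (rho * cis t - z).
Proof.
intros H. eapply Rle_trans; [|apply Cmod_triangle_inv].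
rewrite Cmod_mul_cis, Cmod_R, Rabs_pos_eq; lra.
Qed.

Lemma Cmod_ray (rho : R) (z : C) (s t : R) : s <= 0 -> Cmod z < rho -> Cmod (ray rho z s t) <= rho.
Proof.
intros Hs Hz. assert (Hz0 := Cmod_ge_0 z). unfold ray.
replace (z + exp s * (rho * cis t - z))%C with ((1 - exp s)%R * z + (exp s * rho)%R * cis t)%C
  by (rewrite RtoC_minus, RtoC_mult; ring).
eapply Rle_trans; [apply Cmod_triangle|].
rewrite Cmod_mul_cis, Cmod_mult, !Cmod_R.
assert (He := exp_pos s).
assert (He1 : exp s <= 1).
{ rewrite <- exp_0. destruct Hs as [Hs| ->]; [left; now apply exp_increasing|lra]. }
rewrite !Rabs_pos_eq; nra.
Qed.

Lemma rcont_circle (rho : R) (z : C) (t : R) : rcont (fun t => rho * cis t - z)%C t.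
Proof.
apply rcont_minus; [|apply rcont_const]. apply rcont_mult; [apply rcont_const|apply rcont_cis].
Qed.

Lemma rcont_exp (s : R) : rcont (fun s => RtoC (exp s)) s.
Proof. apply rcont_RtoC. apply derivable_continuous, derivable_exp. Qed.

(* The closed form [dh / (h - z)] pulled back by [h (s, t) = z + e^s (rho e^(it) - z)]
   is [ds + ray_arg t dt]; Goursat's argument is run on [f(h) dh / (h - z)]. *)
Definition cauchy_form (f : C -> C) (rho : R) (z : C) (s1 s2 t1 t2 : R) : C :=
  (CInt (fun s => f (ray rho z s t1) - f (ray rho z s t2))%C s1 s2 +
   CInt (fun t => (f (ray rho z s2 t) - f (ray rho z s1 t)) * ray_arg rho z t)%C t1 t2)%C.

Lemma ray_arg_cont (rho : R) (z : C) (t : R) : Cmod z < rho -> rcont (ray_arg rho z) t.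
Proof.
intros Hz. assert (Hz0 := Cmod_ge_0 z). apply rcont_mult.
- apply rcont_mult; [apply rcont_const|apply rcont_cis].
- apply rcont_inv; [|apply rcont_circle].
  apply Cmod_gt_0. assert (H := circle_sub_ge rho z t ltac:(lra)). lra.
Qed.

Lemma ray_arg_mul (rho : R) (z : C) (t : R) : Cmod z < rho ->
  ((rho * cis t - z) * ray_arg rho z t = rho * (Ci * cis t))%C.
Proof.
intros Hz. assert (Hz0 := Cmod_ge_0 z). unfold ray_arg. field.
apply Cmod_gt_0. assert (H := circle_sub_ge rho z t ltac:(lra)). lra.
Qed.

(** Subtracting from [f] its affine approximation at the point does not change the form: the
    constant drops out and the two linear contributions cancel exactly. What is left is the
    remainder [r], of size [e' * D], on sides of length at most [D]. *)
Lemma cauchy_form_local (f : C -> C) (rho : R) (z : C) (s0 t0 : R) (l : C) (e : R) :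
  rho < 1 -> Cmod z < rho -> s0 <= 0 -> 0 < e -> holo f 1 ->
  cderiv f (ray rho z s0 t0) l ->
  exists r, 0 < r /\ forall s1 s2 t1 t2, s1 <= s0 -> s0 <= s2 <= 0 -> t1 <= t0 -> t0 <= t2 ->
     s2 - s1 < r -> t2 - t1 < r ->
     Cmod (cauchy_form f rho z s1 s2 t1 t2) <= e * ((s2 - s1) + (t2 - t1)) ^ 2.
Proof.
intros Hr1 Hz Hs0 He Hf Hl. assert (Hz0 := Cmod_ge_0 z).
set (K := / (rho - Cmod z)).
assert (HK : 0 < K) by (apply Rinv_0_lt_compat; lra).
rewrite cderiv_eps in Hl.
(* The integrand in [s] is a difference of two remainders, at most [4 * e' * D]; the one in [t]
   gains a factor [K], which bounds [ray_arg]. *)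
destruct (Hl (e / (4 * (1 + K)))) as [d [Hd Hl']]; [apply Rdiv_lt_0_compat; lra|].
set (e' := e / (4 * (1 + K))) in *.
assert (He' : 0 < e') by (apply Rdiv_lt_0_compat; lra).
(* Then [D < d / 2], and [ray] moves by at most [2 * D] on the box. *)
exists (d / 4). split; [lra|]. intros s1 s2 t1 t2 Hs1 Hs2 Ht1 Ht2 Hs12 Ht12.
set (D := (s2 - s1) + (t2 - t1)).
assert (HD : 0 <= D) by (unfold D; lra).
set (h := ray rho z) in *.
assert (Hh : forall s t, s1 <= s <= s2 -> t1 <= t <= t2 -> Cmod (h s t - h s0 t0) <= 2 * D).
{ intros s t Hs Ht. unfold h, ray.
  replace (z + exp s * (rho * cis t - z) - (z + exp s0 * (rho * cis t0 - z)))%C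
   with ((exp s * rho)%R * (cis t - cis t0) + (exp s - exp s0)%R * (rho * cis t0 - z))%C
   by (rewrite RtoC_minus, RtoC_mult; ring).
  eapply Rle_trans; [apply Cmod_triangle|]. rewrite !Cmod_mult, !Cmod_R.
  assert (E1 := Cmod_cis_sub t0 t).
  assert (E2 := exp_sub_le s s0 ltac:(lra) ltac:(lra)).
  assert (E3 : Cmod (rho * cis t0 - z) <= 2).
  { eapply Rle_trans; [apply Cmod_triangle|].
    rewrite Cmod_opp, Cmod_mul_cis, Cmod_R, Rabs_pos_eq; lra. }
  assert (E4 : Rabs (exp s * rho) <= 1).
  { assert (P := exp_pos s). assert (exp s <= 1).
    { rewrite <- exp_0. destruct (Req_dec s 0) as [->|]; [lra|left; apply exp_increasing; lra]. }
    rewrite Rabs_pos_eq; nra. }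
  assert (E5 : Rabs (t - t0) <= t2 - t1) by (apply Rabs_le; lra).
  assert (E6 : Rabs (s - s0) <= s2 - s1) by (apply Rabs_le; lra).
  assert (Rabs (exp s * rho) * Cmod (cis t - cis t0) <= 1 * (t2 - t1)).
  { apply Rmult_le_compat; try lra; [apply Rabs_pos|apply Cmod_ge_0]. }
  assert (Rabs (exp s - exp s0) * Cmod (rho * cis t0 - z) <= (s2 - s1) * 2).
  { apply Rmult_le_compat; try lra; [apply Rabs_pos|apply Cmod_ge_0]. }
  unfold D; lra. }
set (r := fun s t => (f (h s t) - f (h s0 t0) - l * (h s t - h s0 t0))%C).
assert (Hr : forall s t, s1 <= s <= s2 -> t1 <= t <= t2 -> Cmod (r s t) <= 2 * e' * D).
{ intros s t Hs Ht. specialize (Hh s t Hs Ht).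
  eapply Rle_trans; [apply Hl'; unfold D in Hh; lra|].
  assert (e' * Cmod (h s t - h s0 t0) <= e' * (2 * D)) by (apply Rmult_le_compat_l; lra). lra. }
assert (Hhc1 : forall t s, rcont (fun s => h s t) s).
{ intros t s. apply rcont_plus; [apply rcont_const|].
  apply rcont_mult; [apply rcont_exp|apply rcont_const]. }
assert (Hhc2 : forall s t, rcont (h s) t).
{ intros s t. apply rcont_plus; [apply rcont_const|].
  apply rcont_mult; [apply rcont_const|apply rcont_circle]. }
assert (Hfh : forall s t, s <= 0 -> ccont f (h s t)).
{ intros s t Hs. apply (holo_cont f 1); [exact Hf|].
  assert (P := Cmod_ray rho z s t Hs Hz). fold h in P. lra. }
assert (HI1 : is_CInt (fun s => f (h s t1) - f (h s t2))%C s1 s2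
   (CInt (fun s => f (h s t1) - f (h s t2))%C s1 s2)).
{ apply CInt_correct; [lra|]. intros s Hs. apply rcont_minus; apply (rcont_comp f); auto; apply Hfh; lra. }
assert (HI2 : is_CInt (fun t => (f (h s2 t) - f (h s1 t)) * ray_arg rho z t)%C t1 t2
   (CInt (fun t => (f (h s2 t) - f (h s1 t)) * ray_arg rho z t)%C t1 t2)).
{ apply CInt_correct; [lra|]. intros t Ht. apply rcont_mult; [|now apply ray_arg_cont].
  apply rcont_minus; apply (rcont_comp f); auto; apply Hfh; lra. }
unfold cauchy_form. fold h.
set (I1 := CInt (fun s => f (h s t1) - f (h s t2))%C s1 s2) in *.
set (I2 := CInt (fun t => (f (h s2 t) - f (h s1 t)) * ray_arg rho z t)%C t1 t2) in *.
assert (J1 : is_CInt (fun s => r s t1 - r s t2)%C s1 s2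
  (I1 - l * ((rho * cis t1 - rho * cis t2) * (exp s2 - exp s1)%R))%C).
{ apply (is_CInt_ext (fun s => (f (h s t1) - f (h s t2)) -
      l * ((rho * cis t1 - rho * cis t2) * RtoC (exp s)))%C); [lra| |].
  - intros s _. unfold r, h, ray. ring.
  - apply is_CInt_minus; [exact HI1|]. apply is_CInt_scal, is_CInt_scal, is_CInt_exp. lra. }
assert (J2 : is_CInt (fun t => (r s2 t - r s1 t) * ray_arg rho z t)%C t1 t2
  (I2 - (l * (exp s2 - exp s1)%R * rho) * (cis t2 - cis t1))%C).
{ apply (is_CInt_ext (fun t => (f (h s2 t) - f (h s1 t)) * ray_arg rho z t -
      (l * (exp s2 - exp s1)%R * rho) * (Ci * cis t))%C); [lra| |].
  - intros t _. replace (l * (exp s2 - exp s1)%R * rho * (Ci * cis t))%C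
      with (l * (exp s2 - exp s1)%R * (rho * (Ci * cis t)))%C by ring.
    rewrite <- (ray_arg_mul rho z t Hz), RtoC_minus. unfold r, h, ray. ring.
  - apply is_CInt_minus; [exact HI2|]. apply is_CInt_scal, is_CInt_dcis. lra. }
apply (is_CInt_bound_const _ _ _ _ (4 * e' * D)) in J1; [|lra|].
2:{ intros s Hs. eapply Rle_trans; [apply Cmod_triangle|]. rewrite Cmod_opp.
  assert (A1 := Hr s t1 ltac:(lra) ltac:(lra)). assert (A2 := Hr s t2 ltac:(lra) ltac:(lra)). lra. }
apply (is_CInt_bound_const _ _ _ _ (4 * e' * D * K)) in J2; [|lra|].
2:{ intros t Ht. rewrite Cmod_mult.
  assert (A1 := Hr s1 t ltac:(lra) ltac:(lra)). assert (A2 := Hr s2 t ltac:(lra) ltac:(lra)).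
  assert (A3 : Cmod (r s2 t - r s1 t) <= 4 * e' * D).
  { eapply Rle_trans; [apply Cmod_triangle|]. rewrite Cmod_opp. lra. }
  assert (A4 : Cmod (ray_arg rho z t) <= K).
  { assert (P := circle_sub_ge rho z t ltac:(lra)). unfold ray_arg.
    rewrite Cmod_div by (apply Cmod_gt_0; lra).
    rewrite Cmod_mul_cis, Cmod_mult, Cmod_Ci, Cmod_R, Rabs_pos_eq, Rmult_1_l by lra.
    unfold K, Rdiv. rewrite <- (Rmult_1_l (/ (rho - Cmod z))).
    apply Rmult_le_compat; try lra.
    - left. apply Rinv_0_lt_compat; lra.
    - apply Rinv_le_contravar; lra. }
  apply Rmult_le_compat; auto using Cmod_ge_0. }
replace (I1 + I2)%C with
 ((I1 - l * ((rho * cis t1 - rho * cis t2) * (exp s2 - exp s1)%R)) +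
  (I2 - (l * (exp s2 - exp s1)%R * rho) * (cis t2 - cis t1)))%C by ring.
eapply Rle_trans; [apply Cmod_triangle|].
assert (HDs : s2 - s1 <= D) by (unfold D; lra). assert (HDt : t2 - t1 <= D) by (unfold D; lra).
assert (0 <= e' * D) by (apply Rmult_le_pos; lra).
assert (0 <= e' * D * K) by (apply Rmult_le_pos; lra).
assert (Q1 : (s2 - s1) * (4 * e' * D) <= D * (4 * e' * D)) by (apply Rmult_le_compat_r; lra).
assert (Q2 : (t2 - t1) * (4 * e' * D * K) <= D * (4 * e' * D * K)) by (apply Rmult_le_compat_r; lra).
fold D. replace (e * D ^ 2) with (D * (4 * e' * D) + D * (4 * e' * D * K)).
- lra.
- unfold e'. field. lra.
Qed.

Lemma cauchy_form_zero (f : C -> C) (rho : R) (z : C) (S : R) :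
  rho < 1 -> Cmod z < rho -> S <= 0 -> holo f 1 -> cauchy_form f rho z S 0 0 (2 * PI) = 0.
Proof.
intros Hr Hz HS Hf. assert (HP := PI2_pos).
apply goursat; [exact HS|lra| |].
- intros s1 s s2 t1 t t2 Hs1 Hs2 Ht1 Ht2. unfold cauchy_form.
  assert (Hfh : forall s t, s <= 0 -> ccont f (ray rho z s t)).
  { intros s' t' Hs'. apply (holo_cont f 1); [exact Hf|].
    assert (P := Cmod_ray rho z s' t' Hs' Hz). lra. }
  assert (G1 : forall a b x y, a <= b -> b <= 0 ->
     is_CInt (fun s => f (ray rho z s x) - f (ray rho z s y))%C a b
     (CInt (fun s => f (ray rho z s x) - f (ray rho z s y))%C a b)).
  { intros a b x y Hab Hb. apply CInt_correct; [exact Hab|]. intros u Hu.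
    assert (forall v, rcont (fun s => ray rho z s v) u).
    { intros v. apply rcont_plus; [apply rcont_const|].
      apply rcont_mult; [apply rcont_exp|apply rcont_const]. }
    apply rcont_minus; apply (rcont_comp f); auto; apply Hfh; lra. }
  assert (G2 : forall a b x y, a <= b -> x <= 0 -> y <= 0 ->
     is_CInt (fun t => (f (ray rho z y t) - f (ray rho z x t)) * ray_arg rho z t)%C a b
     (CInt (fun t => (f (ray rho z y t) - f (ray rho z x t)) * ray_arg rho z t)%C a b)).
  { intros a b x y Hab Hx Hy. apply CInt_correct; [exact Hab|]. intros u Hu.
    assert (forall v, rcont (ray rho z v) u).
    { intros v. apply rcont_plus; [apply rcont_const|].
      apply rcont_mult; [apply rcont_const|apply rcont_circle]. }
    apply rcont_mult; [|now apply ray_arg_cont].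
    apply rcont_minus; apply (rcont_comp f); auto. }
  assert (H1 := is_CInt_unique _ _ _ _ (is_CInt_Chasles _ _ _ _ _ _ (G1 s1 s t1 t2 ltac:(lra) ltac:(lra)) (G1 s s2 t1 t2 ltac:(lra) ltac:(lra)))).
  assert (H2 := is_CInt_unique _ _ _ _ (is_CInt_Chasles _ _ _ _ _ _ (G2 t1 t s1 s2 ltac:(lra) ltac:(lra) ltac:(lra)) (G2 t t2 s1 s2 ltac:(lra) ltac:(lra) ltac:(lra)))).
  assert (A1 : forall a b, a <= b -> b <= 0 ->
    CInt (fun s => f (ray rho z s t1) - f (ray rho z s t2))%C a b =
    (CInt (fun s => f (ray rho z s t1) - f (ray rho z s t))%C a b +
     CInt (fun s => f (ray rho z s t) - f (ray rho z s t2))%C a b)%C).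
  { intros a b Hab Hb. apply is_CInt_unique.
    apply (is_CInt_ext (fun s => (f (ray rho z s t1) - f (ray rho z s t)) +
       (f (ray rho z s t) - f (ray rho z s t2)))%C); [exact Hab|intros; ring|].
    apply is_CInt_plus; now apply G1. }
  assert (A2 : forall a b, a <= b ->
    CInt (fun t => (f (ray rho z s2 t) - f (ray rho z s1 t)) * ray_arg rho z t)%C a b =
    (CInt (fun t => (f (ray rho z s t) - f (ray rho z s1 t)) * ray_arg rho z t)%C a b +
     CInt (fun t => (f (ray rho z s2 t) - f (ray rho z s t)) * ray_arg rho z t)%C a b)%C).
  { intros a b Hab. apply is_CInt_unique.
    apply (is_CInt_ext (fun t => (f (ray rho z s t) - f (ray rho z s1 t)) * ray_arg rho z t +
       (f (ray rho z s2 t) - f (ray rho z s t)) * ray_arg rho z t)%C); [exact Hab|intros; ring|].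
    apply is_CInt_plus; apply G2; lra. }
  rewrite H1, H2, (A1 s1 s), (A1 s s2), (A2 t1 t), (A2 t t2) by lra. ring.
- intros s0 t0 Hs0 Ht0 e He.
  destruct (Hf (ray rho z s0 t0)) as [l Hl].
  { assert (P := Cmod_ray rho z s0 t0 ltac:(lra) Hz). lra. }
  destruct (cauchy_form_local f rho z s0 t0 l e Hr Hz ltac:(lra) He Hf Hl) as [r [Hr0 Hr']].
  exists r. split; [exact Hr0|]. intros. apply Hr'; lra.
Qed.

Lemma is_CInt_ray_arg (rho : R) (z : C) : Cmod z < rho ->
  is_CInt (ray_arg rho z) 0 (2 * PI) (Ci * RtoC (2 * PI))%C.
Proof.
intros Hz. assert (Hz0 := Cmod_ge_0 z). assert (HP := PI2_pos).
assert (Hrho : RtoC rho <> 0) by (intros E; apply RtoC_inj in E; lra).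
apply (is_CInt_ext (fun t => Ci * / (1 - (z / rho) * cis (- t)))%C); [lra| |].
- intros t _. unfold ray_arg. rewrite cis_opp. field.
  assert (rho * cis t - z <> 0)%C.
  { apply Cmod_gt_0. assert (H := circle_sub_ge rho z t ltac:(lra)). lra. }
  assert (cis t * rho - z <> 0)%C by (rewrite (Cmult_comm (cis t)); assumption).
  repeat split; auto using cis_neq_0.
- apply is_CInt_scal, mean_cauchy_kernel.
  rewrite Cmod_div by exact Hrho. rewrite Cmod_R, Rabs_pos_eq by lra.
  apply Rlt_div_l; lra.
Qed.

(** The sides t = 0 and t = 2 pi of the (s, t) box have the same image, so the vanishing of
    [cauchy_form] says that the integral over [t] does not depend on [s]. As [s] tends to minus
    infinity it tends to f(z) times the total argument 2 pi i. *)
Theorem cauchy_formula (f : C -> C) (rho : R) (z : C) :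
  rho < 1 -> Cmod z < rho -> holo f 1 ->
  is_CInt (fun t => f (rho * cis t) / (1 - (z / rho) * cis (- t)))%C 0 (2 * PI) (2 * PI * f z)%C.
Proof.
intros Hr Hz Hf. assert (Hz0 := Cmod_ge_0 z). assert (HP := PI2_pos).
assert (Hrho : RtoC rho <> 0) by (intros E; apply RtoC_inj in E; lra).
assert (Hfh : forall s t, s <= 0 -> ccont f (ray rho z s t)).
{ intros s' t' Hs'. apply (holo_cont f 1); [exact Hf|].
  assert (P := Cmod_ray rho z s' t' Hs' Hz). lra. }
assert (G : forall s, s <= 0 -> is_CInt (fun t => f (ray rho z s t) * ray_arg rho z t)%C 0 (2 * PI)
   (CInt (fun t => f (ray rho z s t) * ray_arg rho z t)%C 0 (2 * PI))).
{ intros s Hs. apply CInt_correct; [lra|]. intros t Ht.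
  apply rcont_mult; [|now apply ray_arg_cont]. apply (rcont_comp f); [auto|].
  apply rcont_plus; [apply rcont_const|]. apply rcont_mult; [apply rcont_const|apply rcont_circle]. }
set (I := CInt (fun t => f (ray rho z 0 t) * ray_arg rho z t)%C 0 (2 * PI)) in *.
assert (HI : forall s, s <= 0 -> CInt (fun t => f (ray rho z s t) * ray_arg rho z t)%C 0 (2 * PI) = I).
{ intros s Hs. assert (H := cauchy_form_zero f rho z s Hr Hz Hs Hf). unfold cauchy_form in H.
  replace (CInt (fun s => f (ray rho z s 0) - f (ray rho z s (2 * PI)))%C s 0) with (RtoC 0) in H.
  2:{ symmetry. apply is_CInt_unique. apply (is_CInt_ext (fun _ => RtoC 0)); [exact Hs| |].
    - intros u _. unfold ray. rewrite cis_0, cis_2PI. ring.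
    - assert (H0 := is_CInt_const 0 s 0). now rewrite Cmult_0_r in H0. }
  replace (CInt (fun t => (f (ray rho z 0 t) - f (ray rho z s t)) * ray_arg rho z t)%C 0 (2 * PI))
   with (I - CInt (fun t => f (ray rho z s t) * ray_arg rho z t)%C 0 (2 * PI))%C in H.
  - replace I with (0 + (I - CInt (fun t => f (ray rho z s t) * ray_arg rho z t) 0 (2 * PI)) +
      CInt (fun t => f (ray rho z s t) * ray_arg rho z t) 0 (2 * PI))%C by ring.
    rewrite H. ring.
  - symmetry. apply is_CInt_unique.
    apply (is_CInt_ext (fun t => f (ray rho z 0 t) * ray_arg rho z t - f (ray rho z s t) * ray_arg rho z t)%C);
     [lra|intros; ring|]. apply is_CInt_minus; apply G; lra. }
assert (HIz : I = (f z * (Ci * RtoC (2 * PI)))%C).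
{ assert (Hz' : Cmod (I - f z * (Ci * RtoC (2 * PI))) = 0).
  2:{ apply Cmod_eq_0 in Hz'. replace I with (I - f z * (Ci * RtoC (2 * PI)) + f z * (Ci * RtoC (2 * PI)))%C by ring. rewrite Hz'. ring. }
  apply Rle_antisym; [|apply Cmod_ge_0]. apply le_epsilon. intros e He. rewrite Rplus_0_l.
  set (K := / (rho - Cmod z)).
  assert (HK : 0 < K) by (apply Rinv_0_lt_compat; lra).
  destruct (holo_cont f 1 z Hf ltac:(lra) (e / (2 * PI * K))) as [d [Hd Hd']].
  { apply Rdiv_lt_0_compat; [lra|]. apply Rmult_lt_0_compat; lra. }
  (* The distance from [ray] to [z] is at most 2 e^s <= 2 d / 3 < d. *)
  set (s := Rmin 0 (ln (d / 3))).
  assert (Hs : s <= 0) by apply Rmin_l.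
  assert (Hes : exp s <= d / 3).
  { rewrite <- (exp_ln (d / 3)) by lra. assert (Hm : s <= ln (d / 3)) by apply Rmin_r.
    destruct Hm as [Hm|Hm]; [left; now apply exp_increasing|rewrite Hm; lra]. }
  assert (Hdiff : is_CInt (fun t => (f (ray rho z s t) - f z) * ray_arg rho z t)%C 0 (2 * PI)
     (I - f z * (Ci * RtoC (2 * PI)))%C).
  { apply (is_CInt_ext (fun t => f (ray rho z s t) * ray_arg rho z t - f z * ray_arg rho z t)%C);
      [lra|intros; ring|].
    apply is_CInt_minus; [rewrite <- (HI s Hs); now apply G|]. now apply is_CInt_scal, is_CInt_ray_arg. }
  apply (is_CInt_bound_const _ _ _ _ (e / (2 * PI * K) * K)) in Hdiff; [|lra|].
  - replace ((2 * PI - 0) * (e / (2 * PI * K) * K)) with e in Hdiff; [exact Hdiff|field; split; lra].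
  - intros t _. rewrite Cmod_mult. apply Rmult_le_compat; try apply Cmod_ge_0.
    + left. apply Hd'. unfold ray.
      replace (z + exp s * (rho * cis t - z) - z)%C with (exp s * (rho * cis t - z))%C by ring.
      rewrite Cmod_mult, Cmod_R, Rabs_pos_eq by (left; apply exp_pos).
      assert (E3 : Cmod (rho * cis t - z) <= 2).
      { eapply Rle_trans; [apply Cmod_triangle|].
        rewrite Cmod_opp, Cmod_mul_cis, Cmod_R, Rabs_pos_eq; lra. }
      assert (P := exp_pos s). nra.
    + assert (P := circle_sub_ge rho z t ltac:(lra)). unfold ray_arg.
      rewrite Cmod_div by (apply Cmod_gt_0; lra).
      rewrite Cmod_mul_cis, Cmod_mult, Cmod_Ci, Cmod_R, Rabs_pos_eq, Rmult_1_l by lra.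
      unfold K, Rdiv. rewrite <- (Rmult_1_l (/ (rho - Cmod z))).
      apply Rmult_le_compat; try lra.
      * left. apply Rinv_0_lt_compat; lra.
      * apply Rinv_le_contravar; lra. }
assert (HG := is_CInt_scal (/ Ci) _ _ _ _ (G 0 ltac:(lra))). fold I in HG. rewrite HIz in HG.
assert (HCi : Ci <> 0) by (intros E; injection E; lra).
replace (2 * PI * f z)%C with (/ Ci * (f z * (Ci * RtoC (2 * PI))))%C
  by (rewrite RtoC_mult; field; exact HCi).
revert HG. apply is_CInt_ext; [lra|]. intros t _.
replace (ray rho z 0 t) with (rho * cis t)%C by (unfold ray; rewrite exp_0; ring).
unfold ray_arg. rewrite cis_opp. field.
assert (rho * cis t - z <> 0)%C.
{ apply Cmod_gt_0. assert (H := circle_sub_ge rho z t ltac:(lra)). lra. }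
assert (cis t * rho - z <> 0)%C by (rewrite (Cmult_comm (cis t)); assumption).
repeat split; auto using cis_neq_0.
Qed.


(** * Power series and Taylor's theorem *)

Definition psum (a : nat -> C) (F : C -> C) (r : R) : Prop :=
  forall z, Cmod z < r -> Cser (fun n => a n * z ^ n)%C (F z).

Lemma Cser_ext (a b : nat -> C) (l : C) : (forall n, a n = b n) -> Cser a l -> Cser b l.
Proof. exact (is_series_ext (K := C_AbsRing) (V := C_NormedModule) a b l). Qed.

Lemma Cser_plus (a b : nat -> C) (l m : C) : Cser a l -> Cser b m ->
  Cser (fun n => a n + b n)%C (l + m)%C.
Proof. exact (is_series_plus (K := C_AbsRing) (V := C_NormedModule) a b l m). Qed.

Lemma Cser_scal (c : C) (a : nat -> C) (l : C) : Cser a l -> Cser (fun n => c * a n)%C (c * l)%C.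
Proof. exact (is_series_scal_l (K := C_AbsRing) (V := C_NormedModule) c a l). Qed.

Lemma Cser_decr (a : nat -> C) (l : C) : Cser (fun n => a (S n)) (l - a 0%nat)%C -> Cser a l.
Proof. exact (is_series_decr_1 (K := C_AbsRing) (V := C_NormedModule) a l). Qed.

Lemma Cser_incr (a : nat -> C) (l : C) : Cser a l -> Cser (fun n => a (S n)) (l - a 0%nat)%C.
Proof.
intros H. apply (is_series_incr_1 (K := C_AbsRing) (V := C_NormedModule)).
change (Cser a (l - a 0%nat + a 0%nat)%C).
now replace (l - a 0%nat + a 0%nat)%C with l by ring.
Qed.

Lemma Cser_dominated (a : nat -> C) (b : nat -> R) :
  (forall n, Cmod (a n) <= b n) -> ex_series b -> exists l, Cser a l.
Proof.
intros H Hb. apply (ex_series_le (K := C_AbsRing) (V := C_CompleteNormedModule) a b); [exact H|exact Hb].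
Qed.

Lemma Cser_terms_bounded (a : nat -> C) (l : C) : Cser a l -> exists M, 0 < M /\ forall n, Cmod (a n) <= M.
Proof.
intros H. rewrite Cser_eps in H. destruct (H 1 Rlt_0_1) as [N HN].
assert (G : forall K, exists M, 0 < M /\ forall n, (n <= K)%nat -> Cmod (a n) <= M).
{ induction K as [|K [M [HM IH]]].
  - exists (Cmod (a 0%nat) + 1). split; [assert (P := Cmod_ge_0 (a 0%nat)); lra|].
    intros n Hn. replace n with 0%nat by lia. lra.
  - exists (Rmax M (Cmod (a (S K)))). split; [eapply Rlt_le_trans; [exact HM|apply Rmax_l]|].
    intros n Hn. destruct (Nat.eq_dec n (S K)) as [->|Hne]; [apply Rmax_r|].
    eapply Rle_trans; [apply IH; lia|apply Rmax_l]. }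
destruct (G (S N)) as [M [HM IH]]. exists (Rmax M 2). split; [eapply Rlt_le_trans; [exact HM|apply Rmax_l]|].
intros n. destruct (Nat.le_gt_cases n (S N)) as [Hn|Hn].
- eapply Rle_trans; [now apply IH|apply Rmax_l].
- eapply Rle_trans; [|apply Rmax_r]. destruct n as [|n]; [lia|].
  replace (a (S n)) with ((Csum a (S n) - l) - (Csum a n - l))%C by (rewrite Csum_S; ring).
  eapply Rle_trans; [apply Cmod_triangle|]. rewrite Cmod_opp.
  assert (A1 := HN (S n) ltac:(lia)). assert (A2 := HN n ltac:(lia)). lra.
Qed.

Lemma Cser_norm_le (a : nat -> C) (l : C) (B : R) :
  (forall n, Cmod (Csum a n) <= B) -> Cser a l -> Cmod l <= B.
Proof.
intros H Hl. apply le_epsilon. intros e He. rewrite Cser_eps in Hl.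
destruct (Hl e He) as [N HN]. specialize (HN N (le_n N)). specialize (H N).
assert (T := Cmod_triangle_inv l (Csum a N)). rewrite Cmod_sub_comm in T. lra.
Qed.

Lemma Csum_le (a : nat -> C) (b : nat -> R) (B : R) :
  (forall n, Cmod (a n) <= b n) -> is_series b B -> forall n, Cmod (Csum a n) <= B.
Proof.
intros H Hb n.
assert (H1 : forall n, Cmod (Csum a n) <= sum_n b n).
{ induction n0 as [|m IH].
  - rewrite Csum_0, sum_O. apply H.
  - rewrite Csum_S, sum_Sn. eapply Rle_trans; [apply Cmod_triangle|].
    specialize (H (S m)). unfold plus; simpl. lra. }
eapply Rle_trans; [apply H1|].
assert (Hb0 : forall n, 0 <= b n) by (intros m; eapply Rle_trans; [apply Cmod_ge_0|apply H]).
apply (is_lim_seq_incr_compare (sum_n b) B); [exact Hb|].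
intros m. rewrite sum_Sn. change (sum_n b m <= sum_n b m + b (S m)). specialize (Hb0 (S m)). lra.
Qed.

(** These are the terms of the second derivative of the geometric series, and differentiation keeps
    the radius of convergence. *)
Lemma ex_series_quadratic_geom (q : R) : 0 <= q < 1 ->
  ex_series (fun n => INR (S n) * INR (S (S n)) * q ^ n).
Proof.
intros Hq.
assert (Hr : Rbar_lt (Rabs q) (CV_radius (PS_derive (PS_derive (fun _ => 1))))).
{ rewrite !CV_radius_derive. rewrite Rabs_pos_eq by lra.
  apply Rbar_lt_le_trans with ((q + 1) / 2); [simpl; lra|].
  apply (CV_radius_bounded (fun _ => 1)). exists 1. intros n. rewrite Rmult_1_l.
  rewrite Rabs_pos_eq by (apply pow_le; lra).
  rewrite <- (pow1 n) at 2. apply pow_incr. lra. }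
apply CV_radius_inside in Hr.
revert Hr. apply ex_series_ext.
intros n. unfold PS_derive. rewrite pow_n_pow. unfold scal; simpl; unfold mult; simpl. ring.
Qed.

(** If E is the remainder for the exponent n + 1, the next one is w E + (n + 1) z^n (w - z)^2. The
    factor [R0] on the left avoids the exponent n - 1, which would go wrong at n = 0. *)
Lemma taylor_remainder (w z : C) (R0 : R) (n : nat) : 0 < R0 -> Cmod w <= R0 -> Cmod z <= R0 ->
  R0 * Cmod (w ^ S n - z ^ S n - INR (S n) * z ^ n * (w - z)) <=
  INR n * INR (S n) * R0 ^ n * Cmod (w - z) ^ 2.
Proof.
intros HR Hw Hz. induction n as [|n IH].
- replace (w ^ 1 - z ^ 1 - INR 1 * z ^ 0 * (w - z))%C with (RtoC 0) by (simpl; ring).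
  rewrite Cmod_0. simpl. lra.
- set (E := (w ^ S n - z ^ S n - INR (S n) * z ^ n * (w - z))%C) in *.
  replace (w ^ S (S n) - z ^ S (S n) - INR (S (S n)) * z ^ S n * (w - z))%C
   with (w * E + INR (S n) * z ^ n * (w - z) ^ 2)%C.
  2:{ unfold E. rewrite (S_INR (S n)), RtoC_plus. simpl Cpow. ring. }
  assert (T := Cmod_triangle (w * E) (INR (S n) * z ^ n * (w - z) ^ 2)).
  rewrite !Cmod_mult, !Cmod_pow, Cmod_R, Rabs_pos_eq in T by apply pos_INR.
  set (d := Cmod (w - z)) in *.
  assert (Hd : 0 <= d ^ 2) by apply pow2_ge_0.
  assert (Hzn : Cmod z ^ n <= R0 ^ n) by (apply pow_incr; split; [apply Cmod_ge_0|exact Hz]).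
  assert (HE := Cmod_ge_0 E).
  assert (P0 : 0 <= R0 ^ n) by (apply pow_le; lra).
  assert (P1 : Cmod w * Cmod E <= R0 * Cmod E) by (apply Rmult_le_compat_r; lra).
  assert (HI := pos_INR (S n)).
  assert (P2 : INR (S n) * Cmod z ^ n * d ^ 2 <= INR (S n) * R0 ^ n * d ^ 2).
  { apply Rmult_le_compat_r; [exact Hd|]. apply Rmult_le_compat_l; lra. }
  apply Rmult_le_compat_l with (r := R0) in T; [|lra].
  eapply Rle_trans; [exact T|].
  assert (P3 : R0 * (R0 * Cmod E + INR (S n) * R0 ^ n * d ^ 2) <=
    R0 * (INR n * INR (S n) * R0 ^ n * d ^ 2 + INR (S n) * R0 ^ n * d ^ 2)).
  { apply Rmult_le_compat_l; lra. }
  assert (P4 : R0 * (Cmod w * Cmod E + INR (S n) * Cmod z ^ n * d ^ 2) <=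
    R0 * (R0 * Cmod E + INR (S n) * R0 ^ n * d ^ 2)) by (apply Rmult_le_compat_l; lra).
  eapply Rle_trans; [exact P4|]. eapply Rle_trans; [exact P3|].
  replace (R0 * _) with (INR (S n) * (INR n + 1) * (R0 * R0 ^ n * d ^ 2)) by ring.
  rewrite (S_INR (S n)), (S_INR n). simpl pow at 3.
  assert (0 <= R0 * R0 ^ n * d ^ 2) by (apply Rmult_le_pos; [apply Rmult_le_pos; lra|exact Hd]).
  assert (0 <= INR n) by apply pos_INR. 
  replace ((INR n + 1) * (INR n + 1 + 1) * (R0 * R0 ^ n) * d ^ 2) with 
   ((INR n + 1) * (INR n + 1 + 1) * (R0 * R0 ^ n * d ^ 2)) by ring.
  apply Rmult_le_compat_r; [assumption|]. apply Rmult_le_compat_l; lra.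
Qed.

Definition dcoef (a : nat -> C) (n : nat) : C := (INR (S n) * a (S n))%C.

Lemma psum_coef_bound (a : nat -> C) (F : C -> C) (r rho : R) :
  psum a F r -> 0 <= rho < r -> exists M, 0 < M /\ forall n, Cmod (a n) * rho ^ n <= M.
Proof.
intros H Hr. assert (Hm : Cmod rho = rho) by (rewrite Cmod_R; apply Rabs_pos_eq; lra).
destruct (Cser_terms_bounded _ _ (H (RtoC rho) ltac:(lra))) as [M [HM HM']].
exists M; split; [exact HM|]. intros n. specialize (HM' n).
rewrite Cmod_mult, Cmod_pow, Hm in HM'. exact HM'.
Qed.

Lemma psum_intro (a : nat -> C) (r : R) :
  (forall z, Cmod z < r -> exists l, Cser (fun n => a n * z ^ n)%C l) -> exists F, psum a F r.
Proof.
intros H. exists (fun z => epsilon (inhabits (RtoC 0)) (fun l => Cser (fun n => a n * z ^ n)%C l)).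
intros z Hz. apply epsilon_spec. now apply H.
Qed.

(** Summing [taylor_remainder] over a disc of radius [R0] strictly between |z| and r bounds F w - F
    z - F1 z (w - z) by a constant times |w - z|^2. *)
Theorem psum_derive (a : nat -> C) (F : C -> C) (r : R) : psum a F r ->
  exists F1, psum (dcoef a) F1 r /\ forall z, Cmod z < r -> cderiv F z (F1 z).
Proof.
intros H.
assert (Hb : forall R0, 0 < R0 < r -> exists B, ex_series B /\ forall n, 
  Cmod (a (S n)) * (INR (S n) * INR (S (S n)) * R0 ^ n) <= B n).
{ intros R0 HR0. set (rho := (R0 + r) / 2).
  destruct (psum_coef_bound a F r rho H) as [M [HM HM']]; [unfold rho; lra|].
  assert (Hrho : R0 < rho) by (unfold rho; lra).
  exists (fun n => M / rho * (INR (S n) * INR (S (S n)) * (R0 / rho) ^ n)). split.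
  - apply (ex_series_scal (V := R_NormedModule) (M / rho)), ex_series_quadratic_geom. split.
    + apply Rdiv_le_0_compat; lra.
    + apply Rlt_div_l; lra.
  - intros n. specialize (HM' (S n)). simpl pow in HM'.
    assert (Hp : 0 < rho ^ n) by (apply pow_lt; lra).
    unfold Rdiv at 2. rewrite Rpow_mult_distr, pow_inv.
    replace (M / rho * (INR (S n) * INR (S (S n)) * (R0 ^ n * / rho ^ n)))
      with (M * / (rho * rho ^ n) * (INR (S n) * INR (S (S n)) * R0 ^ n)) by (field; lra).
    apply Rmult_le_compat_r.
    + apply Rmult_le_pos; [apply Rmult_le_pos; apply pos_INR|apply pow_le; lra].
    + apply Rle_div_r; [nra|]. exact HM'. }
destruct (psum_intro (dcoef a) r) as [F1 HF1].
{ intros z Hz. assert (Hz0 := Cmod_ge_0 z). set (R0 := (Cmod z + r) / 2).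
  destruct (Hb R0) as [B [HB HB']]; [unfold R0; lra|].
  apply (Cser_dominated _ B); [|exact HB]. intros n. eapply Rle_trans; [|apply HB'].
  unfold dcoef. rewrite !Cmod_mult, Cmod_pow, Cmod_R, Rabs_pos_eq by apply pos_INR.
  rewrite (Rmult_comm _ (Cmod (a (S n)))), Rmult_assoc. apply Rmult_le_compat_l; [apply Cmod_ge_0|].
  rewrite Rmult_assoc. apply Rmult_le_compat_l; [apply pos_INR|].
  assert (HI : 1 <= INR (S (S n))) by (rewrite !S_INR; assert (P := pos_INR n); lra).
  assert (Cmod z ^ n <= R0 ^ n) by (apply pow_incr; unfold R0; lra).
  assert (0 <= Cmod z ^ n) by (apply pow_le; lra). nra. }
exists F1. split; [exact HF1|]. intros z Hz. assert (Hz0 := Cmod_ge_0 z).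
set (R0 := (Cmod z + r) / 2).
destruct (Hb R0) as [B [[K HK] HB']]; [unfold R0; lra|].
assert (HR0 : 0 < R0) by (unfold R0; lra).
assert (HK0 : 0 <= K).
{ eapply Rle_trans; [apply Cmod_ge_0|]. apply (Csum_le (fun _ => 0) B K) with (n := 0%nat); [|exact HK].
  intros n. rewrite Cmod_0. eapply Rle_trans; [|apply HB'].
  repeat apply Rmult_le_pos; try apply Cmod_ge_0; try apply pos_INR. apply pow_le; lra. }
assert (Hq : forall w, Cmod w < R0 -> Cmod (F w - F z - F1 z * (w - z)) <= K / R0 * Cmod (w - z) ^ 2).
{ intros w Hw.
  assert (S1 := Cser_incr _ _ (H w ltac:(unfold R0 in Hw; lra))).
  assert (S2 := Cser_incr _ _ (H z Hz)).
  assert (S3 := Cser_scal (- (w - z)) _ _ (HF1 z Hz)).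
  assert (S4 := Cser_plus _ _ _ _ (Cser_plus _ _ _ _ S1 (Cser_scal (-(1)) _ _ S2)) S3).
  replace (F w - F z - F1 z * (w - z))%C with
    (F w - a 0%nat * w ^ 0 + (- (1)) * (F z - a 0%nat * z ^ 0) + - (w - z) * F1 z)%C by (simpl; ring).
  apply (Cser_norm_le _ _ _) with (2 := S4).
  apply (Csum_le _ (fun n => Cmod (w - z) ^ 2 / R0 * B n)).
  - intros n. cbn beta. unfold dcoef.
    replace (a (S n) * w ^ S n + - (1) * (a (S n) * z ^ S n) + - (w - z) * (INR (S n) * a (S n) * z ^ n))%C
     with (a (S n) * (w ^ S n - z ^ S n - INR (S n) * z ^ n * (w - z)))%C by ring.
    rewrite Cmod_mult.
    assert (T := taylor_remainder w z R0 n HR0 ltac:(lra) ltac:(unfold R0; lra)).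
    specialize (HB' n).
    assert (T2 : R0 * Cmod (w ^ S n - z ^ S n - INR (S n) * z ^ n * (w - z)) <=
      INR (S n) * INR (S (S n)) * R0 ^ n * Cmod (w - z) ^ 2).
    { eapply Rle_trans; [exact T|]. apply Rmult_le_compat_r; [apply pow2_ge_0|].
      apply Rmult_le_compat_r; [apply pow_le; lra|].
      rewrite (Rmult_comm (INR n)). apply Rmult_le_compat_l; [apply pos_INR|].
      rewrite !S_INR. lra. }
    set (E := Cmod (w ^ S n - z ^ S n - INR (S n) * z ^ n * (w - z))) in *.
    set (d := Cmod (w - z) ^ 2) in *.
    assert (Hd : 0 <= d) by apply pow2_ge_0.
    assert (T3 := Rmult_le_compat_l _ _ _ (Cmod_ge_0 (a (S n))) T2).
    assert (T4 := Rmult_le_compat_r d _ _ Hd HB').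
    replace (d / R0 * B n) with (d * B n / R0) by (field; lra).
    apply (Rmult_le_reg_r R0); [exact HR0|].
    replace (d * B n / R0 * R0) with (d * B n) by (field; lra). lra.
  - replace (K / R0 * Cmod (w - z) ^ 2) with (Cmod (w - z) ^ 2 / R0 * K) by (field; lra).
    apply (is_series_scal_l (V := R_NormedModule)). exact HK. }
apply cderiv_eps. intros e He.
assert (HKR : 0 <= K / R0) by (apply Rdiv_le_0_compat; lra).
exists (Rmin (R0 - Cmod z) (e / (K / R0 + 1))). split.
{ apply Rmin_glb_lt; [unfold R0; lra|apply Rdiv_lt_0_compat; lra]. }
intros w Hw.
assert (Hw1 : Cmod (w - z) < R0 - Cmod z) by (eapply Rlt_le_trans; [exact Hw|apply Rmin_l]).
assert (Hw2 : Cmod (w - z) < e / (K / R0 + 1)) by (eapply Rlt_le_trans; [exact Hw|apply Rmin_r]).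
apply Rlt_div_r in Hw2; [|lra].
assert (T := Cmod_triangle_inv w z).
eapply Rle_trans; [apply Hq; lra|].
assert (Hd := Cmod_ge_0 (w - z)). simpl. rewrite Rmult_1_r.
rewrite <- Rmult_assoc. apply Rmult_le_compat_r; [exact Hd|]. lra.
Qed.

Lemma psum_holo (a : nat -> C) (F : C -> C) (r : R) : psum a F r -> holo F r.
Proof.
intros H z Hz. destruct (psum_derive a F r H) as [F1 [_ HF1]]. exists (F1 z). now apply HF1.
Qed.

Lemma psum_0 (a : nat -> C) (F : C -> C) (r : R) : 0 < r -> psum a F r -> F 0 = a 0%nat.
Proof.
intros Hr H. apply (Cser_unique (fun n => a n * 0 ^ n)%C).
- apply H. now rewrite Cmod_0.
- apply Cser_eps. intros e He. exists 0%nat. intros n _.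
  replace (Csum (fun n => a n * 0 ^ n)%C n) with (a 0%nat).
  + replace (a 0%nat - a 0%nat)%C with (RtoC 0) by ring. now rewrite Cmod_0.
  + induction n as [|n IH].
    * rewrite Csum_0. simpl. ring.
    * rewrite Csum_S, <- IH. simpl. ring.
Qed.

Lemma psum_tail (a : nat -> C) (F : C -> C) (r : R) : psum a F r ->
  exists G, psum (fun n => a (S n)) G r /\ forall z, Cmod z < r -> F z = (a 0%nat + z * G z)%C.
Proof.
intros H.
assert (E : forall z : C, z <> 0 -> Cmod z < r ->
   Cser (fun n => a (S n) * z ^ n)%C (/ z * (F z - a 0%nat))%C).
{ intros z Hz Hzr. assert (H1 := Cser_incr _ _ (H z Hzr)).
  apply (Cser_scal (/ z)) in H1. simpl Cpow in H1. rewrite Cmult_1_r in H1.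
  revert H1. apply Cser_ext. intros n. field. exact Hz. }
destruct (psum_intro (fun n => a (S n)) r) as [G HG].
{ intros z Hz. destruct (Ceq_dec z 0) as [->|Hne]; [|eauto].
  exists (a 1%nat). apply Cser_eps. intros e He. exists 0%nat. intros n _.
  replace (Csum (fun n => a (S n) * 0 ^ n)%C n) with (a 1%nat).
  + replace (a 1%nat - a 1%nat)%C with (RtoC 0) by ring. now rewrite Cmod_0.
  + induction n as [|n IH].
    * rewrite Csum_0. simpl. ring.
    * rewrite Csum_S, <- IH. simpl. ring. }
exists G. split; [exact HG|]. intros z Hz.
destruct (Ceq_dec z 0) as [->|Hne].
- rewrite (psum_0 a F r); [ring| |exact H]. now rewrite Cmod_0 in Hz.
- rewrite (Cser_unique _ _ _ (HG z Hz) (E z Hne Hz)). field. exact Hne.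
Qed.

Lemma ccont_eq_0 (f g : C -> C) (r : R) : 0 < r -> ccont f 0 -> ccont g 0 ->
  (forall z : C, z <> 0 -> Cmod z < r -> f z = g z) -> f 0 = g 0.
Proof.
intros Hr Hf Hg H.
assert (E : Cmod (f 0 - g 0) = 0).
{ apply Rle_antisym; [|apply Cmod_ge_0]. apply le_epsilon. intros e He. rewrite Rplus_0_l.
  destruct (Hf (e/2) ltac:(lra)) as [d1 [Hd1 H1]]. destruct (Hg (e/2) ltac:(lra)) as [d2 [Hd2 H2]].
  set (d := Rmin r (Rmin d1 d2) / 2).
  assert (Hd : 0 < d) by (unfold d; assert (0 < Rmin r (Rmin d1 d2)) by (repeat apply Rmin_glb_lt; assumption); lra).
  assert (A1 : d < r /\ d < d1 /\ d < d2).
  { assert (P1 := Rmin_l r (Rmin d1 d2)). assert (P2 := Rmin_r r (Rmin d1 d2)).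
    assert (P3 := Rmin_l d1 d2). assert (P4 := Rmin_r d1 d2). unfold d in *. lra. }
  clearbody d.
  assert (Hm : Cmod d = d) by (rewrite Cmod_R; apply Rabs_pos_eq; lra).
  assert (Hm0 : Cmod (d - 0) = d) by (replace (d - 0)%C with (RtoC d) by ring; exact Hm).
  assert (Hdn : RtoC d <> 0) by (intros E; apply RtoC_inj in E; lra).
  specialize (H1 d ltac:(lra)). specialize (H2 d ltac:(lra)).
  rewrite (H d Hdn ltac:(lra)) in H1.
  assert (T := Cmod_triangle_sub (f 0) (g d) (g 0)). rewrite (Cmod_sub_comm (f 0) (g d)) in T. lra. }
apply Cmod_eq_0 in E. replace (f 0) with (f 0 - g 0 + g 0)%C by ring. rewrite E. ring.
Qed.

Lemma Cmult_cancel_l (z a b : C) : z <> 0 -> (z * a = z * b)%C -> a = b.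
Proof.
intros Hz H. replace a with (/ z * (z * a))%C by (field; exact Hz). rewrite H. field. exact Hz.
Qed.

Theorem psum_unique (a b : nat -> C) (F : C -> C) (r : R) : 0 < r ->
  psum a F r -> psum b F r -> forall n, a n = b n.
Proof.
intros Hr Ha Hb n. revert a b F Ha Hb.
(* Generalised to two functions that agree only off 0: the inductive step divides by z, which says
   nothing at 0, and continuity restores the constant term. *)
assert (G : forall n a b F F', psum a F r -> psum b F' r ->
   (forall z : C, z <> 0 -> Cmod z < r -> F z = F' z) -> a n = b n).
{ assert (G0 : forall a b F F', psum a F r -> psum b F' r ->
   (forall z : C, z <> 0 -> Cmod z < r -> F z = F' z) -> a 0%nat = b 0%nat).
  { intros a b F F' Ha Hb H. rewrite <- (psum_0 a F r), <- (psum_0 b F' r) by assumption.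
    apply (ccont_eq_0 F F' r Hr); [| |exact H];
    apply (holo_cont _ r); try (rewrite Cmod_0; assumption); eapply psum_holo; eassumption. }
  induction n0 as [|m IH]; intros a b F F' Ha Hb H; [eapply G0; eassumption|].
  destruct (psum_tail a F r Ha) as [A [HA HA']]. destruct (psum_tail b F' r Hb) as [B [HB HB']].
  apply (IH (fun n => a (S n)) (fun n => b (S n)) A B HA HB).
  intros z Hz Hzr. assert (E := H z Hz Hzr). rewrite HA', HB', (G0 a b F F' Ha Hb H) in E by exact Hzr.
  apply (Cmult_cancel_l z); [exact Hz|].
  replace (z * A z)%C with (b 0%nat + z * A z - b 0%nat)%C by ring. rewrite E. ring. }
intros a b F Ha Hb. exact (G n a b F F Ha Hb (fun _ _ _ => eq_refl)).
Qed.

Lemma psum_le (a : nat -> C) (F : C -> C) (r r' : R) : r' <= r -> psum a F r -> psum a F r'.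
Proof. intros Hr H z Hz. apply H; lra. Qed.

Lemma psum_ext (a : nat -> C) (F G : C -> C) (r : R) :
  (forall z, Cmod z < r -> F z = G z) -> psum a F r -> psum a G r.
Proof. intros H Ha z Hz. rewrite <- H by exact Hz. now apply Ha. Qed.

Lemma psum_coef_ext (a b : nat -> C) (F : C -> C) (r : R) :
  (forall n, a n = b n) -> psum a F r -> psum b F r.
Proof.
intros H Ha z Hz. apply (Cser_ext (fun n => a n * z ^ n)%C); [|now apply Ha].
intros n. now rewrite H.
Qed.

Lemma RtoC_2PI_neq_0 : (2 * PI)%C <> 0.
Proof.
rewrite <- RtoC_mult. intros E. apply RtoC_inj in E. assert (HP := PI2_pos). lra.
Qed.

Lemma cauchy_taylor (f : C -> C) (rho : R) : holo f 1 -> 0 < rho < 1 ->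
  psum (fun n => / (2 * PI) * fourier (fun t => f (rho * cis t)%C) n * / rho ^ n)%C f rho.
Proof.
intros Hf Hrho z Hz.
assert (Hrn : RtoC rho <> 0) by (intros E; apply RtoC_inj in E; lra).
assert (Hc : rcont_on (fun t => f (rho * cis t)%C) 0 (2 * PI)).
{ intros t _. apply (rcont_comp f); [|apply rcont_mult; [apply rcont_const|apply rcont_cis]].
  apply (holo_cont f 1); [exact Hf|]. rewrite Cmod_mul_cis, Cmod_R, Rabs_pos_eq; lra. }
assert (Hzr : Cmod (z / rho) < 1).
{ rewrite Cmod_div, Cmod_R, Rabs_pos_eq by (assumption || lra). apply Rlt_div_l; lra. }
assert (H1 := cauchy_kernel_series _ (z / rho) Hc Hzr). cbv beta in H1.
rewrite (is_CInt_unique _ _ _ _ (cauchy_formula f rho z ltac:(lra) Hz Hf)) in H1.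
apply (Cser_scal (/ (2 * PI))) in H1.
replace (/ (2 * PI) * (2 * PI * f z))%C with (f z) in H1
  by (rewrite Cmult_assoc, Cinv_l by exact RtoC_2PI_neq_0; ring).
revert H1. apply Cser_ext. intros n. unfold Cdiv. rewrite Cpow_mult_l, Cpow_inv by exact Hrn. ring.
Qed.

(** The coefficients from [cauchy_taylor] depend a priori on the radius. By uniqueness on the disc
    of radius 1/2 they coincide for all larger radii, so those of 1/2 serve on the whole unit
    disc. *)
Theorem taylor_unit (f : C -> C) : holo f 1 -> exists a, psum a f 1.
Proof.
intros Hf.
set (a := fun (rho : R) n => (/ (2 * PI) * fourier (fun t => f (rho * cis t)%C) n * / rho ^ n)%C).
assert (H : forall rho, 0 < rho < 1 -> psum (a rho) f rho) by (intros; now apply cauchy_taylor).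
exists (a (1 / 2)). intros z Hz. assert (Hz0 := Cmod_ge_0 z).
set (rho := Rmax (1 / 2) ((1 + Cmod z) / 2)).
assert (H1 : 1 / 2 <= rho) by apply Rmax_l.
assert (H2 : (1 + Cmod z) / 2 <= rho) by apply Rmax_r.
assert (H3 : rho < 1) by (apply Rmax_lub_lt; lra).
assert (H4 := psum_unique (a (1/2)) (a rho) f (1/2) ltac:(lra) (H (1/2) ltac:(lra))
  (psum_le _ _ _ _ H1 (H rho ltac:(lra)))).
apply (psum_coef_ext (a rho) (a (1/2)) f rho (fun n => eq_sym (H4 n))); [apply H|]; lra.
Qed.

Lemma fourier_psum (a : nat -> C) (f : C -> C) (rho : R) (n : nat) : psum a f 1 -> 0 < rho < 1 ->
  fourier (fun t => f (rho * cis t)%C) n = (2 * PI * a n * rho ^ n)%C.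
Proof.
intros Ha Hrho.
assert (Hrn : (rho ^ n)%C <> 0) by (apply Cpow_nz; intros E; apply RtoC_inj in E; lra).
rewrite (psum_unique _ _ _ rho ltac:(lra) (psum_le _ _ 1 rho ltac:(lra) Ha)
  (cauchy_taylor f rho (psum_holo _ _ _ Ha) Hrho) n).
assert (E : (2 * PI * / (2 * PI) = 1)%C) by (apply Cinv_r; exact RtoC_2PI_neq_0).
transitivity (2 * PI * / (2 * PI) * fourier (fun t => f (rho * cis t)%C) n * (/ rho ^ n * rho ^ n))%C; [|ring].
rewrite E, Cinv_l by exact Hrn. ring.
Qed.

Theorem taylor (f : C -> C) (r : R) : 0 < r -> holo f r -> exists a, psum a f r.
Proof.
intros Hr Hf.
assert (Hrn : RtoC r <> 0) by (intros E; apply RtoC_inj in E; lra).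
destruct (taylor_unit (fun z => f (r * z)%C)) as [a Ha].
{ intros z Hz. destruct (Hf (r * z)%C) as [l Hl].
  { rewrite Cmod_mult, Cmod_R, Rabs_pos_eq by lra. nra. }
  exists (r * 1 * l)%C. apply (cderiv_comp f (fun z => r * z)%C); [exact Hl|].
  apply cderiv_scal, cderiv_id. }
exists (fun n => a n * / r ^ n)%C. intros z Hz.
assert (H1 := Ha (z / r)%C). cbv beta in H1.
replace (r * (z / r))%C with z in H1 by (field; exact Hrn).
assert (Hz' : Cmod (z / r) < 1).
{ rewrite Cmod_div, Cmod_R, Rabs_pos_eq by (assumption || lra). apply Rlt_div_l; lra. }
generalize (H1 Hz'). apply Cser_ext. intros n.
unfold Cdiv. rewrite Cpow_mult_l, Cpow_inv by exact Hrn. ring.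
Qed.


(** * Products, composition and logarithms of power series *)

Lemma holo_le (f : C -> C) (r r' : R) : r' <= r -> holo f r -> holo f r'.
Proof. intros Hr H z Hz. apply H; lra. Qed.

Lemma holo_const (c : C) (r : R) : holo (fun _ => c) r.
Proof. intros z _. eexists. apply cderiv_const. Qed.

Lemma holo_id (r : R) : holo (fun z => z) r.
Proof. intros z _. eexists. apply cderiv_id. Qed.

Lemma holo_plus (f g : C -> C) (r : R) : holo f r -> holo g r -> holo (fun z => f z + g z)%C r.
Proof.
intros Hf Hg z Hz. destruct (Hf z Hz) as [a Ha]. destruct (Hg z Hz) as [b Hb].
eexists. apply cderiv_plus; eassumption.
Qed.

Lemma holo_minus (f g : C -> C) (r : R) : holo f r -> holo g r -> holo (fun z => f z - g z)%C r.
Proof.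
intros Hf Hg z Hz. destruct (Hf z Hz) as [a Ha]. destruct (Hg z Hz) as [b Hb].
eexists. apply cderiv_minus; eassumption.
Qed.

Lemma holo_mult (f g : C -> C) (r : R) : holo f r -> holo g r -> holo (fun z => f z * g z)%C r.
Proof.
intros Hf Hg z Hz. destruct (Hf z Hz) as [a Ha]. destruct (Hg z Hz) as [b Hb].
eexists. apply cderiv_mult; eassumption.
Qed.

Lemma holo_inv (f : C -> C) (r : R) :
  (forall z, Cmod z < r -> f z <> 0) -> holo f r -> holo (fun z => / f z)%C r.
Proof.
intros H0 Hf z Hz. destruct (Hf z Hz) as [a Ha]. eexists. apply cderiv_inv; [auto|eassumption].
Qed.

Lemma holo_comp (f g : C -> C) (r r' : R) :
  (forall z, Cmod z < r -> Cmod (g z) < r') -> holo f r' -> holo g r -> holo (fun z => f (g z)) r.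
Proof.
intros H Hf Hg z Hz. destruct (Hf _ (H z Hz)) as [a Ha]. destruct (Hg z Hz) as [b Hb].
eexists. apply cderiv_comp; eassumption.
Qed.

Lemma holo_Cexp (f : C -> C) (r : R) : holo f r -> holo (fun z => Cexp (f z)) r.
Proof.
intros Hf z Hz. destruct (Hf z Hz) as [a Ha]. eexists. apply (cderiv_comp Cexp f); [apply cderiv_Cexp|eassumption].
Qed.

Lemma holo_pow (f : C -> C) (r : R) (n : nat) : holo f r -> holo (fun z => f z ^ n)%C r.
Proof.
intros Hf. induction n as [|n IH]; simpl; [apply holo_const|now apply holo_mult].
Qed.

Lemma holo_ext (f g : C -> C) (r : R) : (forall z, Cmod z < r -> f z = g z) -> holo f r -> holo g r.
Proof.
intros H Hf z Hz. destruct (Hf z Hz) as [a Ha]. exists a.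
apply (cderiv_ext_loc f g z a (r - Cmod z)); [lra| |exact Ha].
intros w Hw. apply H. assert (T := Cmod_triangle_inv w z). lra.
Qed.

Lemma holo_derive (f : C -> C) (r : R) : 0 < r -> holo f r ->
  exists f1, holo f1 r /\ forall z, Cmod z < r -> cderiv f z (f1 z).
Proof.
intros Hr Hf. destruct (taylor f r Hr Hf) as [a Ha].
destruct (psum_derive a f r Ha) as [f1 [H1 H2]]. exists f1. split; [|exact H2].
eapply psum_holo; eassumption.
Qed.

Lemma psum_plus (a b : nat -> C) (F G : C -> C) (r : R) : psum a F r -> psum b G r ->
  psum (fun n => a n + b n)%C (fun z => F z + G z)%C r.
Proof.
intros Ha Hb z Hz. generalize (Cser_plus _ _ _ _ (Ha z Hz) (Hb z Hz)).
apply Cser_ext. intros n. ring.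
Qed.

Lemma psum_scal (c : C) (a : nat -> C) (F : C -> C) (r : R) : psum a F r ->
  psum (fun n => c * a n)%C (fun z => c * F z)%C r.
Proof.
intros Ha z Hz. generalize (Cser_scal c _ _ (Ha z Hz)). apply Cser_ext. intros n. ring.
Qed.

Definition shift_coef (a : nat -> C) (n : nat) : C := match n with O => 0 | S k => a k end.

Lemma psum_shift (a : nat -> C) (F : C -> C) (r : R) : psum a F r ->
  psum (shift_coef a) (fun z => z * F z)%C r.
Proof.
intros Ha z Hz. apply Cser_decr. simpl.
replace (z * F z - 0 * 1)%C with (z * F z)%C by ring.
generalize (Cser_scal z _ _ (Ha z Hz)). apply Cser_ext. intros n. ring.
Qed.

Lemma psum_const (c : C) (r : R) : psum (fun n => match n with O => c | _ => 0 end) (fun _ => c) r.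
Proof.
intros z _. apply Cser_eps. intros e He. exists 0%nat. intros n _.
replace (Csum _ n) with c.
- replace (c - c)%C with (RtoC 0) by ring. now rewrite Cmod_0.
- induction n as [|n IH].
  + rewrite Csum_0. simpl. ring.
  + rewrite Csum_S, <- IH. ring.
Qed.

Lemma Csum_ext (a b : nat -> C) (n : nat) : (forall k, (k <= n)%nat -> a k = b k) -> Csum a n = Csum b n.
Proof. exact (sum_n_ext_loc (G := C_AbelianGroup) a b n). Qed.

Lemma Csum_scal (c : C) (a : nat -> C) (n : nat) : Csum (fun k => c * a k)%C n = (c * Csum a n)%C.
Proof. exact (sum_n_mult_l (K := C_Ring) c a n). Qed.

Lemma Csum_shift (a : nat -> C) (n : nat) : Csum a (S n) = (a 0%nat + Csum (fun k => a (S k)) n)%C.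
Proof.
induction n as [|n IH].
- now rewrite Csum_S, !Csum_0.
- rewrite Csum_S, IH, Csum_S. ring.
Qed.

Definition conv (a b : nat -> C) (n : nat) : C := Csum (fun k => a k * b (n - k)%nat)%C n.

Lemma conv_S (a b : nat -> C) (n : nat) :
  conv a b (S n) = (a 0%nat * b (S n) + conv (fun k => a (S k)) b n)%C.
Proof. unfold conv. rewrite Csum_shift. reflexivity. Qed.

(** The product is holomorphic, hence has a Taylor series; its coefficients are then identified by
    splitting off the constant term of [F] and inducting on the index. No double series is
    rearranged. *)
Theorem psum_mult (a b : nat -> C) (F G : C -> C) (r : R) : 0 < r -> psum a F r -> psum b G r ->
  psum (conv a b) (fun z => F z * G z)%C r.
Proof.
intros Hr Ha Hb.
assert (HG : holo G r) by (eapply psum_holo; eassumption).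
destruct (taylor (fun z => F z * G z)%C r Hr) as [c Hc].
{ apply holo_mult; [eapply psum_holo; eassumption|exact HG]. }
apply (psum_coef_ext c); [|exact Hc].
intros n. revert a F c Ha Hc. induction n as [|n IH]; intros a F c Ha Hc.
- unfold conv. rewrite Csum_0, <- (psum_0 _ _ _ Hr Hc), (psum_0 _ _ _ Hr Ha), (psum_0 _ _ _ Hr Hb).
  reflexivity.
- destruct (psum_tail a F r Ha) as [F1 [H1 H2]].
  destruct (taylor (fun z => F1 z * G z)%C r Hr) as [d Hd].
  { apply holo_mult; [eapply psum_holo; eassumption|exact HG]. }
  assert (Hc' := psum_plus _ _ _ _ _ (psum_scal (a 0%nat) _ _ _ Hb) (psum_shift _ _ _ Hd)).
  apply (psum_ext _ _ (fun z => F z * G z)%C) in Hc'.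
  2:{ intros z Hz. rewrite (H2 z Hz). ring. }
  rewrite (psum_unique _ _ _ _ Hr Hc Hc' (S n)), conv_S. simpl.
  now rewrite (IH _ _ _ H1 Hd).
Qed.

Lemma psum_high_order (m : nat) (c : nat -> C) (G : C -> C) (r : R) : 0 < r -> holo G r ->
  psum c (fun z => z ^ m * G z)%C r -> forall n, (n < m)%nat -> c n = 0.
Proof.
intros Hr HG. revert c. induction m as [|m IH]; intros c Hc n Hn; [lia|].
destruct (taylor (fun z => z ^ m * G z)%C r Hr) as [d Hd].
{ apply holo_mult; [apply holo_pow, holo_id|exact HG]. }
assert (Hc' := psum_shift _ _ _ Hd).
apply (psum_ext _ _ (fun z => z ^ S m * G z)%C) in Hc'.
2:{ intros z _. rewrite Cpow_S. ring. }
rewrite (psum_unique _ _ _ _ Hr Hc Hc' n). destruct n as [|n]; [reflexivity|].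
simpl. apply (IH d Hd). lia.
Qed.

Lemma psum_Csum (e : nat -> nat -> C) (F : nat -> C -> C) (phi : nat -> C) (r : R) (N : nat) :
  (forall k, psum (e k) (F k) r) ->
  psum (fun n => Csum (fun k => phi k * e k n)%C N) (fun z => Csum (fun k => phi k * F k z)%C N) r.
Proof.
intros H. induction N as [|N IH].
- intros z Hz. generalize (psum_scal (phi 0%nat) _ _ _ (H 0%nat) z Hz). rewrite Csum_0.
  apply Cser_ext. intros n. now rewrite Csum_0.
- intros z Hz. generalize (psum_plus _ _ _ _ _ IH (psum_scal (phi (S N)) _ _ _ (H (S N))) z Hz).
  rewrite Csum_S. apply Cser_ext. intros n. now rewrite Csum_S.
Qed.

(* The coefficient of order [n] of [P o Y] only sees the terms of order at most [n] of [P],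
   because [Y] vanishes at the origin. *)
Theorem psum_comp (phi : nat -> C) (P Y y : C -> C) (r r' : R) (e : nat -> nat -> C) :
  0 < r -> 0 < r' -> psum phi P r' -> holo y r -> (forall z, Cmod z < r -> Y z = z * y z)%C ->
  (forall z, Cmod z < r -> Cmod (Y z) < r') ->
  (forall k, psum (e k) (fun z => Y z ^ k)%C r) ->
  psum (fun n => Csum (fun k => phi k * e k n)%C n) (fun z => P (Y z)) r.
Proof.
intros Hr Hr' HP Hy HYy HY He.
assert (HYh : holo Y r).
{ apply (holo_ext (fun z => z * y z)%C); [intros; symmetry; auto|].
  apply holo_mult; [apply holo_id|exact Hy]. }
destruct (taylor (fun z => P (Y z)) r Hr) as [c Hc].
{ apply (holo_comp P Y r r'); auto. eapply psum_holo; eassumption. }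
(* P is its partial sum plus w^(N+1) Q. After the substitution w = z y(z) the second part starts at
   order N + 1 in z. *)
assert (G : forall N, exists Q, psum (fun n => phi (n + S N)%nat) Q r' /\
  forall w, Cmod w < r' -> P w = (Csum (fun k => phi k * w ^ k)%C N + w ^ S N * Q w)%C).
{ induction N as [|N [Q [HQ HQ']]].
  - destruct (psum_tail phi P r' HP) as [Q [HQ HQ']]. exists Q. split.
    + apply (psum_coef_ext _ _ _ _ (fun n => f_equal phi (eq_sym (Nat.add_1_r n))) HQ).
    + intros w Hw. rewrite HQ' by exact Hw. rewrite Csum_0. simpl. ring.
  - destruct (psum_tail _ Q r' HQ) as [Q1 [HQ1 HQ1']]. exists Q1. split.
    + apply (psum_coef_ext _ _ _ _ (fun n => f_equal phi (eq_sym (Nat.add_succ_r n (S N)))) HQ1).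
    + intros w Hw. rewrite HQ' by exact Hw. rewrite HQ1' by exact Hw. rewrite Csum_S, !Cpow_S.
      simpl (0 + S N)%nat. ring. }
apply (psum_coef_ext c); [|exact Hc]. intros n.
destruct (G n) as [Q [HQ HQ']].
set (T := fun z => (y z ^ S n * Q (Y z))%C).
assert (HT : holo T r).
{ apply holo_mult; [now apply holo_pow|].
  apply (holo_comp Q Y r r'); auto. eapply psum_holo; eassumption. }
destruct (taylor (fun z => z ^ S n * T z)%C r Hr) as [d Hd].
{ apply holo_mult; [apply holo_pow, holo_id|exact HT]. }
assert (Hc' := psum_plus _ _ _ _ _ (psum_Csum e (fun k z => Y z ^ k)%C phi r n He) Hd).
apply (psum_ext _ _ (fun z => P (Y z))) in Hc'.
2:{ intros z Hz. rewrite (HQ' (Y z)) by auto. unfold T. f_equal.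
    rewrite (HYy z Hz) at 2. rewrite Cpow_mult_l. ring. }
rewrite (psum_unique _ _ _ _ Hr Hc Hc' n).
rewrite (psum_high_order _ _ _ _ Hr HT Hd n) by lia. ring.
Qed.

Lemma psum_abs (a : nat -> C) (F : C -> C) (r : R) (z : C) : psum a F r -> Cmod z < r ->
  ex_series (fun n => Cmod (a n) * Cmod z ^ n).
Proof.
intros H Hz. assert (Hz0 := Cmod_ge_0 z). set (rho := (Cmod z + r) / 2).
destruct (psum_coef_bound a F r rho H) as [M [HM HM']]; [unfold rho; lra|].
assert (Hrho : Cmod z < rho) by (unfold rho; lra).
apply (ex_series_le (V := R_CompleteNormedModule) _ (fun n => M * (Cmod z / rho) ^ n)).
- intros n. change (Rabs (Cmod (a n) * Cmod z ^ n) <= M * (Cmod z / rho) ^ n).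
  rewrite Rabs_pos_eq by (apply Rmult_le_pos; [apply Cmod_ge_0|now apply pow_le]).
  unfold Rdiv. rewrite Rpow_mult_distr, pow_inv.
  assert (Hp : 0 < rho ^ n) by (apply pow_lt; lra).
  replace (Cmod (a n) * Cmod z ^ n) with (Cmod (a n) * rho ^ n * (Cmod z ^ n * / rho ^ n)) by (field; lra).
  apply Rmult_le_compat_r; [|apply HM'].
  apply Rmult_le_pos; [now apply pow_le|left; now apply Rinv_0_lt_compat].
- apply (ex_series_scal (V := R_NormedModule) M). apply ex_series_geom.
  rewrite Rabs_pos_eq; [apply Rlt_div_l; lra|apply Rdiv_le_0_compat; lra].
Qed.

Lemma INR_S_neq_0 (n : nat) : RtoC (INR (S n)) <> 0.
Proof. intros E. apply RtoC_inj in E. assert (H := pos_INR n). rewrite S_INR in E. lra. Qed.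

Theorem holo_primitive (f : C -> C) (r : R) : 0 < r -> holo f r ->
  exists F : C -> C, F 0 = 0 /\ forall z, Cmod z < r -> cderiv F z (f z).
Proof.
intros Hr Hf. destruct (taylor f r Hr Hf) as [a Ha].
set (b := fun n => match n with O => RtoC 0 | S k => (a k / INR (S k))%C end).
destruct (psum_intro b r) as [F HF].
{ intros z Hz. assert (H := psum_abs a f r z Ha Hz).
  destruct (Cser_dominated (fun n => b (S n) * z ^ S n)%C (fun n => Cmod z * (Cmod (a n) * Cmod z ^ n))) as [l Hl].
  - intros n. unfold b. rewrite Cmod_mult, Cmod_div by apply INR_S_neq_0.
    rewrite Cmod_pow, Cmod_R, Rabs_pos_eq by apply pos_INR. simpl pow.
    assert (H1 : 1 <= INR (S n)) by (rewrite S_INR; assert (P := pos_INR n); lra).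
    assert (H2 : Cmod (a n) / INR (S n) <= Cmod (a n)).
    { apply Rle_div_l; [lra|]. assert (P := Cmod_ge_0 (a n)). nra. }
    assert (H3 : 0 <= Cmod z * Cmod z ^ n) by (apply Rmult_le_pos; [|apply pow_le]; apply Cmod_ge_0).
    assert (H4 := Rmult_le_compat_r _ _ _ H3 H2). lra.
  - now apply (ex_series_scal (V := R_NormedModule)).
  - exists l. apply Cser_decr. replace (l - b 0%nat * z ^ 0)%C with l by (simpl; ring). exact Hl. }
exists F. split; [rewrite (psum_0 _ _ _ Hr HF); reflexivity|].
destruct (psum_derive b F r HF) as [F1 [H1 H2]]. intros z Hz.
replace (f z) with (F1 z); [now apply H2|].
apply (Cser_unique _ _ _ (H1 z Hz)). generalize (Ha z Hz). apply Cser_ext.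
intros n. unfold dcoef, b. field. apply INR_S_neq_0.
Qed.

Theorem zero_derivative_const (F : C -> C) (r : R) : (forall z, Cmod z < r -> cderiv F z 0) ->
  forall z, Cmod z < r -> F z = F 0.
Proof.
intros H z Hz. assert (Hr : 0 < r) by (assert (P := Cmod_ge_0 z); lra).
destruct (taylor F r Hr) as [a Ha]; [intros w Hw; eexists; now apply H|].
destruct (psum_derive a F r Ha) as [F1 [H1 H2]].
assert (H0 : psum (fun n => match n with O => RtoC 0 | _ => RtoC 0 end) F1 r).
{ apply (psum_ext _ (fun _ => RtoC 0)); [|apply psum_const].
  intros w Hw. exact (cderiv_unique _ _ _ _ (H w Hw) (H2 w Hw)). }
assert (E : forall n, a (S n) = 0).
{ intros n. assert (E := psum_unique _ _ _ _ Hr H1 H0 n).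
  apply (Cmult_cancel_l (INR (S n)) _ _ (INR_S_neq_0 n)). unfold dcoef in E. rewrite E.
  destruct n; ring. }
rewrite (psum_0 _ _ _ Hr Ha).
apply (Cser_unique _ _ _ (Ha z Hz)). generalize (psum_const (a 0%nat) r z Hz).
apply Cser_ext. intros [|n]; [reflexivity|]. now rewrite E.
Qed.

(** L is the primitive of q'/q vanishing at 0; then q exp(-L) has derivative 0 and the value 1 at
    0. *)
Theorem holo_log (q q1 : C -> C) (r : R) : 0 < r -> holo q1 r ->
  (forall z, Cmod z < r -> cderiv q z (q1 z)) ->
  (forall z, Cmod z < r -> q z <> 0) -> q 0 = 1 ->
  exists L : C -> C, L 0 = 0 /\ (forall z, Cmod z < r -> cderiv L z (q1 z / q z)%C) /\
   forall z, Cmod z < r -> Cexp (L z) = q z.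
Proof.
intros Hr Hq1 Hq Hq0 Hq00.
destruct (holo_primitive (fun z => q1 z / q z)%C r Hr) as [L [HL0 HL]].
{ apply holo_mult; [exact Hq1|]. apply holo_inv; [exact Hq0|]. intros z Hz. eexists. now apply Hq. }
exists L. split; [exact HL0|]. split; [exact HL|]. intros z Hz.
assert (E := zero_derivative_const (fun z => q z * Cexp (- (1) * L z))%C r).
cbv beta in E. rewrite <- (Cmult_1_r (q z)).
rewrite <- Cexp_0. replace (RtoC 0) with (- (1) * L z + L z)%C by ring.
rewrite Cexp_plus, Cmult_assoc, E; [|intros w Hw|exact Hz].
- rewrite HL0, Hq00, Cmult_0_r, Cexp_0. ring.
- apply (cderiv_ext (fun z => q z * Cexp (- (1) * L z))%C _ _
    (q1 w * Cexp (- (1) * L w) + q w * ((- (1) * (q1 w / q w)) * Cexp (- (1) * L w)))%C); [reflexivity| |].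
  + field. auto.
  + apply (cderiv_mult q (fun z => Cexp (- (1) * L z))%C); [auto|]. apply (cderiv_comp Cexp (fun z => - (1) * L z)%C); [exact (cderiv_Cexp _)|].
    apply cderiv_scal. auto.
Qed.

(** The half-angle formula sin b / (1 + cos b) = tan (b / 2), with b / 2 in the range of atan. *)
Lemma Clog_Cexp (w : C) : - PI < Im w < PI -> Clog (Cexp w) = w.
Proof.
intros Hw. unfold Clog. rewrite Cmod_Cexp, ln_exp. destruct w as [a b]; simpl in *.
f_equal.
assert (Hc : 0 < cos (b / 2)) by (apply cos_gt_0; lra).
replace (exp a * sin b / (exp a + exp a * cos b)) with (tan (b / 2)).
- rewrite atan_tan by lra. field.
- assert (He := exp_pos a).
  replace b with (2 * (b / 2)) at 2 3 by field.
  rewrite sin_2a, cos_2a_cos. unfold tan. field.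
  split; [|lra].
  replace (exp a + exp a * (2 * cos (b / 2) * cos (b / 2) - 1)) with (exp a * (2 * (cos (b / 2) * cos (b / 2)))) by ring.
  apply Rgt_not_eq. apply Rmult_lt_0_compat; [exact He|]. nra.
Qed.

(** Near 0 the imaginary part of [l] stays below pi, so the principal branch in [Cpower] is the
    branch that equals 1 at the centre. *)
Lemma Cpower_Cexp (l : C -> C) (a r : R) : 0 < r -> holo l r -> l 0 = 0 ->
  exists r', 0 < r' <= r /\ forall z, Cmod z < r' -> Cpower (Cexp (l z)) a = Cexp (a * l z).
Proof.
intros Hr Hl Hl0. destruct (holo_cont l r 0 Hl) with (e := 1) as [d [Hd Hd']]; [now rewrite Cmod_0|lra|].
exists (Rmin d r). split; [split; [now apply Rmin_glb_lt|apply Rmin_r]|]. intros z Hz.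
unfold Cpower. rewrite Clog_Cexp; [reflexivity|].
specialize (Hd' z). rewrite Hl0 in Hd'.
replace (z - 0)%C with z in Hd' by ring. replace (l z - 0)%C with (l z) in Hd' by ring.
assert (H := Hd' ltac:(eapply Rlt_le_trans; [exact Hz|apply Rmin_l])).
assert (H1 := Rabs_snd_le (l z)). assert (P2 := PI2_1).
assert (H2 := Rabs_def2 (snd (l z)) PI ltac:(lra)). unfold Im. lra.
Qed.


(** * The local expansion and disk automorphisms *)

Lemma locally_univalent_holo (f : C -> C) : locally_univalent f -> holo f 1.
Proof. intros H z Hz. exact (proj1 (H z Hz)). Qed.

Lemma cderiv_C_derive (f : C -> C) (z : C) : locally_univalent f -> Cmod z < 1 ->
  cderiv f z (C_derive f z).
Proof. intros H Hz. exact (C_derive_correct f z z (proj1 (H z Hz))). Qed.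

Lemma pow_n_Cpow (z : C) (n : nat) : pow_n (K := C_AbsRing) z n = (z ^ n)%C.
Proof. induction n as [|n IH]; [reflexivity|]. simpl. rewrite IH. reflexivity. Qed.

Lemma is_pseries_Cser (a : nat -> C) (z l : C) :
  is_pseries (K := C_AbsRing) (V := C_NormedModule) a z l <-> Cser (fun n => a n * z ^ n)%C l.
Proof.
unfold is_pseries.
assert (E : forall n, scal (pow_n (K := C_AbsRing) z n) (a n) = (a n * z ^ n)%C).
{ intros n. rewrite pow_n_Cpow. change ((z ^ n * a n)%C = (a n * z ^ n)%C). ring. }
split; apply (is_series_ext (K := C_AbsRing) (V := C_NormedModule)); intros n; [|symmetry]; apply E.
Qed.

Lemma cderiv_translate (f : C -> C) (z y l : C) : cderiv f (z + y)%C l -> cderiv (fun w => f (z + w)%C) y l.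
Proof.
intros H. apply (cderiv_ext (fun w => f (z + w)%C) _ _ ((0 + 1) * l)%C); [reflexivity|ring|].
apply (cderiv_comp f (fun w => z + w)%C); [exact H|].
apply cderiv_plus; [apply cderiv_const|apply cderiv_id].
Qed.

Lemma neq_0_near (f : C -> C) (r : R) : 0 < r -> holo f r -> f 0 <> 0 ->
  exists r', 0 < r' <= r /\ forall z, Cmod z < r' -> f z <> 0.
Proof.
intros Hr Hf H0.
destruct (holo_cont f r 0 Hf) with (e := Cmod (f 0)) as [d [Hd Hd']];
  [now rewrite Cmod_0|now apply Cmod_gt_0|].
exists (Rmin d r). split; [split; [now apply Rmin_glb_lt|apply Rmin_r]|].
intros z Hz E. specialize (Hd' z). rewrite E in Hd'.
replace (z - 0)%C with z in Hd' by ring. replace (0 - f 0)%C with (- f 0)%C in Hd' by ring.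
rewrite Cmod_opp in Hd'.
assert (H := Hd' ltac:(eapply Rlt_le_trans; [exact Hz|apply Rmin_l])). lra.
Qed.

(** [Phi] is picked by [epsilon], so its defining property has to be earned by exhibiting one
    expansion: with f(zeta + y) - f(zeta) = y B(y) and K = f'(zeta) = B(0), it is the Taylor series
    of exp(lambda l), where l is a logarithm of K / B near 0. *)
Lemma Phi_expansion (lambda : R) (f : C -> C) (zeta : C) : locally_univalent f -> Cmod zeta < 1 ->
  exists r l, 0 < r /\ holo l r /\ l 0 = 0 /\
   (forall y, Cmod y < r -> Cexp (l y) * (f (zeta + y) - f zeta) = C_derive f zeta * y)%C /\
   psum (Phi lambda f zeta) (fun y => Cexp (lambda * l y)) r.
Proof.
intros Hf Hz. set (r0 := 1 - Cmod zeta). assert (Hr0 : 0 < r0) by (unfold r0; lra).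
set (K := C_derive f zeta). assert (HK : K <> 0) by (apply Hf; exact Hz).
set (F := fun y => f (zeta + y)%C).
assert (HF : holo F r0).
{ intros y Hy. destruct (locally_univalent_holo f Hf (zeta + y)%C) as [l Hl].
  - eapply Rle_lt_trans; [apply Cmod_triangle|]. unfold r0 in Hy. lra.
  - exists l. now apply cderiv_translate. }
destruct (taylor F r0 Hr0 HF) as [b Hb].
destruct (psum_tail b F r0 Hb) as [B [HB HFB]].
assert (HBh : holo B r0) by (eapply psum_holo; eassumption).
assert (Hb0 : b 0%nat = f zeta).
{ rewrite <- (psum_0 b F r0 Hr0 Hb). unfold F. f_equal. ring. }
assert (HB0 : B 0 = K).
{ destruct (psum_derive b F r0 Hb) as [F1 [H1 H2]].
  assert (E : F1 0 = K).
  { apply (cderiv_unique F 0); [apply H2; now rewrite Cmod_0|].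
    apply cderiv_translate. replace (zeta + 0)%C with zeta by ring. now apply cderiv_C_derive. }
  rewrite <- E, (psum_0 _ _ _ Hr0 HB), (psum_0 _ _ _ Hr0 H1). unfold dcoef. simpl. ring. }
destruct (neq_0_near B r0 Hr0 HBh) as [r1 [[Hr1 Hr1'] HBn]]; [now rewrite HB0|].
set (Q := fun y => (K * / B y)%C).
assert (HQ : holo Q r1).
{ apply holo_mult; [apply holo_const|]. apply holo_inv; [exact HBn|]. now apply (holo_le _ r0). }
destruct (holo_derive Q r1 Hr1 HQ) as [Q1 [HQ1 HQ1']].
destruct (holo_log Q Q1 r1 Hr1 HQ1 HQ1') as [l [Hl0 [Hl1 Hl2]]].
{ intros y Hy. apply Cmult_neq_0; [exact HK|]. apply Cinv_neq_0 || (apply Cmod_gt_0; rewrite Cmod_inv by auto; apply Rinv_0_lt_compat, Cmod_0_lt; auto). }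
{ unfold Q. rewrite HB0. field. exact HK. }
assert (Hl : holo l r1) by (intros y Hy; eexists; now apply Hl1).
destruct (Cpower_Cexp l lambda r1 Hr1 Hl Hl0) as [r2 [[Hr2 Hr2'] Hl3]].
destruct (taylor (fun y => Cexp (lambda * l y)) r2 Hr2) as [phi Hphi].
{ apply holo_Cexp, holo_mult; [apply holo_const|]. now apply (holo_le _ r1). }
assert (HQa : forall y, Cmod y < r2 -> Cpower (aharonov_quotient f zeta (zeta + y)) lambda = Cexp (lambda * l y)).
{ intros y Hy. rewrite <- Hl3 by exact Hy. f_equal. rewrite Hl2 by lra.
  unfold aharonov_quotient, Q. destruct (Ceq_dec (zeta + y) zeta) as [E|E].
  - assert (y = 0) by (replace y with (zeta + y - zeta)%C by ring; rewrite E; ring).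
    subst y. rewrite HB0. field. exact HK.
  - assert (y <> 0) by (intros ->; apply E; ring).
    assert (Hfy : f (zeta + y)%C = (f zeta + y * B y)%C) by (rewrite <- Hb0; apply HFB; lra).
    rewrite Hfy. fold K. field. split; [apply HBn; lra|].
    replace (f zeta + y * B y - f zeta)%C with (y * B y)%C by ring.
    apply Cmult_neq_0; [assumption|]. apply HBn; lra. }
assert (Hex : is_aharonov_expansion lambda f zeta phi).
{ apply (locally_C_intro _ _ r2 Hr2). intros w Hw. apply is_pseries_Cser.
  assert (H := Hphi (w - zeta)%C Hw). cbv beta in H. rewrite <- HQa in H by exact Hw.
  replace (zeta + (w - zeta))%C with w in H by ring. exact H. }
assert (Hsp : is_aharonov_expansion lambda f zeta (Phi lambda f zeta)).
{ unfold Phi; apply epsilon_spec. now exists phi. }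
(* The expansion picked by [epsilon] comes with a neighbourhood of its own; the final radius is the
   smaller of the two. *)
apply locally_C_elim in Hsp. destruct Hsp as [d [Hd Hsp]].
assert (Hm1 := Rmin_l d r2). assert (Hm2 := Rmin_r d r2).
assert (Hm : 0 < Rmin d r2) by now apply Rmin_glb_lt.
exists (Rmin d r2), l. repeat split; auto.
- apply (holo_le _ r1); [lra|exact Hl].
- intros y Hy. rewrite Hl2 by lra.
  assert (Hfy : f (zeta + y)%C = (f zeta + y * B y)%C) by (rewrite <- Hb0; apply HFB; lra).
  rewrite Hfy. unfold Q. field. apply HBn; lra.
- intros y Hy. rewrite <- HQa by lra.
  specialize (Hsp (zeta + y)%C). replace (zeta + y - zeta)%C with y in Hsp by ring.
  apply is_pseries_Cser. apply Hsp; lra.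
Qed.

(** * Disk automorphisms *)

Definition mobius (zeta z : C) : C := ((z + zeta) / (1 + Cconj zeta * z))%C.

Lemma one_plus_conj_neq_0 (zeta z : C) : Cmod zeta < 1 -> Cmod z < 1 -> (1 + Cconj zeta * z)%C <> 0.
Proof.
intros H1 H2. replace (1 + Cconj zeta * z)%C with (1 - - (Cconj zeta * z))%C by ring.
apply one_minus_neq_0. rewrite Cmod_opp, Cmod_mult, Cmod_conj.
assert (P := Cmod_ge_0 zeta). assert (Q := Cmod_ge_0 z). nra.
Qed.

Lemma Cmod_mobius (zeta z : C) : Cmod zeta < 1 -> Cmod z < 1 -> Cmod (mobius zeta z) < 1.
Proof.
intros H1 H2. assert (Hn := one_plus_conj_neq_0 zeta z H1 H2).
unfold mobius. rewrite Cmod_div by exact Hn. apply Rlt_div_l; [now apply Cmod_gt_0|].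
rewrite Rmult_1_l. apply Rsqr_incrst_0; try apply Cmod_ge_0. rewrite !Rsqr_pow2.
assert (E : Cmod (1 + Cconj zeta * z) ^ 2 - Cmod (z + zeta) ^ 2 = (1 - Cmod zeta ^ 2) * (1 - Cmod z ^ 2)).
{ rewrite !Cmod2_alt. destruct zeta, z; simpl. ring. }
assert (P := Cmod_ge_0 zeta). assert (Q := Cmod_ge_0 z).
assert (0 < (1 - Cmod zeta ^ 2) * (1 - Cmod z ^ 2)); [apply Rmult_lt_0_compat; simpl; nra|lra].
Qed.

Lemma mobius_0 (zeta : C) : mobius zeta 0 = zeta.
Proof.
unfold mobius. replace (1 + Cconj zeta * 0)%C with (RtoC 1) by ring.
replace (0 + zeta)%C with zeta by ring. unfold Cdiv. replace (/ 1)%C with (RtoC 1); [ring|].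
rewrite <- RtoC_inv by lra. now rewrite Rinv_1.
Qed.

Lemma RtoC_1_minus_Cmod2 (zeta : C) : RtoC (1 - Cmod zeta ^ 2) = (1 - Cconj zeta * zeta)%C.
Proof. rewrite RtoC_minus, Cmod2_conj. ring. Qed.

Lemma mobius_sub (zeta z : C) : Cmod zeta < 1 -> Cmod z < 1 ->
  (mobius zeta z - zeta = z * (RtoC (1 - Cmod zeta ^ 2) / (1 + Cconj zeta * z)))%C.
Proof.
intros H1 H2. rewrite RtoC_1_minus_Cmod2. unfold mobius. field. now apply one_plus_conj_neq_0.
Qed.

Lemma mobius_inj (zeta z w : C) : Cmod zeta < 1 -> Cmod z < 1 -> Cmod w < 1 ->
  mobius zeta z = mobius zeta w -> z = w.
Proof.
intros H1 H2 H3 E. assert (N1 := one_plus_conj_neq_0 zeta z H1 H2).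
assert (N2 := one_plus_conj_neq_0 zeta w H1 H3).
assert (E3 : (mobius zeta z * (1 + Cconj zeta * z) = z + zeta)%C) by (unfold mobius; field; exact N1).
assert (E4 : (mobius zeta z * (1 + Cconj zeta * w) = w + zeta)%C) by (rewrite E; unfold mobius; field; exact N2).
assert (E5 : ((z - w) * (1 - mobius zeta z * Cconj zeta) = 0)%C).
{ replace ((z - w) * (1 - mobius zeta z * Cconj zeta))%C with
   ((z + zeta - mobius zeta z * (1 + Cconj zeta * z)) - (w + zeta - mobius zeta z * (1 + Cconj zeta * w)))%C by ring.
  rewrite E3, E4. ring. }
assert (N3 : (1 - mobius zeta z * Cconj zeta)%C <> 0).
{ apply one_minus_neq_0. rewrite Cmod_mult, Cmod_conj.
  assert (P := Cmod_mobius zeta z H1 H2). assert (Q := Cmod_ge_0 zeta).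
  assert (Q2 := Cmod_ge_0 (mobius zeta z)). nra. }
assert (E7 : (z - w = 0)%C).
{ apply (Cmult_cancel_l _ _ _ N3). rewrite Cmult_comm, E5. ring. }
replace z with (z - w + w)%C by ring. rewrite E7. ring.
Qed.

Lemma mobius_surj (zeta w : C) : Cmod zeta < 1 -> Cmod w < 1 ->
  exists z, Cmod z < 1 /\ mobius zeta z = w.
Proof.
intros H1 H2. exists (mobius (- zeta) w).
assert (H1' : Cmod (- zeta) < 1) by now rewrite Cmod_opp.
split; [now apply Cmod_mobius|].
assert (Hc : Cconj (- zeta) = (- Cconj zeta)%C) by (unfold Cconj, Copp; simpl; reflexivity).
assert (N1 := one_plus_conj_neq_0 (- zeta) w H1' H2).
assert (N2 := one_plus_conj_neq_0 zeta (mobius (- zeta) w) H1 (Cmod_mobius _ _ H1' H2)).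
unfold mobius in *. rewrite Hc in *.
assert (N3 : (1 - Cconj zeta * zeta)%C <> 0).
{ rewrite <- RtoC_1_minus_Cmod2. intros E. apply RtoC_inj in E. assert (P := Cmod_ge_0 zeta). nra. }
field. split; [exact N1|].
intros E. apply N3. rewrite <- E. ring.
Qed.

Lemma holo_mobius (zeta : C) : Cmod zeta < 1 -> holo (mobius zeta) 1.
Proof.
intros Hz. apply holo_mult.
- apply holo_plus; [apply holo_id|apply holo_const].
- apply holo_inv; [intros z H; now apply one_plus_conj_neq_0|].
  apply holo_plus; [apply holo_const|]. apply holo_mult; [apply holo_const|apply holo_id].
Qed.


(** * The A n as Taylor coefficients *)

Lemma falling_left (a : R) (m : nat) : falling (a + 1) (S m) = (a + 1) * falling a m.
Proof.
induction m as [|m IH]; [simpl; ring|].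
change (falling (a + 1) (S m) * (a + 1 - INR (S m)) = (a + 1) * (falling a m * (a - INR m))).
rewrite IH, S_INR. ring.
Qed.

Lemma gbinom_0 (a : R) : gbinom a 0 = 1.
Proof. unfold gbinom. simpl. field. Qed.

Lemma gbinom_S (a : R) (m : nat) : gbinom a (S m) * INR (S m) = gbinom a m * (a - INR m).
Proof.
unfold gbinom. rewrite fact_simpl, mult_INR. simpl falling. field.
split; [apply INR_fact_neq_0|apply not_0_INR; lia].
Qed.

Lemma gbinom_pascal (a : R) (m : nat) : gbinom (a + 1) (S m) = gbinom a (S m) + gbinom a m.
Proof.
unfold gbinom. rewrite falling_left, fact_simpl, mult_INR, S_INR. simpl falling. field.
split; [apply INR_fact_neq_0|assert (P := pos_INR m); lra].
Qed.

Lemma gbinom_pred_self (j : nat) : gbinom (INR (S j) - 1) (S j) = 0.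
Proof.
unfold gbinom. rewrite S_INR. replace (INR j + 1 - 1) with (INR j) by ring.
simpl falling. rewrite Rminus_diag. unfold Rdiv. ring.
Qed.

(** Coefficient of z^j in (c z / (1 + conj zeta z))^k with c = 1 - |zeta|^2. The test guards the
    truncated subtraction [j - k]. For k = 0 the binomial is 1 at j = 0, as binom(-1, 0) = 1, and 0
    at every later j. *)
Definition mobius_pow_coef (zeta : C) (k j : nat) : C :=
  if Nat.leb k j
  then (RtoC (1 - Cmod zeta ^ 2) ^ k * (RtoC (gbinom (INR j - 1) (j - k)) * (- Cconj zeta) ^ (j - k)))%C
  else 0.

(** With X = mobius zeta z - zeta one has (1 + conj zeta z) X^(k+1) = c z X^k. Comparing
    coefficients gives a recursion in j, which is Pascal's rule. *)
Lemma psum_mobius_pow (zeta : C) (k : nat) : Cmod zeta < 1 ->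
  psum (mobius_pow_coef zeta k) (fun z => (mobius zeta z - zeta) ^ k)%C 1.
Proof.
intros Hz. induction k as [|k IH].
- apply (psum_ext _ (fun _ => RtoC 1)); [reflexivity|].
  apply (psum_coef_ext _ _ _ _) with (2 := psum_const 1 1).
  intros [|j]; unfold mobius_pow_coef; simpl Nat.leb; simpl Nat.sub.
  + rewrite gbinom_0. simpl. ring.
  + rewrite gbinom_pred_self. ring.
- set (c := RtoC (1 - Cmod zeta ^ 2)).
  destruct (taylor (fun z => (mobius zeta z - zeta) ^ S k)%C 1 Rlt_0_1) as [d Hd].
  { apply holo_pow. apply holo_minus; [now apply holo_mobius|apply holo_const]. }
  assert (H1 := psum_plus _ _ _ _ _ Hd (psum_scal (Cconj zeta) _ _ _ (psum_shift _ _ _ Hd))).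
  assert (H2 := psum_scal c _ _ _ (psum_shift _ _ _ IH)).
  apply (psum_ext _ _ (fun z => c * (z * (mobius zeta z - zeta) ^ k))%C) in H1.
  2:{ intros z Hz1. rewrite Cpow_S. rewrite (mobius_sub zeta z Hz Hz1) at 1 3. fold c.
      field. now apply one_plus_conj_neq_0. }
  assert (E := psum_unique _ _ _ _ Rlt_0_1 H1 H2).
  apply (psum_coef_ext d); [|exact Hd].
  induction n as [|n IHn].
  + specialize (E 0%nat). simpl in E. unfold mobius_pow_coef; simpl Nat.leb. cbv iota.
    replace (d 0%nat) with (d 0%nat + Cconj zeta * 0)%C by ring. rewrite E. ring.
  + specialize (E (S n)). simpl in E. rewrite IHn in E.
    replace (d (S n)) with (c * mobius_pow_coef zeta k n - Cconj zeta * mobius_pow_coef zeta (S k) n)%C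
      by (rewrite <- E; ring).
    unfold mobius_pow_coef. fold c.
    change (Nat.leb (S k) (S n)) with (Nat.leb k n). change (S n - S k)%nat with (n - k)%nat.
    destruct (Nat.leb_spec k n) as [Hkn|Hkn].
    * destruct (Nat.leb_spec (S k) n) as [Hkn'|Hkn'].
      -- replace (n - k)%nat with (S (n - S k)) by lia.
         replace (INR (S n) - 1) with (INR n - 1 + 1) by (rewrite S_INR; ring).
         rewrite gbinom_pascal, RtoC_plus, !Cpow_S. ring.
      -- replace (n - k)%nat with 0%nat by lia. rewrite !gbinom_0, !Cpow_S. ring.
    * destruct (Nat.leb_spec (S k) n) as [Hkn'|Hkn']; [lia|]. ring.
Qed.

(** B = (1 + b z)^lambda satisfies (1 + b z) B' = lambda b B, so its coefficients obey (n + 1)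
    a_(n+1) = b (lambda - n) a_n, the recursion of the binomial coefficients. *)
Lemma binomial_series (lambda : R) (b : C) : Cmod b < 1 ->
  exists L : C -> C, L 0 = 0 /\ holo L 1 /\
   (forall z, Cmod z < 1 -> Cexp (L z) = 1 + b * z)%C /\
   psum (fun n => RtoC (gbinom lambda n) * b ^ n)%C (fun z => Cexp (lambda * L z)) 1.
Proof.
intros Hb.
assert (Hn : forall z, Cmod z < 1 -> (1 + b * z)%C <> 0).
{ intros z Hz. replace (1 + b * z)%C with (1 - - (b * z))%C by ring.
  apply one_minus_neq_0. rewrite Cmod_opp, Cmod_mult.
  assert (P := Cmod_ge_0 b). assert (Q := Cmod_ge_0 z). nra. }
destruct (holo_log (fun z => 1 + b * z)%C (fun _ => b) 1 Rlt_0_1 (holo_const b 1)) as [L [HL0 [HL HLe]]].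
- intros z _. apply (cderiv_ext (fun z => 1 + b * z)%C _ _ (0 + b * 1)%C); [reflexivity|ring|].
  apply cderiv_plus; [apply cderiv_const|]. apply cderiv_scal, cderiv_id.
- exact Hn.
- ring.
- assert (HLh : holo L 1) by (intros z Hz; eexists; now apply HL).
  exists L. repeat split; auto.
  assert (HB : forall z, Cmod z < 1 -> cderiv (fun z => Cexp (lambda * L z)) z
     (lambda * (b / (1 + b * z)) * Cexp (lambda * L z))%C).
  { intros z Hz. apply (cderiv_comp Cexp (fun z => lambda * L z)%C); [exact (cderiv_Cexp _)|].
    apply cderiv_scal. now apply HL. }
  destruct (taylor (fun z => Cexp (lambda * L z)) 1 Rlt_0_1) as [a Ha];
   [intros z Hz; eexists; now apply HB|].
  destruct (psum_derive a _ 1 Ha) as [B1 [HB1 HB1']].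
  assert (H1 := psum_plus _ _ _ _ _ HB1 (psum_scal b _ _ _ (psum_shift _ _ _ HB1))).
  assert (H2 := psum_scal (lambda * b) _ _ _ Ha).
  apply (psum_ext _ _ (fun z => lambda * b * Cexp (lambda * L z))%C) in H1.
  2:{ intros z Hz. rewrite (cderiv_unique _ _ _ _ (HB1' z Hz) (HB z Hz)). field. auto. }
  assert (E := psum_unique _ _ _ _ Rlt_0_1 H1 H2).
  apply (psum_coef_ext a); [|exact Ha].
  induction n as [|n IH].
  + rewrite <- (psum_0 _ _ _ Rlt_0_1 Ha), HL0, Cmult_0_r, Cexp_0, gbinom_0. simpl. ring.
  + apply (Cmult_cancel_l (INR (S n)) _ _ (INR_S_neq_0 n)).
    assert (E1 : (INR (S n) * a (S n) = b * (lambda - INR n) * a n)%C).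
    { specialize (E n). unfold dcoef in E. 
      replace (INR (S n) * a (S n))%C with (INR (S n) * a (S n) +
         b * shift_coef (fun n => INR (S n) * a (S n)) n - b * shift_coef (fun n => INR (S n) * a (S n)) n)%C by ring.
      unfold dcoef. rewrite E. destruct n as [|n]; cbn [shift_coef]; [change (INR 0) with 0; ring|ring]. }
    rewrite E1, IH.
    replace (INR (S n) * (gbinom lambda (S n) * b ^ S n))%C
      with (RtoC (gbinom lambda (S n) * INR (S n)) * b ^ S n)%C by (rewrite RtoC_mult; ring).
    rewrite gbinom_S, RtoC_mult, RtoC_minus, Cpow_S. ring.
Qed.

(** With w = mobius zeta z, w - zeta = c z / (1 + conj zeta z) and c = 1 - |zeta|^2, the quotient
    f'(zeta) c z / (f(w) - f(zeta)) is the quotient defining [Phi] times 1 + conj zeta z. Its power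
    lambda is therefore the [Phi] series composed with w - zeta, times a binomial series; the inner
    sum of [A] is the composition and the outer one the Cauchy product. The signs (-1)^(n-j) turn
    the powers of - conj zeta back into powers of conj zeta. *)
Theorem A_expansion (lambda : R) (f : C -> C) (zeta : C) : locally_univalent f -> Cmod zeta < 1 ->
  exists (r : R) (l : C -> C) (K : C), 0 < r <= 1 /\ holo l r /\ l 0 = 0 /\ K <> 0 /\
   (forall z, Cmod z < r -> Cexp (l z) * (f (mobius zeta z) - f zeta) = K * z)%C /\
   psum (A lambda f zeta) (fun z => Cexp (lambda * l z)) r.
Proof.
intros Hf Hz.
destruct (Phi_expansion lambda f zeta Hf Hz) as [r0 [l [Hr0 [Hl [Hl0 [Hle HPhi]]]]]].
destruct (binomial_series lambda (Cconj zeta)) as [L [HL0 [HL [HLe HB]]]]; [now rewrite Cmod_conj|].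
set (c := RtoC (1 - Cmod zeta ^ 2)).
assert (Hc : c <> 0).
{ intros E. apply RtoC_inj in E. assert (P := Cmod_ge_0 zeta). nra. }
set (Y := fun z => (mobius zeta z - zeta)%C).
set (y := fun z => (c * / (1 + Cconj zeta * z))%C).
assert (Hy : holo y 1).
{ apply holo_mult; [apply holo_const|]. apply holo_inv; [intros w H; now apply one_plus_conj_neq_0|].
  apply holo_plus; [apply holo_const|]. apply holo_mult; [apply holo_const|apply holo_id]. }
assert (HY : holo Y 1) by (apply holo_minus; [now apply holo_mobius|apply holo_const]).
assert (HYy : forall z, Cmod z < 1 -> Y z = (z * y z)%C).
{ intros z H. unfold Y, y. now rewrite mobius_sub. }
destruct (holo_cont Y 1 0 HY) with (e := r0) as [d [Hd Hd']]; [rewrite Cmod_0; lra|exact Hr0|].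
set (r := Rmin d 1).
assert (Hr : 0 < r) by (apply Rmin_glb_lt; lra).
assert (Hrd : r <= d) by apply Rmin_l. assert (Hr1 : r <= 1) by apply Rmin_r.
assert (HYr : forall z, Cmod z < r -> Cmod (Y z) < r0).
{ intros z H. specialize (Hd' z). replace (z - 0)%C with z in Hd' by ring.
  replace (Y z - Y 0)%C with (Y z) in Hd'; [apply Hd'; lra|].
  unfold Y at 3. rewrite mobius_0. ring. }
exists r, (fun z => l (Y z) + L z)%C, (C_derive f zeta * c)%C.
repeat split; auto.
- apply holo_plus; [|now apply (holo_le _ 1)].
  apply (holo_comp l Y r r0); auto. now apply (holo_le _ 1).
- unfold Y. rewrite mobius_0. replace (zeta - zeta)%C with (RtoC 0) by ring. rewrite Hl0, HL0. ring.
- apply Cmult_neq_0; [|exact Hc]. now apply Hf.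
- intros z H. rewrite Cexp_plus, HLe by lra.
  assert (E := Hle (Y z) (HYr z H)). unfold Y in E at 2. replace (zeta + (mobius zeta z - zeta))%C with (mobius zeta z) in E by ring.
  replace (Cexp (l (Y z)) * (1 + Cconj zeta * z) * (f (mobius zeta z) - f zeta))%C
    with ((1 + Cconj zeta * z) * (Cexp (l (Y z)) * (f (mobius zeta z) - f zeta)))%C by ring.
  rewrite E, HYy by lra. unfold y. field. apply one_plus_conj_neq_0; lra.
- assert (HPY := psum_comp _ _ Y y r r0 (mobius_pow_coef zeta) Hr Hr0 HPhi (holo_le _ _ _ Hr1 Hy)
    (fun z H => HYy z (Rlt_le_trans _ _ _ H Hr1)) HYr (fun k => psum_le _ _ _ _ Hr1 (psum_mobius_pow zeta k Hz))).
  assert (HAB := psum_mult _ _ _ _ _ Hr HPY (psum_le _ _ _ _ Hr1 HB)).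
  apply (psum_ext _ _ (fun z => Cexp (lambda * (l (Y z) + L z)))) in HAB.
  2:{ intros z _. rewrite <- Cexp_plus. f_equal. ring. }
  revert HAB. apply psum_coef_ext. intros n. unfold conv, A.
  apply Csum_ext. intros j Hj. rewrite Cmult_comm, <- Csum_scal.
  symmetry. etransitivity; [symmetry; apply (Csum_scal _ (fun k : nat => RtoC (gbinom (INR j - 1) (j - k)) * Cpow (- Cconj zeta) (n - k) *
      RtoC ((1 - Cmod zeta ^ 2) ^ k) * Phi lambda f zeta k)%C)|].
  apply Csum_ext. intros k Hk. unfold mobius_pow_coef.
  replace (Nat.leb k j) with true by (symmetry; now apply Nat.leb_le).
  replace (n - k)%nat with ((n - j) + (j - k))%nat by lia.
  rewrite Cpow_add_r, RtoC_mult, !RtoC_pow.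
  replace (Cconj zeta ^ (n - j))%C with (((-1) ^ (n - j))%C * (- Cconj zeta) ^ (n - j))%C.
  + ring.
  + rewrite <- Cpow_mult_l. f_equal. ring.
Qed.


(** * Sufficiency *)

Lemma identity_theorem (F : C -> C) (r R0 : R) : 0 < r <= R0 -> holo F R0 ->
  (forall z, Cmod z < r -> F z = 0) -> forall z, Cmod z < R0 -> F z = 0.
Proof.
intros Hr HF H z Hz. destruct (taylor F R0 ltac:(lra) HF) as [a Ha].
assert (H0 : psum (fun n => match n with O => RtoC 0 | _ => RtoC 0 end) F r).
{ apply (psum_ext _ (fun _ => RtoC 0)); [|apply psum_const]. intros w Hw. now rewrite H. }
assert (E := psum_unique _ _ _ _ (proj1 Hr) (psum_le _ _ _ _ (proj2 Hr) Ha) H0).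
apply (Cser_unique _ _ _ (Ha z Hz)). generalize (psum_const 0 R0 z Hz).
apply Cser_ext. intros [|n]; now rewrite E.
Qed.

Lemma is_derive_eps (f : R -> R) (t l : R) :
  (forall e, 0 < e -> exists d, 0 < d /\ forall s, Rabs (s - t) < d ->
    Rabs (f s - f t - l * (s - t)) <= e * Rabs (s - t)) -> is_derive f t l.
Proof.
intros H. apply is_derive_Reals. intros e He.
destruct (H (e / 2) ltac:(lra)) as [d [Hd Hd']]. exists (mkposreal d Hd).
intros h Hh Hhd. specialize (Hd' (t + h)). replace (t + h - t) with h in Hd' by ring.
replace ((f (t + h) - f t) / h - l) with ((f (t + h) - f t - l * h) / h) by (field; auto).
unfold Rdiv. rewrite Rabs_mult, Rabs_inv.
assert (Hp : 0 < Rabs h) by now apply Rabs_pos_lt.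
apply (Rmult_lt_reg_r (Rabs h)); [exact Hp|].
rewrite Rmult_assoc, Rinv_l, Rmult_1_r by lra.
specialize (Hd' Hhd). nra.
Qed.

Definition rderiv (h : R -> C) (t : R) (l : C) : Prop :=
  forall e, 0 < e -> exists d, 0 < d /\ forall s, Rabs (s - t) < d ->
    Cmod (h s - h t - RtoC (s - t) * l) <= e * Rabs (s - t).

Lemma rderiv_fst (h : R -> C) (t : R) (l : C) : rderiv h t l -> is_derive (fun s => fst (h s)) t (fst l).
Proof.
intros H. apply is_derive_eps. intros e He. destruct (H e He) as [d [Hd Hd']].
exists d; split; [exact Hd|]. intros s Hs. eapply Rle_trans; [|apply Hd', Hs].
eapply Rle_trans; [|apply Rabs_fst_le]. apply Req_le. f_equal.
unfold Cminus, Cplus, Copp, Cmult; simpl. ring.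
Qed.

Lemma rderiv_snd (h : R -> C) (t : R) (l : C) : rderiv h t l -> is_derive (fun s => snd (h s)) t (snd l).
Proof.
intros H. apply is_derive_eps. intros e He. destruct (H e He) as [d [Hd Hd']].
exists d; split; [exact Hd|]. intros s Hs. eapply Rle_trans; [|apply Hd', Hs].
eapply Rle_trans; [|apply Rabs_snd_le]. apply Req_le. f_equal.
unfold Cminus, Cplus, Copp, Cmult; simpl. ring.
Qed.

Lemma rderiv_linear (z : C) (t : R) : rderiv (fun s => s * z)%C t z.
Proof.
intros e He. exists 1. split; [lra|]. intros s _.
replace (s * z - t * z - RtoC (s - t) * z)%C with (RtoC 0) by (rewrite RtoC_minus; ring).
rewrite Cmod_0. apply Rmult_le_pos; [lra|apply Rabs_pos].
Qed.

Lemma rderiv_comp (F : C -> C) (h : R -> C) (t : R) (k l : C) : cderiv F (h t) l -> rderiv h t k ->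
  rderiv (fun s => F (h s)) t (k * l)%C.
Proof.
intros HF Hh e He. rewrite cderiv_eps in HF.
assert (Hk := Cmod_ge_0 k). assert (Hl := Cmod_ge_0 l).
set (e1 := e / (2 * (Cmod k + 1))). set (e2 := Rmin 1 (e / (2 * (Cmod l + 1)))).
assert (He1 : 0 < e1) by (apply Rdiv_lt_0_compat; lra).
assert (He2 : 0 < e2) by (apply Rmin_glb_lt; [lra|apply Rdiv_lt_0_compat; lra]).
assert (He21 : e2 <= 1) by apply Rmin_l.
assert (He22 : e2 <= e / (2 * (Cmod l + 1))) by apply Rmin_r.
destruct (HF e1 He1) as [d1 [Hd1 H1]]. destruct (Hh e2 He2) as [d2 [Hd2 H2]].
assert (Hd1k : 0 < d1 / (Cmod k + 1)) by (apply Rdiv_lt_0_compat; lra).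
exists (Rmin d2 (d1 / (Cmod k + 1))). split; [now apply Rmin_glb_lt|]. intros s Hs.
assert (Hs1 : Rabs (s - t) < d2) by (eapply Rlt_le_trans; [exact Hs|apply Rmin_l]).
assert (Hs2 : Rabs (s - t) < d1 / (Cmod k + 1)) by (eapply Rlt_le_trans; [exact Hs|apply Rmin_r]).
apply Rlt_div_r in Hs2; [|lra].
specialize (H2 s Hs1). assert (Hp := Rabs_pos (s - t)).
assert (T := Cmod_triangle (h s - h t - RtoC (s - t) * k) (RtoC (s - t) * k)).
replace (h s - h t - RtoC (s - t) * k + RtoC (s - t) * k)%C with (h s - h t)%C in T by ring.
rewrite Cmod_mult, Cmod_R in T.
assert (Hh1 : Cmod (h s - h t) <= (Cmod k + 1) * Rabs (s - t)) by nra.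
specialize (H1 (h s) ltac:(nra)).
replace (F (h s) - F (h t) - RtoC (s - t) * (k * l))%C with
 ((F (h s) - F (h t) - l * (h s - h t)) + l * (h s - h t - RtoC (s - t) * k))%C by ring.
eapply Rle_trans; [apply Cmod_triangle|]. rewrite Cmod_mult.
assert (A1 : e1 * Cmod (h s - h t) <= e / 2 * Rabs (s - t)).
{ replace (e / 2 * Rabs (s - t)) with (e1 * ((Cmod k + 1) * Rabs (s - t))) by (unfold e1; field; lra).
  apply Rmult_le_compat_l; lra. }
assert (A2 : Cmod l * Cmod (h s - h t - RtoC (s - t) * k) <= e / 2 * Rabs (s - t)).
{ apply Rle_trans with ((Cmod l + 1) * (e / (2 * (Cmod l + 1)) * Rabs (s - t))).
  - apply Rmult_le_compat; try lra; [apply Cmod_ge_0|].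
    eapply Rle_trans; [exact H2|]. apply Rmult_le_compat_r; lra.
  - apply Req_le. field. lra. }
lra.
Qed.

Definition sqmod (w : C) : R := fst w * fst w + snd w * snd w.

Lemma sqmod_Cmod (w : C) : sqmod w = Cmod w ^ 2.
Proof. rewrite Cmod2_alt. unfold sqmod, Re, Im. ring. Qed.

Lemma is_derive_sqmod_ray (F : C -> C) (z l : C) (t : R) : cderiv F (t * z)%C l ->
  is_derive (fun s : R => sqmod (F (s * z)%C)) t (2 * fst (Cconj (F (t * z)%C) * (z * l))%C).
Proof.
intros H. assert (Hr := rderiv_comp F _ t _ l H (rderiv_linear z t)).
assert (H1 := rderiv_fst _ _ _ Hr). assert (H2 := rderiv_snd _ _ _ Hr).
unfold sqmod.
assert (H3 := is_derive_plus _ _ _ _ _ (is_derive_mult _ _ _ _ _ H1 H1 Rmult_comm)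
  (is_derive_mult _ _ _ _ _ H2 H2 Rmult_comm)).
revert H3. unfold plus, mult; simpl.
match goal with |- is_derive ?f _ ?a -> is_derive _ _ ?b => replace b with a; [exact (fun H => H)|] end.
unfold Cmult, Cconj; simpl. ring.
Qed.

Lemma derive_zero_eq (U : R -> R) (a b x y : R) : a < x < b -> a < y < b ->
  (forall t, a < t < b -> is_derive U t 0) -> U x = U y.
Proof.
intros Hx Hy H.
assert (G : forall x y, a < x < b -> a < y < b -> x < y -> U x = U y).
{ intros u v Hu Hv Huv.
  destruct (MVT_cor2 U (fun _ => 0) u v Huv) as [c [Hc _]].
  - intros c Hc. apply is_derive_Reals. apply H. lra.
  - lra. }
destruct (Rtotal_order x y) as [Hlt|[->|Hgt]]; [now apply G|reflexivity|symmetry; now apply G].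
Qed.

(** [t1] is the supremum of the s <= 1 below which F(t z) has no zero. If F were nonzero at t1 < 1,
    continuity would push the supremum further; if t1 = 1, the zero at z itself is the one
    sought. *)
Lemma first_zero (F : C -> C) (z : C) (s0 : R) : holo F 1 -> Cmod z < 1 -> 0 < s0 <= 1 ->
  (forall t, 0 < t < s0 -> F (t * z)%C <> 0) -> F z = 0 ->
  exists t1, s0 <= t1 <= 1 /\ F (t1 * z)%C = 0 /\ forall t, 0 < t < t1 -> F (t * z)%C <> 0.
Proof.
intros HF Hz Hs0 Hn Hz0.
destruct (completeness (fun s => s <= 1 /\ forall t, 0 < t < s -> F (t * z)%C <> 0)) as [t1 [Ht1 Ht2]].
- exists 1. intros s [Hs _]. exact Hs.
- exists s0. split; [lra|exact Hn].
- assert (A1 : s0 <= t1) by (apply Ht1; split; [lra|exact Hn]).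
  assert (A2 : t1 <= 1) by (apply Ht2; intros s [Hs _]; exact Hs).
  assert (A3 : forall t, 0 < t < t1 -> F (t * z)%C <> 0).
  { intros t Ht E. assert (B : t1 <= t).
    { apply Ht2. intros s [Hs Hs']. apply Rnot_lt_le. intros Hst. apply (Hs' t); [lra|exact E]. }
    lra. }
  exists t1. split; [lra|]. split; [|exact A3].
  destruct (Ceq_dec (F (t1 * z)%C) 0) as [E|E]; [exact E|exfalso].
  assert (Hne : t1 <> 1) by (intros ->; apply E; now rewrite Cmult_1_l).
  assert (Hzt : Cmod (t1 * z) < 1).
  { rewrite Cmod_mult, Cmod_R, Rabs_pos_eq by lra. assert (P := Cmod_ge_0 z). nra. }
  destruct (holo_cont F 1 _ HF Hzt) with (e := Cmod (F (t1 * z)%C)) as [d [Hd Hd']]; [now apply Cmod_gt_0|].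
  set (s := Rmin 1 (t1 + d / 2)).
  assert (Hs : t1 < s) by (apply Rmin_glb_lt; lra).
  assert (Hs1 : s <= 1) by apply Rmin_l. assert (Hs2 : s <= t1 + d / 2) by apply Rmin_r.
  assert (B : s <= t1); [|lra].
  apply Ht1. split; [exact Hs1|]. intros t Ht E0.
  destruct (Rlt_dec t t1) as [Hlt|Hge]; [apply (A3 t); [lra|exact E0]|].
  specialize (Hd' (t * z)%C). rewrite E0 in Hd'.
  replace (0 - F (t1 * z))%C with (- F (t1 * z))%C in Hd' by ring. rewrite Cmod_opp in Hd'.
  assert (B : Cmod (t * z - t1 * z) < d); [|specialize (Hd' B); lra].
  replace (t * z - t1 * z)%C with (RtoC (t - t1) * z)%C by (rewrite RtoC_minus; ring).
  rewrite Cmod_mult, Cmod_R, Rabs_pos_eq by lra. assert (P := Cmod_ge_0 z). nra.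
Qed.

Lemma holo_ray_bounded (F : C -> C) (z : C) : holo F 1 -> Cmod z < 1 ->
  exists M, 0 < M /\ forall t, 0 <= t <= 1 -> Cmod (F (t * z)%C) <= M.
Proof.
intros HF Hz. destruct (rcont_bounded (fun t => F (t * z)%C) 0 1) as [M [HM HM']]; [lra| |].
- intros t Ht. apply (rcont_comp F (fun t => t * z)%C).
  + apply (holo_cont F 1); [exact HF|]. rewrite Cmod_mult, Cmod_R, Rabs_pos_eq by lra.
    assert (P := Cmod_ge_0 z). nra.
  + apply rcont_mult; [|apply rcont_const]. apply rcont_RtoC. apply continuity_pt_id.
- exists (M + 1). split; [lra|]. intros t Ht. specialize (HM' t Ht). lra.
Qed.

Lemma is_derive_log_sqmod_ray (G : C -> C) (z l : C) (t : R) : cderiv G (t * z)%C l ->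
  G (t * z)%C <> 0 ->
  is_derive (fun s : R => ln (sqmod (G (s * z)%C))) t (2 * fst ((z * l) / G (t * z))%C).
Proof.
intros H H0. assert (Hp : 0 < sqmod (G (t * z)%C)).
{ rewrite sqmod_Cmod. apply pow_lt. now apply Cmod_gt_0. }
assert (H1 := is_derive_comp ln _ t _ _ (is_derive_ln _ Hp) (is_derive_sqmod_ray G z l t H)).
revert H1. unfold scal; simpl; unfold mult; simpl.
match goal with |- is_derive ?f _ ?a -> is_derive _ _ ?b => replace b with a; [exact (fun H => H)|] end.
unfold sqmod in *. destruct (G (t * z)%C) as [a b]. unfold Cdiv, Cinv, Cmult; simpl in *.
field. simpl. nra.
Qed.

(* [|H|^2 |G/z|^(2 lambda)] is constant along a ray, so [G] cannot reach [0] while [H]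
   stays bounded. *)
Lemma no_zero_on_ray (lambda : R) (G G1 H H1 : C -> C) (K : C) (r : R) (z : C) :
  0 < lambda -> 0 < r <= 1 -> K <> 0 -> holo G 1 -> holo H 1 ->
  (forall w, Cmod w < 1 -> cderiv G w (G1 w)) -> (forall w, Cmod w < 1 -> cderiv H w (H1 w)) ->
  (forall w, Cmod w < r -> exists l, H w = Cexp (lambda * l) /\ Cexp l * G w = K * w)%C ->
  (forall w, Cmod w < 1 -> w * G w * H1 w = lambda * H w * (G w - w * G1 w))%C ->
  Cmod z < 1 -> z <> 0 -> G z <> 0.
Proof.
intros Hlam Hr HK HG HH HG1 HH1 Hnear Hode Hz Hz0 HGz.
assert (Hzp := Cmod_0_lt z Hz0).
assert (Hsmall : forall t, 0 < t < r -> Cmod (t * z) < r).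
{ intros t Ht. rewrite Cmod_mult, Cmod_R, Rabs_pos_eq by lra. nra. }
destruct (first_zero G z r HG Hz Hr) as [t1 [Ht1 [HGt1 Hne]]]; [|exact HGz|].
{ intros t Ht E. destruct (Hnear _ (Hsmall t Ht)) as [l [_ Hl]]. rewrite E, Cmult_0_r in Hl.
  assert (E2 : (K * (t * z))%C <> 0); [|now apply E2].
  repeat apply Cmult_neq_0; auto. intros E3. apply RtoC_inj in E3. lra. }
assert (Hunit : forall t, 0 <= t <= 1 -> Cmod (t * z) < 1).
{ intros t Ht. rewrite Cmod_mult, Cmod_R, Rabs_pos_eq by lra. nra. }
(* The exponential is the real power (|G| / t)^(2 lambda). Dividing by t instead of |t z| changes
   [U] by a constant factor only. *)
set (U := fun t : R => sqmod (H (t * z)%C) * exp (lambda * (ln (sqmod (G (t * z)%C)) - 2 * ln t))).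
assert (HU : forall t, 0 < t < t1 -> is_derive U t 0).
{ intros t Ht. assert (Htz := Hunit t ltac:(lra)).
  assert (D1 := is_derive_sqmod_ray H z _ t (HH1 _ Htz)).
  assert (D2 := is_derive_log_sqmod_ray G z _ t (HG1 _ Htz) (Hne t Ht)).
  assert (D3 : is_derive (fun s : R => exp (lambda * (ln (sqmod (G (s * z)%C)) - 2 * ln s))) t
    (lambda * (2 * fst (z * G1 (t * z) / G (t * z))%C - 2 * / t) * exp (lambda * (ln (sqmod (G (t * z)%C)) - 2 * ln t)))).
  { apply (is_derive_comp exp (fun s : R => lambda * (ln (sqmod (G (s * z)%C)) - 2 * ln s))); [apply is_derive_exp|].
    apply is_derive_scal. apply (is_derive_minus (V := R_NormedModule)); [exact D2|]. apply is_derive_scal. apply is_derive_ln. lra. }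
  assert (D4 := is_derive_mult _ _ _ _ _ D1 D3 Rmult_comm). revert D4. unfold U.
  match goal with |- is_derive ?f _ ?a -> is_derive _ _ ?b => replace b with a; [exact (fun H => H)|] end.
  change (2 * fst (Cconj (H (t * z)) * (z * H1 (t * z)))%C * exp (lambda * (ln (sqmod (G (t * z)%C)) - 2 * ln t)) +
    sqmod (H (t * z)%C) * (lambda * (2 * fst (z * G1 (t * z) / G (t * z))%C - 2 * / t) *
     exp (lambda * (ln (sqmod (G (t * z)%C)) - 2 * ln t))) = 0).
  assert (E : (z * H1 (t * z) = lambda * H (t * z) * (/ t - z * G1 (t * z) / G (t * z)))%C).
  { assert (Htn : RtoC t <> 0) by (intros E; apply RtoC_inj in E; lra).
    assert (Hgn := Hne t Ht).
    apply (Cmult_cancel_l (t * G (t * z))%C); [now apply Cmult_neq_0|].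
    replace (t * G (t * z) * (z * H1 (t * z)))%C with (t * z * G (t * z) * H1 (t * z))%C by ring.
    rewrite Hode by exact Htz. field. auto. }
  rewrite E. rewrite <- RtoC_inv by lra.
  set (h := H (t * z)%C). set (q := (z * G1 (t * z) / G (t * z))%C).
  destruct h as [h1 h2], q as [q1 q2]. unfold sqmod, Cconj, Cmult, Cminus, Cplus, Copp, RtoC; simpl. ring. }
(* Near 0 the moduli in exp(l) G = K w give |H| = (|K| |z| t / |G|)^lambda, which fixes the
   constant. *)
assert (HU0 : forall t, 0 < t < r -> U t = exp (lambda * (2 * ln (Cmod K * Cmod z)))).
{ intros t Ht. destruct (Hnear _ (Hsmall t Ht)) as [l [Hl1 Hl2]].
  assert (HKp := Cmod_0_lt K HK).
  unfold U. rewrite !sqmod_Cmod, Hl1, Cmod_Cexp.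
  assert (EG : Cmod (G (t * z)%C) = exp (- Re l) * (Cmod K * Cmod z * t)).
  { assert (E := f_equal Cmod Hl2). rewrite !Cmod_mult, Cmod_Cexp, Cmod_R, Rabs_pos_eq in E by lra.
    rewrite exp_Ropp. apply (Rmult_eq_reg_l (exp (Re l))); [|apply Rgt_not_eq, exp_pos].
    rewrite E. field. apply Rgt_not_eq, exp_pos. }
  rewrite EG. 
  assert (HKz : 0 < Cmod K * Cmod z) by now apply Rmult_lt_0_compat.
  assert (Elin : ln ((exp (- Re l) * (Cmod K * Cmod z * t)) ^ 2) = 2 * (- Re l + (ln (Cmod K * Cmod z) + ln t))).
  { simpl. rewrite Rmult_1_r. assert (Hep := exp_pos (- Re l)).
    assert (Hkt : 0 < Cmod K * Cmod z * t) by (apply Rmult_lt_0_compat; lra).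
    rewrite ln_mult by (apply Rmult_lt_0_compat; assumption).
    rewrite ln_mult by assumption. rewrite ln_exp, (ln_mult _ t) by lra. ring. }
  rewrite Elin. simpl pow. rewrite Rmult_1_r, <- !exp_plus. f_equal.
  destruct l as [l1 l2]. unfold Re, RtoC, Cmult; simpl. ring. }
set (kappa := exp (lambda * (2 * ln (Cmod K * Cmod z)))) in *.
assert (Hkap : 0 < kappa) by apply exp_pos.
assert (HUc : forall t, 0 < t < t1 -> U t = kappa).
{ intros t Ht. rewrite <- (HU0 (r / 2)) by lra. apply (derive_zero_eq U 0 t1); auto; lra. }
destruct (holo_ray_bounded H z HH Hz) as [M [HM HM']].
(* U = kappa and |H| <= M give |G|^2 >= (kappa / M^2)^(1 / lambda) t^2, and t > t1 / 2: a lower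
   bound that persists up to the supposed zero. *)
set (m := exp (/ lambda * ln (kappa / M ^ 2) + 2 * ln (t1 / 2))).
assert (Hm : 0 < m) by apply exp_pos.
assert (HGm : forall t, t1 / 2 < t < t1 -> m <= sqmod (G (t * z)%C)).
{ intros t Ht. assert (HM2 : 0 < M ^ 2) by now apply pow_lt.
  assert (Hg : 0 < sqmod (G (t * z)%C)).
  { rewrite sqmod_Cmod. apply pow_lt, Cmod_0_lt, Hne. lra. }
  set (x := ln (sqmod (G (t * z)%C)) - 2 * ln t).
  assert (Hx : kappa / M ^ 2 <= exp (lambda * x)).
  { apply Rle_div_l; [exact HM2|]. rewrite <- (HUc t) by lra. unfold U. fold x.
    rewrite Rmult_comm. apply Rmult_le_compat_l; [left; apply exp_pos|].
    rewrite sqmod_Cmod. apply pow_incr. split; [apply Cmod_ge_0|]. apply HM'; lra. }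
  assert (Hx2 : ln (kappa / M ^ 2) <= lambda * x).
  { rewrite <- (ln_exp (lambda * x)). apply ln_le; [|exact Hx]. now apply Rdiv_lt_0_compat. }
  assert (Hx3 : / lambda * ln (kappa / M ^ 2) <= x).
  { apply (Rmult_le_reg_l lambda); [exact Hlam|]. rewrite <- Rmult_assoc, Rinv_r, Rmult_1_l by lra. exact Hx2. }
  assert (Hlt : ln (t1 / 2) <= ln t) by (apply ln_le; lra).
  rewrite <- (exp_ln (sqmod (G (t * z)%C))) by exact Hg. unfold m, x in *.
  destruct (Rle_lt_or_eq_dec (/ lambda * ln (kappa / M ^ 2) + 2 * ln (t1 / 2)) (ln (sqmod (G (t * z)%C)))) as [Hl|He]; [lra| |].
  - left. now apply exp_increasing.
  - rewrite He. lra. }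
assert (Hc : continuity_pt (fun t => Cmod (G (t * z)%C)) t1).
{ apply (rcont_Cmod (fun t => G (t * z)%C)). apply (rcont_comp G (fun t => t * z)%C).
  - apply (holo_cont G 1); [exact HG|]. apply Hunit. lra.
  - apply rcont_mult; [|apply rcont_const]. apply rcont_RtoC. apply continuity_pt_id. }
destruct (Hc (sqrt m / 2)) as [d [Hd Hd']]; [assert (P := sqrt_lt_R0 m Hm); lra|].
set (t := Rmax (3 / 4 * t1) (t1 - d / 2)).
assert (B1 : 3 / 4 * t1 <= t) by apply Rmax_l. assert (B2 : t1 - d / 2 <= t) by apply Rmax_r.
assert (B3 : t < t1) by (apply Rmax_lub_lt; lra).
assert (B4 : Rabs (t - t1) < d) by (apply Rabs_def1; lra).
assert (B5 : t1 <> t) by lra.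
specialize (Hd' t (conj (conj I B5) B4)). simpl in Hd'. unfold R_dist in Hd'.
rewrite HGt1, Cmod_0, Rminus_0_r, Rabs_pos_eq in Hd' by apply Cmod_ge_0.
specialize (HGm t ltac:(lra)). rewrite sqmod_Cmod in HGm.
assert (P := sqrt_lt_R0 m Hm). assert (Q := sqrt_sqrt m ltac:(lra)).
assert (Q2 := Cmod_ge_0 (G (t * z)%C)). simpl in HGm. nra.
Qed.

(** The terms of a convergent series tend to 0 and the weight n - lambda eventually exceeds 1, so |A
    n| <= 1 from some index on, and a geometric series dominates. *)
Lemma area_terms_bounded (lambda : R) (f : C -> C) (zeta : C) :
  ex_series (fun n : nat => area_term lambda f zeta (S n)) ->
  forall z, Cmod z < 1 -> exists l, Cser (fun n => A lambda f zeta n * z ^ n)%C l.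
Proof.
intros H z Hz. assert (Hz0 := Cmod_ge_0 z).
assert (H1 := ex_series_lim_0 _ H).
apply is_lim_seq_Reals in H1. destruct (H1 1 Rlt_0_1) as [N HN].
destruct (INR_unbounded (lambda + 1)) as [N2 HN2].
set (N0 := (N + N2)%nat).
assert (HA : forall n, Cmod (A lambda f zeta (n + S N0)%nat) <= 1).
{ intros n. specialize (HN (n + N0)%nat ltac:(unfold N0; lia)).
  unfold R_dist in HN. rewrite Rminus_0_r in HN. unfold area_term in HN.
  replace (S (n + N0)) with (n + S N0)%nat in HN by lia.
  set (a := Cmod (A lambda f zeta (n + S N0)%nat)) in *.
  assert (Hi : lambda + 1 < INR (n + S N0)).
  { eapply Rlt_le_trans; [exact HN2|]. apply le_INR. unfold N0; lia. }
  assert (Ha : 0 <= a) by apply Cmod_ge_0.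
  rewrite Rabs_pos_eq in HN by (apply Rmult_le_pos; [lra|apply pow2_ge_0]).
  simpl in HN. apply Rnot_lt_le. intros Hlt. nra. }
assert (G : forall k b, (exists l, Cser (fun n => b (n + k)%nat * z ^ n)%C l) ->
   exists l, Cser (fun n => b n * z ^ n)%C l).
{ induction k as [|k IH]; intros b [l Hl].
  - exists l. revert Hl. apply Cser_ext. intros n. now rewrite Nat.add_0_r.
  - apply IH. exists (b k + z * l)%C. apply Cser_decr.
    simpl (b (0 + k)%nat * z ^ 0)%C. replace (b k + z * l - b k * 1)%C with (z * l)%C by ring.
    generalize (Cser_scal z _ _ Hl). apply Cser_ext. intros n. 
    replace (S n + k)%nat with (n + S k)%nat by lia. simpl Cpow. ring. }
apply (G (S N0)).
apply (Cser_dominated _ (fun n => Cmod z ^ n)).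
- intros n. rewrite Cmod_mult, Cmod_pow. rewrite <- (Rmult_1_l (Cmod z ^ n)) at 2.
  apply Rmult_le_compat_r; [now apply pow_le|apply HA].
- apply ex_series_geom. rewrite Rabs_pos_eq; lra.
Qed.

(** Differentiate exp(l) G = K v, multiply by u and cancel exp(l). Without division by G the
    identity makes sense at u = 0 as well. *)
Lemma log_derivative_identity (l G : C -> C) (K u l1 g1 : C) (r : R) : Cmod u < r ->
  (forall v, Cmod v < r -> Cexp (l v) * G v = K * v)%C -> cderiv l u l1 -> cderiv G u g1 ->
  (u * l1 * G u = G u - u * g1)%C.
Proof.
intros Hu H Hl HG.
assert (EK : (l1 * Cexp (l u) * G u + Cexp (l u) * g1 = K * 1)%C).
{ apply (cderiv_unique (fun u => Cexp (l u) * G u)%C u).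
  - apply (cderiv_mult (fun u => Cexp (l u)) G); [|exact HG].
    apply (cderiv_comp Cexp l); [apply cderiv_Cexp|exact Hl].
  - apply (cderiv_ext_loc (fun u => K * u)%C _ u _ (r - Cmod u)); [lra| |apply cderiv_scal, cderiv_id].
    intros v Hv. symmetry. apply H. assert (T := Cmod_triangle_inv v u). lra. }
apply (Cmult_cancel_l (Cexp (l u)) _ _ (Cexp_neq_0 _)).
replace (Cexp (l u) * (u * l1 * G u))%C with
  (u * (l1 * Cexp (l u) * G u + Cexp (l u) * g1) - Cexp (l u) * (u * g1))%C by ring.
rewrite EK. replace (u * (K * 1))%C with (K * u)%C by ring. rewrite <- (H u Hu). ring.
Qed.

Theorem univalent_of_area (lambda : R) (f : C -> C) : 0 < lambda -> locally_univalent f ->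
  (forall zeta, in_disk zeta -> ex_series (fun n : nat => area_term lambda f zeta (S n))) ->
  univalent f.
Proof.
intros Hlam Hf Hser zeta w Hzeta Hw Hfw.
destruct (Ceq_dec zeta w) as [E|Hne]; [exact E|exfalso].
destruct (mobius_surj zeta w Hzeta Hw) as [z [Hz Hzw]].
assert (Hz0 : z <> 0) by (intros ->; apply Hne; now rewrite <- Hzw, mobius_0).
destruct (A_expansion lambda f zeta Hf Hzeta) as [r [l [K [Hr [Hl [Hl0 [HK [HlG HA]]]]]]]].
set (G := fun z => (f (mobius zeta z) - f zeta)%C).
assert (HG : holo G 1).
{ apply holo_minus; [|apply holo_const].
  apply (holo_comp f (mobius zeta) 1 1); [intros; now apply Cmod_mobius|now apply locally_univalent_holo|now apply holo_mobius]. }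
destruct (psum_intro (A lambda f zeta) 1) as [H HH].
{ apply area_terms_bounded. now apply Hser. }
assert (HHh : holo H 1) by (eapply psum_holo; eassumption).
destruct (holo_derive G 1 Rlt_0_1 HG) as [G1 [HG1 HG1']].
destruct (holo_derive H 1 Rlt_0_1 HHh) as [H1 [HH1 HH1']].
assert (HHl : forall u, Cmod u < r -> H u = Cexp (lambda * l u)).
{ intros u Hu. apply (Cser_unique _ _ _ (HH u ltac:(lra)) (HA u Hu)). }
apply (no_zero_on_ray lambda G G1 H H1 K r z); auto.
- intros u Hu. exists (l u). split; [now apply HHl|now apply HlG].
- intros u Hu.
  (* The logarithm [l] exists only near 0, but [D] no longer mentions it, so its vanishing spreads
     to the whole disc. *)
  set (D := fun u => (u * G u * H1 u - lambda * H u * (G u - u * G1 u))%C).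
  assert (HD : D u = 0).
  { apply (identity_theorem D r 1); [lra| | |exact Hu].
    - apply holo_minus.
      + repeat apply holo_mult; auto using holo_id.
      + apply holo_mult; [apply holo_mult; [apply holo_const|exact HHh]|].
        apply holo_minus; [exact HG|apply holo_mult; auto using holo_id].
    - clear u Hu. intros u Hu. destruct (Hl u Hu) as [l1 Hl1].
      assert (EH : H1 u = (lambda * l1 * Cexp (lambda * l u))%C).
      { apply (cderiv_unique H u); [apply HH1'; lra|].
        apply (cderiv_ext_loc (fun u => Cexp (lambda * l u)) H u _ (r - Cmod u)); [lra| |].
        - intros v Hv. symmetry. apply HHl. assert (T := Cmod_triangle_inv v u). lra.
        - apply (cderiv_comp Cexp (fun u => lambda * l u)%C); [exact (cderiv_Cexp _)|now apply cderiv_scal]. }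
      unfold D. rewrite EH, (HHl u Hu).
      assert (EG := log_derivative_identity l G K u l1 (G1 u) r Hu HlG Hl1 (HG1' u ltac:(lra))).
      rewrite <- EG. ring. }
  unfold D in HD. 
  replace (u * G u * H1 u)%C with ((u * G u * H1 u - lambda * H u * (G u - u * G1 u)) + lambda * H u * (G u - u * G1 u))%C by ring.
  rewrite HD. ring.
- unfold G. rewrite Hzw, Hfw. ring.
Qed.


(** * The truncated Cauchy kernel along an injective loop *)

(** A compactness argument on the square of parameters: near a pair with equal [cis] the conclusion
    is continuity, near any other pair the values of [w] stay apart. Parameters are compared through
    [cis] because 0 and 2 pi are the same point of the loop. *)
Lemma injective_loop_separation (w : R -> C) (eta : R) : 0 < eta ->
  (forall t, rcont w t) ->
  (forall s t, 0 <= s <= 2 * PI -> 0 <= t <= 2 * PI -> w s = w t -> cis s = cis t) ->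
  exists d, 0 < d /\ forall s t, 0 <= s <= 2 * PI -> 0 <= t <= 2 * PI ->
    Cmod (w s - w t) < d -> Cmod (cis s - cis t) < eta.
Proof.
intros Heta Hw Hinj.
assert (G : forall u v, exists d : posreal, 0 <= u <= 2 * PI -> 0 <= v <= 2 * PI ->
  forall s t, Rabs (s - u) < d -> Rabs (t - v) < d ->
   Cmod (w s - w t) < d -> Cmod (cis s - cis t) < eta).
{ intros u v. destruct (Ceq_dec (cis u) (cis v)) as [E|E].
  - assert (Hd : 0 < eta / 2) by lra.
    exists (mkposreal _ Hd). simpl. intros Hu Hv s t Hs Ht _.
    replace (cis s - cis t)%C with ((cis s - cis u) - (cis t - cis v))%C by (rewrite E; ring).
    eapply Rle_lt_trans; [apply Cmod_triangle|]. rewrite Cmod_opp.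
    assert (A := Cmod_cis_sub u s). assert (B := Cmod_cis_sub v t). lra.
  - destruct (Req_dec (Cmod (w u - w v)) 0) as [E0|E0].
    + exists (mkposreal 1 Rlt_0_1). intros Hu Hv. exfalso. apply E. apply Hinj; auto.
      apply Cmod_eq_0 in E0. replace (w u) with (w u - w v + w v)%C by ring. rewrite E0. ring.
    + set (m := Cmod (w u - w v)) in *.
      assert (Hm : 0 < m) by (assert (P := Cmod_ge_0 (w u - w v)); fold m in P; lra).
      destruct (Hw u (m / 4)) as [d1 [Hd1 H1]]; [lra|].
      destruct (Hw v (m / 4)) as [d2 [Hd2 H2]]; [lra|].
      assert (Hd : 0 < Rmin (Rmin d1 d2) (m / 2)) by (apply Rmin_glb_lt; [now apply Rmin_glb_lt|lra]).
      exists (mkposreal _ Hd). simpl. intros _ _ s t Hs Ht Hst. exfalso.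
      assert (P1 := Rmin_l (Rmin d1 d2) (m / 2)). assert (P2 := Rmin_r (Rmin d1 d2) (m / 2)).
      assert (P3 := Rmin_l d1 d2). assert (P4 := Rmin_r d1 d2).
      specialize (H1 s ltac:(lra)). specialize (H2 t ltac:(lra)).
      assert (T1 := Cmod_triangle_sub (w u) (w s) (w v)).
      assert (T2 := Cmod_triangle_sub (w s) (w t) (w v)).
      rewrite (Cmod_sub_comm (w u) (w s)) in T1. fold m in T1. lra. }
set (delta := fun u v => proj1_sig (constructive_indefinite_description _ (G u v))).
assert (Hdelta : forall u v, 0 <= u <= 2 * PI -> 0 <= v <= 2 * PI ->
  forall s t, Rabs (s - u) < delta u v -> Rabs (t - v) < delta u v ->
   Cmod (w s - w t) < delta u v -> Cmod (cis s - cis t) < eta).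
{ intros u v. exact (proj2_sig (constructive_indefinite_description _ (G u v))). }
(* The covering cell is obtained only under a double negation, hence the contradiction below. *)
destruct (compactness_value_2d 0 (2 * PI) 0 (2 * PI) delta) as [d Hd].
exists d. split; [apply cond_pos|]. intros s t Hs Ht Hst.
apply Rnot_le_lt. intros Hc. apply (Hd s t Hs Ht).
intros [u [v [Hu [Hv [H1 [H2 H3]]]]]].
assert (B := Hdelta u v Hu Hv s t H1 H2 ltac:(lra)). lra.
Qed.

(** * The Poisson kernel and the truncated Cauchy kernel *)

Lemma poisson_real_part (y : C) : Cmod y < 1 ->
  (1 - Cmod y ^ 2) / Cmod (1 - y) ^ 2 = 2 * fst (/ (1 - y))%C - 1.
Proof.
intros Hy. assert (H := Cmod_0_lt _ (one_minus_neq_0 y Hy)).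
assert (H2 : 0 < Cmod (1 - y) ^ 2) by now apply pow_lt.
rewrite !Cmod2_alt in *. destruct y as [a b]. unfold Cinv, Re, Im in *. simpl in *.
field. nra.
Qed.

(** With y = x e^(-it), (1 - |x|^2) / |1 - y|^2 = 2 Re (1 / (1 - y)) - 1, whose integral is 4 pi - 2
    pi by [mean_cauchy_kernel]. *)
Lemma is_RInt_poisson (x : C) : Cmod x < 1 ->
  is_RInt (fun t => / Cmod (1 - x * cis (- t)) ^ 2) 0 (2 * PI) (2 * PI / (1 - Cmod x ^ 2)).
Proof.
intros Hx. assert (Hx0 := Cmod_ge_0 x).
assert (Hd : 0 < 1 - Cmod x ^ 2) by nra.
assert (H1 := is_CInt_fst _ _ _ _ (mean_cauchy_kernel x Hx)). simpl in H1.
assert (H2 := is_RInt_scal _ _ _ 2 _ H1).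
assert (H3 := is_RInt_minus _ _ _ _ _ _ H2 (is_RInt_const 0 (2 * PI) 1)).
assert (H4 := is_RInt_scal _ _ _ (/ (1 - Cmod x ^ 2)) _ H3).
replace (2 * PI / (1 - Cmod x ^ 2)) with
  (scal (/ (1 - Cmod x ^ 2)) (minus (scal 2 (2 * PI)) (scal (2 * PI - 0) 1))).
- revert H4. apply is_RInt_ext. intros t _.
  assert (Hy : Cmod (x * cis (- t)) = Cmod x) by apply Cmod_mul_cis.
  assert (E := poisson_real_part (x * cis (- t)) ltac:(lra)). rewrite Hy in E.
  assert (Hn := Cmod_0_lt _ (one_minus_neq_0 (x * cis (- t)) ltac:(lra))).
  change (/ (1 - Cmod x ^ 2) * (2 * fst (/ (1 - x * cis (- t)))%C - 1) = / Cmod (1 - x * cis (- t)) ^ 2).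
  rewrite <- E. field. lra.
- change (/ (1 - Cmod x ^ 2) * (2 * (2 * PI) - (2 * PI - 0) * 1) = 2 * PI / (1 - Cmod x ^ 2)). field. lra.
Qed.

(* [1 / v], truncated to stay continuous at the origin. *)
Definition tinv (d : R) (v : C) : C := (Cconj v * RtoC (/ Rmax (Cmod v) d ^ 2))%C.

Lemma tinv_far (d : R) (v : C) : 0 < d -> d <= Cmod v -> tinv d v = (/ v)%C.
Proof.
intros Hd Hv. unfold tinv. rewrite Rmax_left by exact Hv.
assert (Hv0 : v <> 0) by (apply Cmod_gt_0; lra).
rewrite RtoC_inv by (apply pow_nonzero; lra).
assert (Hc : Cconj v <> 0) by (apply Cmod_gt_0; rewrite Cmod_conj; lra).
rewrite Cmod2_conj. field. auto.
Qed.

Lemma Cmod_tinv (d : R) (v : C) : 0 < d -> Cmod (tinv d v) = Cmod v / Rmax (Cmod v) d ^ 2.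
Proof.
intros Hd. unfold tinv. rewrite Cmod_mult, Cmod_conj, Cmod_R, Rabs_pos_eq; [reflexivity|].
left. apply Rinv_0_lt_compat, pow_lt. eapply Rlt_le_trans; [exact Hd|apply Rmax_r].
Qed.

Lemma Cmod_tinv_le (d c : R) (v : C) : 0 < d -> 0 < c -> c <= Rmax (Cmod v) d ->
  Cmod (tinv d v) <= / c.
Proof.
intros Hd Hc H. rewrite Cmod_tinv by exact Hd. set (m := Rmax (Cmod v) d) in *.
assert (Hm : Cmod v <= m) by apply Rmax_l.
apply Rle_div_l; [apply pow_lt; lra|]. simpl. rewrite Rmult_1_r.
replace (/ c * (m * m)) with (m * (m / c)) by (field; lra).
assert (1 <= m / c) by (apply Rle_div_r; lra). nra.
Qed.

Lemma tinv_lipschitz (d : R) (v w : C) : 0 < d ->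
  Cmod (tinv d v - tinv d w) <= 3 / d ^ 2 * Cmod (v - w).
Proof.
intros Hd. unfold tinv.
set (a := Rmax (Cmod v) d). set (b := Rmax (Cmod w) d).
assert (Ha : d <= a) by apply Rmax_r. assert (Hb : d <= b) by apply Rmax_r.
assert (Hwb : Cmod w <= b) by apply Rmax_l.
assert (Hab : Rabs (a - b) <= Cmod (v - w)).
{ assert (T1 := Cmod_triangle_inv v w). assert (T2 := Cmod_triangle_inv w v).
  rewrite Cmod_sub_comm in T2. unfold a, b, Rmax.
  assert (P := Cmod_ge_0 (v - w)).
  apply Rabs_le. destruct (Rle_dec (Cmod v) d), (Rle_dec (Cmod w) d); lra. }
replace (Cconj v * RtoC (/ a ^ 2) - Cconj w * RtoC (/ b ^ 2))%C with
  (Cconj (v - w) * RtoC (/ a ^ 2) + Cconj w * RtoC (/ a ^ 2 - / b ^ 2))%C.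
2:{ rewrite RtoC_minus. replace (Cconj (v - w)) with (Cconj v - Cconj w)%C; [ring|].
    unfold Cconj, Cminus, Cplus, Copp; simpl; f_equal; ring. }
eapply Rle_trans; [apply Cmod_triangle|]. rewrite !Cmod_mult, !Cmod_conj, !Cmod_R.
assert (Hia : / a ^ 2 <= / d ^ 2).
{ apply Rinv_le_contravar; [now apply pow_lt|]. apply pow_incr. lra. }
assert (Hia0 : 0 < / a ^ 2) by (apply Rinv_0_lt_compat, pow_lt; lra).
rewrite (Rabs_pos_eq (/ a ^ 2)) by lra.
assert (E : Rabs (/ a ^ 2 - / b ^ 2) = Rabs (a - b) * ((a + b) / (a ^ 2 * b ^ 2))).
{ replace (/ a ^ 2 - / b ^ 2) with (- (a - b) * ((a + b) / (a ^ 2 * b ^ 2))) by (field; lra).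
  rewrite Rabs_mult, Rabs_Ropp. f_equal. apply Rabs_pos_eq.
  apply Rdiv_le_0_compat; [lra|]. apply Rmult_lt_0_compat; apply pow_lt; lra. }
rewrite E.
assert (Hp := Rabs_pos (a - b)). assert (Hv0 := Cmod_ge_0 (v - w)). assert (Hw0 := Cmod_ge_0 w).
assert (F : Cmod w * ((a + b) / (a ^ 2 * b ^ 2)) <= 2 / d ^ 2).
{ apply Rle_trans with (b * ((a + b) / (a ^ 2 * b ^ 2))).
  - apply Rmult_le_compat_r; [|exact Hwb].
    apply Rdiv_le_0_compat; [lra|]. apply Rmult_lt_0_compat; apply pow_lt; lra.
  - replace (b * ((a + b) / (a ^ 2 * b ^ 2))) with (/ (a * b) + / a ^ 2) by (field; lra).
    assert (/ (a * b) <= / d ^ 2).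
    { apply Rinv_le_contravar; [now apply pow_lt|]. simpl. rewrite Rmult_1_r.
      apply Rmult_le_compat; lra. }
    lra. }
replace (3 / d ^ 2 * Cmod (v - w)) with (Cmod (v - w) * / d ^ 2 + Cmod (v - w) * (2 / d ^ 2)) by (field; lra).
apply Rplus_le_compat; [apply Rmult_le_compat_l; lra|].
replace (Cmod w * (Rabs (a - b) * ((a + b) / (a ^ 2 * b ^ 2))))
 with (Rabs (a - b) * (Cmod w * ((a + b) / (a ^ 2 * b ^ 2)))) by ring.
apply Rmult_le_compat; try lra.
apply Rmult_le_pos; [exact Hw0|]. apply Rdiv_le_0_compat; [lra|]. apply Rmult_lt_0_compat; apply pow_lt; lra.
Qed.

Lemma ccont_tinv (d : R) (v : C) : 0 < d -> ccont (tinv d) v.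
Proof.
intros Hd e He. assert (H3 : 0 < 3 / d ^ 2) by (apply Rdiv_lt_0_compat; [lra|now apply pow_lt]).
exists (e / (3 / d ^ 2)). split; [now apply Rdiv_lt_0_compat|].
intros w Hw. eapply Rle_lt_trans; [now apply tinv_lipschitz|].
apply Rlt_div_r in Hw; lra.
Qed.

Definition tkernel (d : R) (x : C) : C := tinv d (1 - x).

Lemma ccont_tkernel (d : R) (x : C) : 0 < d -> ccont (tkernel d) x.
Proof.
intros Hd e He. destruct (ccont_tinv d (1 - x) Hd e He) as [r [Hr H]].
exists r; split; [exact Hr|]. intros w Hw. apply H.
replace (1 - w - (1 - x))%C with (- (w - x))%C by ring. now rewrite Cmod_opp.
Qed.

Lemma tkernel_le (d : R) (x : C) : 0 < d -> Cmod (tkernel d x) <= / d.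
Proof. intros Hd. apply Cmod_tinv_le; auto. apply Rmax_r. Qed.

(* Only the parameters [t] with [w t] close to [u] matter; by injectivity they lie in a short
   arc, which a Poisson kernel dominates. *)
Lemma tkernel_integral_small (w : R -> C) (U e : R) : 0 < e -> 0 < U ->
  (forall t, rcont w t) ->
  (forall s t, 0 <= s <= 2 * PI -> 0 <= t <= 2 * PI -> w s = w t -> cis s = cis t) ->
  exists d0, 0 < d0 /\ forall (d : R) (u : C), 0 < d < d0 -> u <> 0 -> Cmod u <= U ->
    RInt (fun t => Cmod (tkernel d (w t / u))) 0 (2 * PI) <= e / d.
Proof.
intros He HU Hw Hinj. assert (HP := PI2_pos).
(* The short arc contributes at most 4 / d times 2 pi eta, that is at most e / (2 d). *)
set (eta := Rmin (1 / 2) (e / (16 * PI))).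
assert (Heta : 0 < eta) by (apply Rmin_glb_lt; [lra|apply Rdiv_lt_0_compat; lra]).
assert (Heta1 : eta <= 1 / 2) by apply Rmin_l.
assert (Heta2 : eta <= e / (16 * PI)) by apply Rmin_r.
clearbody eta.
destruct (injective_loop_separation w eta Heta Hw Hinj) as [d1 [Hd1 Hsep]].
(* Away from [u] the kernel is at most 2 U / d1; below this d its integral is at most the other e /
   (2 d). *)
exists (e * d1 / (8 * PI * U)). split.
{ apply Rdiv_lt_0_compat; [now apply Rmult_lt_0_compat|]. apply Rmult_lt_0_compat; lra. }
intros d u [Hd Hd0] Hu HuU. assert (Hup := Cmod_0_lt u Hu).
assert (Hcont : forall t, rcont (fun t => tkernel d (w t / u)) t).
{ intros t. apply (rcont_comp (tkernel d)); [now apply ccont_tkernel|].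
  apply rcont_mult; [apply Hw|apply rcont_const]. }
assert (Hfar : forall t, d1 / 2 <= Cmod (w t - u) -> Cmod (tkernel d (w t / u)) <= 2 * U / d1).
{ intros t Ht. replace (2 * U / d1) with (/ (d1 / (2 * U))) by (field; lra).
  apply Cmod_tinv_le; [exact Hd|apply Rdiv_lt_0_compat; lra|].
  eapply Rle_trans; [|apply Rmax_l].
  replace (1 - w t / u)%C with (- ((w t - u) / u))%C by (field; exact Hu).
  rewrite Cmod_opp, Cmod_div by exact Hu.
  apply Rle_trans with (d1 / 2 / U); [apply Req_le; field; lra|].
  unfold Rdiv. apply Rmult_le_compat; try lra.
  - left; now apply Rinv_0_lt_compat.
  - now apply Rinv_le_contravar. }
assert (HN : exists (c : R) (h : R -> R), c <= 2 * PI * eta /\ is_RInt h 0 (2 * PI) c /\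
   forall t, 0 <= t <= 2 * PI -> Cmod (tkernel d (w t / u)) <= 4 / d * h t + 2 * U / d1).
{ destruct (classic (exists t0, 0 <= t0 <= 2 * PI /\ Cmod (w t0 - u) < d1 / 2)) as [[t0 [Ht0 Hnear]]|Hno].
  (* eta^2 / |1 - x e^(-it)|^2 stands in for the indicator function of the arc |cis t - cis t0| <
     eta: it is at least 1/4 there, because the denominator is at most (2 eta)^2, and its integral
     is at most 2 pi eta. *)
  - set (x := ((1 - eta)%R * cis t0)%C).
    assert (Hx : Cmod x = 1 - eta) by (unfold x; rewrite Cmod_mul_cis, Cmod_R, Rabs_pos_eq; lra).
    exists (eta ^ 2 * (2 * PI / (1 - Cmod x ^ 2))), (fun t => eta ^ 2 * / Cmod (1 - x * cis (- t)) ^ 2).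
    split; [|split].
    + rewrite Hx. replace (1 - (1 - eta) ^ 2) with (eta * (2 - eta)) by ring.
      replace (eta ^ 2 * (2 * PI / (eta * (2 - eta)))) with (2 * PI * eta * / (2 - eta)) by (field; lra).
      rewrite <- (Rmult_1_r (2 * PI * eta)) at 2. apply Rmult_le_compat_l; [nra|].
      rewrite <- Rinv_1. apply Rinv_le_contravar; lra.
    + apply (is_RInt_scal (V := R_NormedModule)). apply is_RInt_poisson. lra.
    + intros t Ht. assert (Hn := Cmod_0_lt _ (one_minus_neq_0 (x * cis (- t)) ltac:(rewrite Cmod_mul_cis; lra))).
      set (q := Cmod (1 - x * cis (- t))) in *.
      assert (H0 : 0 <= 2 * U / d1) by (apply Rdiv_le_0_compat; lra).
      destruct (Rle_dec (d1 / 2) (Cmod (w t - u))) as [Hf|Hf].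
      * eapply Rle_trans; [now apply Hfar|].
        assert (0 <= 4 / d * (eta ^ 2 * / q ^ 2)); [|lra].
        apply Rmult_le_pos; [apply Rdiv_le_0_compat; lra|].
        apply Rmult_le_pos; [apply pow2_ge_0|]. left. apply Rinv_0_lt_compat, pow_lt, Hn.
      * assert (Hc : Cmod (cis t - cis t0) < eta).
        { apply Hsep; auto. assert (T := Cmod_triangle_sub (w t) u (w t0)).
          rewrite (Cmod_sub_comm u (w t0)) in T. lra. }
        assert (Hq : q <= 2 * eta).
        { unfold q. replace (1 - x * cis (- t))%C with ((cis t - cis t0 + eta * cis t0) * cis (- t))%C.
          - rewrite Cmod_mul_cis. eapply Rle_trans; [apply Cmod_triangle|].
            rewrite Cmod_mul_cis, Cmod_R, Rabs_pos_eq; lra.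
          - unfold x. rewrite RtoC_minus, cis_opp. field. apply cis_neq_0. }
        assert (Hh : 1 <= 4 * (eta ^ 2 * / q ^ 2)).
        { assert (Hq2 : 0 < q ^ 2) by now apply pow_lt.
          apply (Rmult_le_reg_r (q ^ 2)); [exact Hq2|].
          replace (4 * (eta ^ 2 * / q ^ 2) * q ^ 2) with (4 * eta ^ 2) by (field; lra). nra. }
        assert (Hb := tkernel_le d (w t / u) Hd).
        assert (Hid : 0 < / d) by now apply Rinv_0_lt_compat.
        assert (/ d * 1 <= / d * (4 * (eta ^ 2 * / q ^ 2))) by (apply Rmult_le_compat_l; lra).
        unfold Rdiv at 2. lra.
  - exists 0, (fun _ => 0). split; [nra|]. split.
    + assert (H := is_RInt_const 0 (2 * PI) 0). unfold scal in H; simpl in H; unfold mult in H; simpl in H.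
      now rewrite Rmult_0_r in H.
    + intros t Ht. rewrite Rmult_0_r, Rplus_0_l. apply Hfar.
      apply Rnot_lt_le. intros H. apply Hno. now exists t. }
destruct HN as [c [h [Hc [Hh Hle]]]].
apply Rle_trans with (4 / d * c + (2 * PI - 0) * (2 * U / d1)).
- apply (is_RInt_le (fun t => Cmod (tkernel d (w t / u))) (fun t => 4 / d * h t + 2 * U / d1) 0 (2 * PI)).
  + lra.
  + apply (RInt_correct (V := R_CompleteNormedModule)).
    apply (ex_RInt_continuous (V := R_CompleteNormedModule)). intros t _.
    apply continuity_pt_filterlim. apply (rcont_Cmod (fun t => tkernel d (w t / u))), Hcont.
  + apply (is_RInt_plus (V := R_NormedModule)).
    * now apply (is_RInt_scal (V := R_NormedModule)).
    * apply (is_RInt_const (V := R_NormedModule)).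
  + intros t Ht. apply Hle. lra.
- assert (A1 : 4 / d * c <= 4 / d * (2 * PI * (e / (16 * PI)))).
  { apply Rmult_le_compat_l; [apply Rdiv_le_0_compat; lra|].
    eapply Rle_trans; [exact Hc|]. apply Rmult_le_compat_l; lra. }
  replace (4 / d * (2 * PI * (e / (16 * PI)))) with (e / (2 * d)) in A1 by (field; lra).
  assert (A2 : (2 * PI - 0) * (2 * U / d1) <= e / (2 * d)).
  { apply (Rmult_le_reg_r (2 * d)); [lra|]. replace (e / (2 * d) * (2 * d)) with e by (field; lra). apply Rlt_div_r in Hd0; [|apply Rmult_lt_0_compat; lra].
    replace ((2 * PI - 0) * (2 * U / d1) * (2 * d)) with (d * (8 * PI * U) / d1) by (field; lra).
    apply Rle_div_l; lra. }
  replace (e / d) with (e / (2 * d) + e / (2 * d)) by (field; lra). lra.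
Qed.


(** * Fubini's theorem and circular means *)

Definition cont2 (f : R -> R -> C) : Prop :=
  forall x y e, 0 < e -> exists d, 0 < d /\ forall x' y',
    Rabs (x' - x) < d -> Rabs (y' - y) < d -> Cmod (f x' y' - f x y) < e.

Lemma cont2_l (h : R -> C) : (forall x, rcont h x) -> cont2 (fun x _ => h x).
Proof.
intros H x y e He. destruct (H x e He) as [d [Hd Hd']]. exists d; split; auto.
Qed.

Lemma cont2_r (h : R -> C) : (forall x, rcont h x) -> cont2 (fun _ y => h y).
Proof.
intros H x y e He. destruct (H y e He) as [d [Hd Hd']]. exists d; split; auto.
Qed.

Lemma cont2_comp (g : C -> C) (f : R -> R -> C) :
  (forall x y, ccont g (f x y)) -> cont2 f -> cont2 (fun x y => g (f x y)).
Proof.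
intros Hg Hf x y e He. destruct (Hg x y e He) as [d [Hd Hd']].
destruct (Hf x y d Hd) as [r [Hr Hr']]. exists r; split; auto.
Qed.

Lemma cont2_diag (f g : R -> R -> C) (h : C -> C -> C) : cont2 f -> cont2 g ->
  (forall a b e, 0 < e -> exists d, 0 < d /\ forall a' b', Cmod (a' - a) < d -> Cmod (b' - b) < d ->
     Cmod (h a' b' - h a b) < e) -> cont2 (fun x y => h (f x y) (g x y)).
Proof.
intros Hf Hg Hh x y e He. destruct (Hh (f x y) (g x y) e He) as [d [Hd Hd']].
destruct (Hf x y d Hd) as [r1 [Hr1 H1]]. destruct (Hg x y d Hd) as [r2 [Hr2 H2]].
exists (Rmin r1 r2). split; [now apply Rmin_glb_lt|]. intros x' y' Hx Hy.
assert (P1 := Rmin_l r1 r2). assert (P2 := Rmin_r r1 r2).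
apply Hd'; [apply H1|apply H2]; lra.
Qed.

Lemma cont2_plus (f g : R -> R -> C) : cont2 f -> cont2 g -> cont2 (fun x y => f x y + g x y)%C.
Proof.
intros Hf Hg. apply (cont2_diag f g Cplus Hf Hg). intros a b e He.
exists (e / 2). split; [lra|]. intros a' b' Ha Hb.
replace (a' + b' - (a + b))%C with ((a' - a) + (b' - b))%C by ring.
eapply Rle_lt_trans; [apply Cmod_triangle|lra].
Qed.

Lemma cont2_mult (f g : R -> R -> C) : cont2 f -> cont2 g -> cont2 (fun x y => f x y * g x y)%C.
Proof.
intros Hf Hg. apply (cont2_diag f g Cmult Hf Hg). intros a b e He.
assert (Ha0 := Cmod_ge_0 a). assert (Hb0 := Cmod_ge_0 b).
assert (Hk : 0 < Rmin 1 (e / (Cmod a + Cmod b + 1))).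
{ apply Rmin_glb_lt; [lra|]. apply Rdiv_lt_0_compat; lra. }
exists (Rmin 1 (e / (Cmod a + Cmod b + 1))). split; [exact Hk|]. intros a' b' Ha Hb.
set (k := Rmin 1 (e / (Cmod a + Cmod b + 1))) in *.
assert (Hk1 : k <= 1) by apply Rmin_l.
assert (Hk2 : k * (Cmod a + Cmod b + 1) <= e).
{ apply Rle_trans with (e / (Cmod a + Cmod b + 1) * (Cmod a + Cmod b + 1)).
  - apply Rmult_le_compat_r; [lra|apply Rmin_r].
  - apply Req_le. field. lra. }
replace (a' * b' - a * b)%C with ((a' - a) * (b' - b) + ((a' - a) * b + a * (b' - b)))%C by ring.
eapply Rle_lt_trans; [apply Cmod_triangle|].
eapply Rle_lt_trans; [apply Rplus_le_compat_l, Cmod_triangle|].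
rewrite !Cmod_mult. assert (H1 := Cmod_ge_0 (a' - a)). assert (H2 := Cmod_ge_0 (b' - b)).
assert (Cmod (a' - a) * Cmod (b' - b) < k * 1).
{ apply Rmult_le_0_lt_compat; lra. }
assert (Cmod (a' - a) * Cmod b <= k * Cmod b) by (apply Rmult_le_compat_r; lra).
assert (Cmod a * Cmod (b' - b) <= Cmod a * k) by (apply Rmult_le_compat_l; lra).
lra.
Qed.

Lemma ccont_real (g : R -> R) (c : C) : continuity_pt g (fst c) -> ccont (fun z => RtoC (g (fst z))) c.
Proof.
intros Hg e He. destruct (rcont_RtoC g (fst c) Hg e He) as [d [Hd Hd']]. exists d. split; [exact Hd|].
intros w Hw. apply Hd'. eapply Rle_lt_trans; [apply (Rabs_fst_le (w - c))|exact Hw].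
Qed.

Lemma cont2_fst (f : R -> R -> C) (x y : R) : cont2 f -> continuity_2d_pt (fun x y => fst (f x y)) x y.
Proof.
intros H e. destruct (H x y e (cond_pos e)) as [d [Hd Hd']]. exists (mkposreal d Hd).
intros u v Hu Hv. eapply Rle_lt_trans; [|apply (Hd' u v Hu Hv)].
apply (Rabs_fst_le (f u v - f x y)).
Qed.

Lemma continuity_2d_pt_swap (f : R -> R -> R) (x y : R) :
  continuity_2d_pt f x y -> continuity_2d_pt (fun v u => f u v) y x.
Proof.
intros H e. destruct (H e) as [d Hd]. exists d. intros u v Hu Hv. now apply Hd.
Qed.

Lemma continuity_2d_pt_l (f : R -> R -> R) (x y : R) :
  continuity_2d_pt f x y -> continuity_pt (fun x => f x y) x.
Proof.
intros H. apply rcont_eps_pt. intros e He. destruct (H (mkposreal e He)) as [d Hd].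
exists d. split; [apply cond_pos|]. intros u Hu. apply (Hd u y Hu).
rewrite Rminus_diag, Rabs_R0. apply cond_pos.
Qed.

Lemma ex_RInt_cont (f : R -> R) (a b : R) : (forall x, continuity_pt f x) -> ex_RInt f a b.
Proof.
intros H. apply (ex_RInt_continuous (V := R_CompleteNormedModule)). intros x _.
now apply continuity_pt_filterlim.
Qed.

Lemma continuity_RInt_param (f : R -> R -> R) (a b x : R) : a <= b ->
  (forall x y, continuity_2d_pt f x y) -> continuity_pt (fun x => RInt (fun y => f x y) a b) x.
Proof.
intros Hab Hf. apply rcont_eps_pt. intros e He.
assert (He' : 0 < e / (2 * (b - a + 1))) by (apply Rdiv_lt_0_compat; lra).
destruct (uniform_continuity_2d_1d' f a b x (fun y _ => Hf x y) (mkposreal _ He')) as [d Hd].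
assert (Hex : forall x, ex_RInt (fun y => f x y) a b).
{ intros u. apply ex_RInt_cont. intros y.
  apply (continuity_2d_pt_l (fun y x => f x y)). now apply continuity_2d_pt_swap. }
exists d. split; [apply cond_pos|]. intros u Hu.
change (RInt (fun y => f u y) a b - RInt (fun y => f x y) a b) with
  (minus (RInt (fun y => f u y) a b) (RInt (fun y => f x y) a b)).
rewrite <- (RInt_minus (V := R_CompleteNormedModule)) by apply Hex.
eapply Rle_lt_trans.
- apply (abs_RInt_le_const _ a b (e / (2 * (b - a + 1))) Hab).
  + apply (ex_RInt_minus (V := R_NormedModule)); apply Hex.
  + intros t Ht. left. assert (Dp := cond_pos d).
    apply Rabs_def2 in Hu. apply (Hd t x t u); try lra.
    rewrite Rminus_diag, Rabs_R0. lra.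
- replace ((b - a) * (e / (2 * (b - a + 1)))) with (e / 2 * ((b - a) / (b - a + 1))) by (field; lra).
  assert ((b - a) / (b - a + 1) <= 1) by (apply Rle_div_l; lra).
  assert (0 <= (b - a) / (b - a + 1)) by (apply Rdiv_le_0_compat; lra). nra.
Qed.

(** As functions of the upper limit in y, both sides have the same derivative, and both vanish when
    that limit is c. *)
Theorem fubini (f : R -> R -> R) (a b c d : R) : a <= b -> c <= d ->
  (forall x y, continuity_2d_pt f x y) ->
  RInt (fun x => RInt (fun y => f x y) c d) a b = RInt (fun y => RInt (fun x => f x y) a b) c d.
Proof.
intros Hab Hcd Hf.
assert (Hf' : forall x y, continuity_2d_pt (fun y x => f x y) x y) by (intros; now apply continuity_2d_pt_swap).
assert (Hcy : forall x y, continuity_pt (f x) y) by (intros x y; exact (continuity_2d_pt_l _ _ _ (Hf' y x))).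
assert (HD : forall x t, is_derive (fun t => RInt (f x) c t) t (f x t)).
{ intros x t. apply (is_derive_RInt (V := R_NormedModule) (f x) _ c t).
  - exists (mkposreal 1 Rlt_0_1). intros u _. apply (RInt_correct (V := R_CompleteNormedModule)).
    apply ex_RInt_cont, Hcy.
  - apply continuity_pt_filterlim, Hcy. }
set (Phi := fun t => RInt (fun x => RInt (f x) c t) a b).
set (Psi := fun t => RInt (fun y => RInt (fun x => f x y) a b) c t).
set (g := fun y => RInt (fun x => f x y) a b).
assert (Hg : forall y, continuity_pt g y).
{ intros y. apply (continuity_RInt_param (fun y x => f x y)); auto. }
assert (HPsi : forall t, is_derive Psi t (g t)).
{ intros t. apply (is_derive_RInt (V := R_NormedModule) g _ c t).
  - exists (mkposreal 1 Rlt_0_1). intros u _. apply (RInt_correct (V := R_CompleteNormedModule)).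
    now apply ex_RInt_cont.
  - now apply continuity_pt_filterlim. }
assert (Hin : forall t, c <= t -> forall x, continuity_pt (fun x => RInt (f x) c t) x).
{ intros t Ht x. now apply continuity_RInt_param. }
assert (Hin' : forall t x, continuity_pt (fun x => RInt (f x) c t) x).
{ intros t x. destruct (Rle_dec c t) as [Ht|Ht]; [now apply Hin|].
  apply continuity_pt_ext with (fun x => - RInt (f x) t c).
  - intros y. apply (opp_RInt_swap (V := R_CompleteNormedModule) (f y) t c).
    apply ex_RInt_cont, Hcy.
  - apply continuity_pt_opp. apply continuity_RInt_param; [lra|exact Hf]. }
assert (HPhi : forall t, is_derive Phi t (g t)).
{ intros t. unfold Phi, g.
  replace (RInt (fun x => f x t) a b) with
    (RInt (fun x => Derive (fun u => RInt (f x) c u) t) a b).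
  - apply (is_derive_RInt_param (fun t x => RInt (f x) c t) a b t).
    + exists (mkposreal 1 Rlt_0_1). intros u _ x _. eexists. apply HD.
    + intros x _. apply continuity_2d_pt_ext with (fun u v => f v u).
      * intros u v. symmetry. apply is_derive_unique, HD.
      * apply Hf'.
    + exists (mkposreal 1 Rlt_0_1). intros u _. now apply ex_RInt_cont.
  - apply (RInt_ext (V := R_CompleteNormedModule)). intros x _. apply is_derive_unique, HD. }
assert (E0 : Phi c = Psi c).
{ unfold Phi, Psi. rewrite (RInt_point (V := R_CompleteNormedModule) c).
  transitivity (RInt (fun _ : R => 0) a b).
  - apply (RInt_ext (V := R_CompleteNormedModule)). intros x _.
    apply (RInt_point (V := R_CompleteNormedModule) c).
  - rewrite (RInt_const (V := R_CompleteNormedModule) a b 0).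
    apply (scal_zero_r (V := R_ModuleSpace)). }
assert (E : Phi d - Psi d = Phi c - Psi c).
{ apply (derive_zero_eq (fun t => Phi t - Psi t) (c - 1) (d + 1)); [lra|lra|].
  intros t _. replace 0 with (minus (g t) (g t)) by (unfold minus; apply (plus_opp_r (G := R_AbelianGroup))).
  apply (is_derive_minus (V := R_NormedModule)); auto. }
change (Phi d = Psi d). lra.
Qed.

Lemma RInt_ge_sub (f : R -> R) (a b p q m : R) : a <= p <= q -> q <= b ->
  (forall x, continuity_pt f x) -> (forall x, a <= x <= b -> 0 <= f x) ->
  (forall x, p <= x <= q -> m <= f x) -> m * (q - p) <= RInt f a b.
Proof.
intros Hap Hqb Hf H0 Hm.
assert (Hex : forall u v, ex_RInt f u v) by (intros; now apply ex_RInt_cont).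
rewrite <- (RInt_Chasles (V := R_CompleteNormedModule) f a q b) by apply Hex.
rewrite <- (RInt_Chasles (V := R_CompleteNormedModule) f a p q) by apply Hex.
assert (A : 0 <= RInt f a p) by (apply RInt_ge_0; [lra|apply Hex|intros; apply H0; lra]).
assert (B : 0 <= RInt f q b) by (apply RInt_ge_0; [lra|apply Hex|intros; apply H0; lra]).
assert (D : m * (q - p) <= RInt f p q).
{ replace (m * (q - p)) with (RInt (fun _ => m) p q).
  - apply RInt_le; [lra|apply ex_RInt_const|apply Hex|intros; apply Hm; lra].
  - rewrite RInt_const. apply Rmult_comm. }
change (m * (q - p) <= RInt f a p + RInt f p q + RInt f q b). lra.
Qed.

(** The integral of the truncated kernel over the direction of u, not divided by 2 pi. It replaces
    the step function of |y| that is 2 pi inside the unit circle and 0 outside. *)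
Definition kmean (d : R) (y : C) : C := CInt (fun t => tkernel d (y * cis (- t))%C) 0 (2 * PI).

Lemma rcont_tkernel_circle (d : R) (y : C) (t : R) : 0 < d -> rcont (fun t => tkernel d (y * cis (- t))%C) t.
Proof.
intros Hd. apply (rcont_comp (tkernel d) (fun t => y * cis (- t))%C); [now apply ccont_tkernel|].
apply rcont_mult; [apply rcont_const|apply rcont_cis_opp].
Qed.

Lemma is_CInt_kmean (d : R) (y : C) : 0 < d ->
  is_CInt (fun t => tkernel d (y * cis (- t))%C) 0 (2 * PI) (kmean d y).
Proof.
intros Hd. apply CInt_correct; [assert (P := PI2_pos); lra|].
intros t _. now apply rcont_tkernel_circle.
Qed.

Lemma ccont_kmean (d : R) (y : C) : 0 < d -> ccont (kmean d) y.
Proof.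
intros Hd e He. assert (HP := PI2_pos).
assert (H3 : 0 < 2 * PI * (3 / d ^ 2)).
{ apply Rmult_lt_0_compat; [lra|]. apply Rdiv_lt_0_compat; [lra|now apply pow_lt]. }
exists (e / (2 * PI * (3 / d ^ 2))). split; [now apply Rdiv_lt_0_compat|].
intros w Hw. apply Rlt_div_r in Hw; [|exact H3].
apply Rle_lt_trans with ((2 * PI - 0) * (3 / d ^ 2 * Cmod (w - y))); [|lra].
apply (is_CInt_bound_const (fun t => tkernel d (w * cis (- t)) - tkernel d (y * cis (- t)))%C 0 (2 * PI)).
- lra.
- intros t _. unfold tkernel. eapply Rle_trans; [now apply tinv_lipschitz|].
  replace (1 - w * cis (- t) - (1 - y * cis (- t)))%C with (- (w - y) * cis (- t))%C by ring.
  rewrite Cmod_mul_cis, Cmod_opp. apply Rle_refl.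
- apply is_CInt_minus; now apply is_CInt_kmean.
Qed.

Lemma kmean_inside (d : R) (y : C) : 0 < d -> Cmod y <= 1 - d -> kmean d y = RtoC (2 * PI).
Proof.
intros Hd Hy. apply is_CInt_unique. assert (HP := PI2_pos).
apply (is_CInt_ext (fun t => / (1 - y * cis (- t)))%C); [lra| |apply mean_cauchy_kernel; lra].
intros t _. symmetry. apply tinv_far; [exact Hd|].
assert (P := Cmod_one_minus (y * cis (- t))). rewrite Cmod_mul_cis in P. lra.
Qed.

Lemma kmean_outside (d : R) (y : C) : 0 < d -> 1 + d <= Cmod y -> kmean d y = 0.
Proof.
intros Hd Hy. assert (HP := PI2_pos). assert (Hy0 : y <> 0) by (apply Cmod_gt_0; lra).
set (y' := (/ Cconj y)%C).
assert (Hyc : Cconj y <> 0) by (apply Cmod_gt_0; rewrite Cmod_conj; lra).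
assert (Hy' : Cmod y' < 1).
{ unfold y'. rewrite Cmod_inv, Cmod_conj by exact Hyc.
  rewrite <- Rinv_1. apply Rinv_lt_contravar; lra. }
assert (H := mean_cauchy_kernel y' Hy').
assert (H1 := is_CInt_fst _ _ _ _ H). assert (H2 := is_CInt_snd _ _ _ _ H).
(* For |y| > 1 and |v| = 1, 1 / (1 - y v^-1) = 1 - conj (1 / (1 - y' v^-1)), y' = 1 / conj y. *)
assert (H3 : is_CInt (fun t => 1 - Cconj (/ (1 - y' * cis (- t))))%C 0 (2 * PI) 0).
{ replace (RtoC 0) with (RtoC (2 * PI - 0) * 1 - Cconj (RtoC (2 * PI)))%C.
  - apply (is_CInt_minus (fun _ => RtoC 1) (fun t => Cconj (/ (1 - y' * cis (- t))))%C).
    + apply is_CInt_const.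
    + apply is_CInt_pair; [exact H1|]. exact (is_RInt_opp _ _ _ _ H2).
  - unfold RtoC, Cconj, Cminus, Cplus, Copp, Cmult; simpl; f_equal; ring. }
apply is_CInt_unique. revert H3. apply is_CInt_ext; [lra|]. intros t _.
assert (Hf : d <= Cmod (1 - y * cis (- t))).
{ assert (P := Cmod_triangle_inv (y * cis (- t)) 1). rewrite Cmod_mul_cis, Cmod_1 in P.
  rewrite Cmod_sub_comm in P. lra. }
unfold tkernel. rewrite tinv_far by assumption.
assert (Hn1 : (1 - y * cis (- t))%C <> 0) by (apply Cmod_gt_0; lra).
assert (Hn2 : (1 - y' * cis (- t))%C <> 0) by (apply one_minus_neq_0; now rewrite Cmod_mul_cis).
rewrite Cinv_conj by exact Hn2.
assert (E : Cconj (1 - y' * cis (- t)) = (1 - / y * cis t)%C).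
{ replace (Cconj (1 - y' * cis (- t))) with (1 - Cconj y' * Cconj (cis (- t)))%C
   by (unfold Cconj, Cminus, Cplus, Copp, Cmult; simpl; f_equal; ring).
  unfold y'. rewrite Cinv_conj, Cconj_conj, cis_conj, Ropp_involutive by exact Hyc. reflexivity. }
rewrite E. rewrite cis_opp in *.
assert (Hc := cis_neq_0 t).
assert (Hn3 : (y - cis t)%C <> 0).
{ intros E3. apply Hn1. replace (y * / cis t)%C with ((y - cis t) * / cis t + 1)%C by (field; exact Hc).
  rewrite E3. ring. }
assert (Hn4 : (cis t - y)%C <> 0).
{ intros E4. apply Hn3. replace (y - cis t)%C with (- (cis t - y))%C by ring. rewrite E4. ring. }
field. auto.
Qed.

(** [tkernel_integral_small] with exchanged roles: the loop is the unit circle and the point is 1 /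
    y, of modulus at most 2. *)
Lemma kmean_annulus (e : R) : 0 < e ->
  exists d0, 0 < d0 /\ forall (d : R) (y : C), 0 < d < d0 -> 1 / 2 <= Cmod y -> Cmod (kmean d y) <= e / d.
Proof.
intros He. assert (HP := PI2_pos).
destruct (tkernel_integral_small (fun t => cis (- t)) 2 e He ltac:(lra) rcont_cis_opp) as [d0 [Hd0 H]].
{ intros s t _ _ E. rewrite !cis_opp in E.
  assert (Hs := cis_neq_0 s). assert (Ht := cis_neq_0 t).
  apply (Cmult_cancel_l (/ cis s * / cis t)).
  - intros E0. assert (E1 : (1 : C) = 0).
    { replace (RtoC 1) with ((/ cis s * / cis t) * (cis s * cis t))%C by (field; auto). rewrite E0. ring. }
    apply RtoC_inj in E1. lra.
  - replace (/ cis s * / cis t * cis s)%C with (/ cis t)%C by (field; auto).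
    replace (/ cis s * / cis t * cis t)%C with (/ cis s)%C by (field; auto). now symmetry. }
exists d0. split; [exact Hd0|]. intros d y Hd Hy.
assert (Hy0 : y <> 0) by (apply Cmod_gt_0; lra).
assert (Hiy : (/ y)%C <> 0).
{ apply Cmod_gt_0. rewrite Cmod_inv by exact Hy0. apply Rinv_0_lt_compat. lra. }
specialize (H d (/ y)%C Hd Hiy).
eapply Rle_trans; [|apply H].
- apply (is_CInt_bound (fun t => tkernel d (y * cis (- t))%C) (fun t => Cmod (tkernel d (cis (- t) / / y)%C)) 0 (2 * PI)).
  + lra.
  + intros t _. replace (cis (- t) / / y)%C with (y * cis (- t))%C by (field; auto). apply Rle_refl.
  + apply is_CInt_kmean. lra.
  + apply (RInt_correct (V := R_CompleteNormedModule)). apply ex_RInt_cont. intros t.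
    apply (rcont_Cmod (fun t => tkernel d (cis (- t) / / y)%C)).
    apply (rcont_comp (tkernel d)); [apply ccont_tkernel; lra|].
    apply rcont_mult; [apply rcont_cis_opp|apply rcont_const].
- rewrite Cmod_inv by exact Hy0. replace 2 with (/ (1 / 2)) by field.
  apply Rinv_le_contravar; lra.
Qed.


(** * Winding numbers smoothed near the curve *)

(** A positive radial profile whose primitive is atan, so that its mass is explicit. *)
Definition lorentz (x : R) : R := / (1 + x ^ 2).

Lemma lorentz_pos (x : R) : 0 < lorentz x.
Proof. apply Rinv_0_lt_compat. assert (P := pow2_ge_0 x). lra. Qed.

Lemma continuity_lorentz (x : R) : continuity_pt lorentz x.
Proof.
apply derivable_continuous_pt. eexists. apply is_derive_Reals. unfold lorentz.
auto_derive; [|reflexivity]. assert (P := pow2_ge_0 x). simpl in P. lra.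
Qed.

(* Up to a constant, an approximate identity in [(s, phi)] at the point where [w = e^s cis phi];
   it pays for the truncation of the kernel near the curve. *)
Definition bump (d : R) (w : C) (s phi : R) : R :=
  lorentz ((ln (Cmod w) - s) / d) *
  (d ^ 2 * / Cmod (1 - (RtoC (1 - d) * (w / Cmod w)) * cis (- phi)) ^ 2).

Lemma Cmod_normalize (w : C) : w <> 0 -> Cmod (w / Cmod w) = 1.
Proof.
intros Hw. assert (Hp := Cmod_0_lt w Hw).
rewrite Cmod_div by (intros E; apply RtoC_inj in E; lra).
rewrite Cmod_R, Rabs_pos_eq by lra. field. lra.
Qed.

Lemma bump_center_lt (d : R) (w : C) (phi : R) : 0 < d < 1 -> w <> 0 ->
  Cmod (RtoC (1 - d) * (w / Cmod w) * cis (- phi)) = 1 - d.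
Proof.
intros Hd Hw. rewrite Cmod_mul_cis, Cmod_mult, Cmod_normalize, Cmod_R, Rabs_pos_eq by (auto; lra). ring.
Qed.

Lemma bump_denom_pos (d : R) (w : C) (phi : R) : 0 < d < 1 -> w <> 0 ->
  0 < Cmod (1 - (RtoC (1 - d) * (w / Cmod w)) * cis (- phi)).
Proof.
intros Hd Hw. apply Cmod_0_lt, one_minus_neq_0. rewrite bump_center_lt; auto; lra.
Qed.

Lemma bump_pos (d : R) (w : C) (s phi : R) : 0 < d < 1 -> w <> 0 -> 0 <= bump d w s phi.
Proof.
intros Hd Hw. apply Rmult_le_pos; [left; apply lorentz_pos|].
apply Rmult_le_pos; [apply pow2_ge_0|]. left. apply Rinv_0_lt_compat, pow_lt. now apply bump_denom_pos.
Qed.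

Lemma is_RInt_bump (d : R) (w : C) (s : R) : 0 < d < 1 -> w <> 0 ->
  is_RInt (bump d w s) 0 (2 * PI) (lorentz ((ln (Cmod w) - s) / d) * (2 * PI * d / (2 - d))).
Proof.
intros Hd Hw. unfold bump.
replace (2 * PI * d / (2 - d)) with (d ^ 2 * (2 * PI / (1 - Cmod (RtoC (1 - d) * (w / Cmod w)) ^ 2))).
- apply (is_RInt_scal (V := R_NormedModule)). apply (is_RInt_scal (V := R_NormedModule)).
  apply is_RInt_poisson. rewrite <- (Cmod_mul_cis _ (- 0)), bump_center_lt; auto; lra.
- rewrite <- (Cmod_mul_cis _ (- 0)), bump_center_lt by auto.
  replace (1 - (1 - d) ^ 2) with (d * (2 - d)) by ring. field. lra.
Qed.

Lemma ln_near_1 (a d : R) : 0 < d <= 1 / 8 -> Rabs (a - 1) < 2 * d -> Rabs (ln a) <= 4 * d.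
Proof.
intros Hd Ha. apply Rabs_def2 in Ha.
assert (G : forall x, 0 < x -> ln x <= x - 1).
{ intros x Hx. assert (P := exp_ineq1_le (ln x)). rewrite exp_ln in P by exact Hx. lra. }
assert (H1 := G a ltac:(lra)). assert (Hia : 0 < / a) by (apply Rinv_0_lt_compat; lra).
assert (H2 := G (/ a) Hia). rewrite ln_Rinv in H2 by lra.
assert (H3 : / a <= 1 + 4 * d).
{ apply (Rmult_le_reg_r a); [lra|]. rewrite Rinv_l by lra. nra. }
apply Rabs_le. lra.
Qed.

(** 425 = 17 * 25. The hypothesis forces |ln |w| - s| <= 4 d, so the radial factor is at least 1 /
    (1 + 4^2); it also bounds the Poisson denominator by 5 d = 2 d + 2 d + d, so the angular factor
    is at least 1 / 5^2. *)
Lemma bump_near (d : R) (w : C) (s phi : R) : 0 < d <= 1 / 8 -> w <> 0 ->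
  Cmod (1 - w * RtoC (exp (- s)) * cis (- phi)) < 2 * d -> / 425 <= bump d w s phi.
Proof.
intros Hd Hw Hx. assert (Hp := Cmod_0_lt w Hw).
set (x := (w * RtoC (exp (- s)) * cis (- phi))%C) in *. set (a := Cmod x).
assert (Ea : a = Cmod w * exp (- s)).
{ unfold a, x. rewrite Cmod_mul_cis, Cmod_mult, Cmod_R, Rabs_pos_eq; [reflexivity|left; apply exp_pos]. }
assert (Hes := exp_pos (- s)).
assert (Ha0 : 0 < a) by (rewrite Ea; now apply Rmult_lt_0_compat).
assert (Ha : Rabs (a - 1) < 2 * d).
{ assert (T1 := Cmod_triangle_inv 1 x). assert (T2 := Cmod_triangle_inv x 1).
  rewrite Cmod_sub_comm in T2. rewrite Cmod_1 in T1, T2. fold a in T1, T2. apply Rabs_def1; lra. }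
assert (Hln : ln (Cmod w) - s = ln a).
{ rewrite Ea, ln_mult, ln_exp by assumption. ring. }
assert (H1 : / 17 <= lorentz ((ln (Cmod w) - s) / d)).
{ rewrite Hln. unfold lorentz. assert (L := ln_near_1 a d Hd Ha).
  apply Rinv_le_contravar; [assert (P := pow2_ge_0 (ln a / d)); lra|].
  assert (Q : Rabs (ln a / d) <= 4).
  { unfold Rdiv. rewrite Rabs_mult, Rabs_inv, (Rabs_pos_eq d) by lra.
    apply (Rmult_le_reg_r d); [lra|]. rewrite Rmult_assoc, Rinv_l, Rmult_1_r by lra. lra. }
  rewrite <- pow2_abs. assert (Q0 := Rabs_pos (ln a / d)). nra. }
set (q := Cmod (1 - (RtoC (1 - d) * (w / Cmod w)) * cis (- phi))).
assert (Hq0 : 0 < q) by (apply bump_denom_pos; auto; lra).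
assert (Hq : q <= 5 * d).
{ unfold q.
  assert (Hwn : RtoC (Cmod w) <> 0) by (intros E; apply RtoC_inj in E; lra).
  assert (Han : RtoC a <> 0) by (intros E; apply RtoC_inj in E; lra).
  assert (Hen : RtoC (exp (- s)) <> 0) by (intros E; apply RtoC_inj in E; lra).
  set (y := (x * RtoC (/ a))%C).
  replace (1 - RtoC (1 - d) * (w / Cmod w) * cis (- phi))%C with ((1 - x) + (x * RtoC (1 - / a)) + d * y)%C.
  - eapply Rle_trans; [apply Cmod_triangle|].
    assert (T := Cmod_triangle (1 - x) (x * RtoC (1 - / a))).
    unfold y. rewrite !Cmod_mult, !Cmod_R in *. fold a in T |- *.
    rewrite (Rabs_pos_eq d), (Rabs_pos_eq (/ a)) by (try (left; apply Rinv_0_lt_compat); lra).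
    rewrite Rinv_r, Rmult_1_r by lra.
    assert (E : a * Rabs (1 - / a) = Rabs (a - 1)).
    { rewrite <- (Rabs_pos_eq a) at 1 by lra. rewrite <- Rabs_mult. f_equal. field. lra. }
    rewrite E in T. lra.
  - unfold y. rewrite RtoC_minus, RtoC_minus, Ea, RtoC_inv, RtoC_mult by nra. unfold x. field. auto. }
unfold bump. fold q.
assert (H2 : / 25 <= d ^ 2 * / q ^ 2).
{ apply (Rmult_le_reg_r (q ^ 2)); [now apply pow_lt|].
  rewrite Rmult_assoc, Rinv_l, Rmult_1_r by (apply pow_nonzero; lra). nra. }
replace (/ 425) with (/ 17 * / 25) by field.
apply Rmult_le_compat; lra.
Qed.

Lemma exp_weight_le (k a s : R) : 0 < k -> a <= s -> exp (- k * s) <= exp (- k * a).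
Proof.
intros Hk Has. destruct (Req_dec a s) as [->|Hne]; [lra|]. left. apply exp_increasing. nra.
Qed.

(** The Lorentz profile of width d has total mass pi d, and the weight is largest at the left
    end. *)
Lemma lorentz_weight (k d sigma a b : R) : 0 < k -> 0 < d -> a <= b ->
  RInt (fun s => exp (- k * s) * lorentz ((sigma - s) / d)) a b <= exp (- k * a) * (PI * d).
Proof.
intros Hk Hd Hab.
assert (H1 : is_RInt (fun s => lorentz ((sigma - s) / d)) a b
   (- d * atan ((sigma - b) / d) - - d * atan ((sigma - a) / d))).
{ apply (is_RInt_derive (V := R_CompleteNormedModule) (fun s => - d * atan ((sigma - s) / d))).
  - intros s _. unfold lorentz. auto_derive; [auto|]. unfold Rsqr. field.
    split; [lra|]. assert (P := pow2_ge_0 (sigma - s)). assert (0 < d ^ 2) by now apply pow_lt.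
    simpl in *. nra.
  - intros s _. apply continuity_pt_filterlim.
    apply (continuity_pt_comp (fun s => (sigma - s) / d) lorentz); [|apply continuity_lorentz].
    continuity_elem. }
apply Rle_trans with (exp (- k * a) * (- d * atan ((sigma - b) / d) - - d * atan ((sigma - a) / d))).
- apply (is_RInt_le (fun s => exp (- k * s) * lorentz ((sigma - s) / d)) (fun s => exp (- k * a) * lorentz ((sigma - s) / d)) a b).
  + exact Hab.
  + apply (RInt_correct (V := R_CompleteNormedModule)). apply ex_RInt_cont. intros s.
    apply continuity_pt_mult.
    * continuity_elem.
    * apply (continuity_pt_comp (fun s => (sigma - s) / d) lorentz); [|apply continuity_lorentz].
      continuity_elem.
  + now apply (is_RInt_scal (V := R_NormedModule)).
  + intros s Hs. apply Rmult_le_compat_r; [left; apply lorentz_pos|]. apply exp_weight_le; lra.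
- apply Rmult_le_compat_l; [left; apply exp_pos|].
  assert (B1 := atan_bound ((sigma - b) / d)). assert (B2 := atan_bound ((sigma - a) / d)). nra.
Qed.

(** For u = e^s cis phi and P dt = dw / (i w), the first term is the truncation of dw / (i w (1 - w
    / u)); its real part integrates to a nonnegative number when u is far from the curve. The second
    term makes up for the truncation when u is close. *)
Definition smoothed_winding (d c : R) (w P : R -> C) (s phi : R) (t : R) : C :=
  (tkernel d (w t * RtoC (exp (- s)) * cis (- phi)) * P t + RtoC (c * bump d (w t) s phi))%C.

Lemma ccont_Cmod (z : C) : ccont (fun v => RtoC (Cmod v)) z.
Proof.
intros e He. exists e. split; [exact He|]. intros w Hw.
rewrite <- RtoC_minus, Cmod_R. eapply Rle_lt_trans; [|exact Hw].
assert (T1 := Cmod_triangle_inv w z). assert (T2 := Cmod_triangle_inv z w).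
rewrite Cmod_sub_comm in T2. apply Rabs_le. lra.
Qed.

Lemma rcont_ln_Cmod (w : R -> C) (t : R) : w t <> 0 -> rcont w t -> rcont (fun t => RtoC (ln (Cmod (w t)))) t.
Proof.
intros H0 Hw. apply rcont_RtoC. apply (continuity_pt_comp (fun t => Cmod (w t)) ln).
- now apply rcont_Cmod.
- apply derivable_continuous_pt. eexists. apply derivable_pt_lim_ln. now apply Cmod_0_lt.
Qed.

Lemma continuity_pt_inv_sq (x : R) : 0 < x -> continuity_pt (fun x => / x ^ 2) x.
Proof.
intros Hx. apply derivable_continuous_pt. eexists. apply is_derive_Reals.
auto_derive; [|reflexivity]. apply Rgt_not_eq. nra.
Qed.

Lemma cont2_smoothed_winding (d c : R) (w P : R -> C) (s : R) : 0 < d < 1 ->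
  (forall t, rcont w t) -> (forall t, rcont P t) -> (forall t, w t <> 0) ->
  cont2 (fun phi t => smoothed_winding d c w P s phi t).
Proof.
intros Hd Hw HP Hw0. apply cont2_plus.
- apply cont2_mult; [|now apply cont2_r].
  apply (cont2_comp (tkernel d)); [intros; apply ccont_tkernel; lra|].
  apply cont2_mult; [|apply cont2_l, rcont_cis_opp].
  apply cont2_r. intros t. apply rcont_mult; [apply Hw|apply rcont_const].
- unfold bump.
  assert (Hv : cont2 (fun phi t => 1 - RtoC (1 - d) * (w t / Cmod (w t)) * cis (- phi))%C).
  { apply cont2_plus; [apply cont2_l; intros; apply rcont_const|].
    apply (cont2_comp Copp).
    - intros x y e He. exists e. split; [exact He|]. intros v Hv.
      match goal with |- Cmod (- v - - ?u) < e => replace (- v - - u)%C with (- (v - u))%C by ring end.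
      now rewrite Cmod_opp.
    - apply cont2_mult; [|apply cont2_l, rcont_cis_opp]. apply cont2_r. intros t.
      apply rcont_mult; [apply rcont_const|]. apply rcont_mult; [apply Hw|].
      assert (Hp := Cmod_0_lt _ (Hw0 t)).
      apply rcont_inv; [intros E; apply RtoC_inj in E; lra|]. apply rcont_RtoC, rcont_Cmod, Hw. }
  assert (HL : forall t, rcont (fun t => RtoC (c * lorentz ((ln (Cmod (w t)) - s) / d) * d ^ 2)) t).
  { intros t. apply rcont_RtoC.
    apply continuity_pt_mult; [|apply continuity_pt_cst].
    apply continuity_pt_mult; [apply continuity_pt_cst|].
    apply (continuity_pt_comp (fun t => (ln (Cmod (w t)) - s) / d) lorentz); [|apply continuity_lorentz].
    apply continuity_pt_mult; [|apply continuity_pt_cst].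
    apply continuity_pt_minus; [|apply continuity_pt_cst].
    apply (rcont_fst (fun t => RtoC (ln (Cmod (w t))))). now apply rcont_ln_Cmod. }
  assert (HQ : cont2 (fun phi t => RtoC (/ (fst (RtoC (Cmod (1 - RtoC (1 - d) * (w t / Cmod (w t)) * cis (- phi))))) ^ 2))).
  { apply (cont2_comp (fun z => RtoC (/ (fst z) ^ 2))).
    - intros phi t. apply (ccont_real (fun x => / x ^ 2)). simpl fst.
      apply continuity_pt_inv_sq. now apply bump_denom_pos.
    - apply (cont2_comp (fun v => RtoC (Cmod v))); [intros; apply ccont_Cmod|exact Hv]. }
  assert (H := cont2_mult _ _ (cont2_r _ HL) HQ).
  intros x y e He. destruct (H x y e He) as [r [Hr Hr']]. exists r. split; [exact Hr|].
  intros x' y' Hx Hy. specialize (Hr' x' y' Hx Hy). simpl fst in Hr'.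
  rewrite <- !RtoC_mult in Hr'. rewrite <- !Rmult_assoc. exact Hr'.
Qed.

(** If |1 - w / u| >= d along the whole curve, the kernel is not truncated and the hypothesis on u
    applies. Otherwise the kernel integral is at least - B e / d, while the bump is at least 1 / 425
    on an interval of t of length e^(s0) d / L; the coefficient is the one for which the two
    balance. *)
Lemma smoothed_winding_nonneg (w P : R -> C) (L B s0 s1 e : R) :
  0 < e -> 0 < L -> 0 < B -> s0 <= s1 ->
  (forall t, rcont w t) -> (forall t, rcont P t) -> (forall t, w t <> 0) ->
  (forall s t, Cmod (w s - w t) <= L * Rabs (s - t)) ->
  (forall s t, 0 <= s <= 2 * PI -> 0 <= t <= 2 * PI -> w s = w t -> cis s = cis t) ->
  (forall t, 0 <= t <= 2 * PI -> Cmod (P t) <= B) ->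
  (forall u : C, u <> 0 -> (forall t, 0 <= t <= 2 * PI -> w t <> u) ->
     0 <= fst (CInt (fun t => P t / (1 - w t / u))%C 0 (2 * PI))) ->
  exists d0, 0 < d0 /\ forall d s phi, 0 < d < d0 -> s0 <= s <= s1 ->
    0 <= RInt (fun t => fst (smoothed_winding d (425 * B * L * exp (- s0) * e / d ^ 2) w P s phi t)) 0 (2 * PI).
Proof.
intros He HL HB Hs01 Hw HP Hw0 Hlip Hinj HPB Hwind. assert (HPI := PI2_pos).
destruct (tkernel_integral_small w (exp s1) e He (exp_pos s1) Hw Hinj) as [d1 [Hd1 Hsmall]].
(* Moving t by at most c0 d moves w by at most d e^(s0) <= d |u|, so 1 - w / u stays below 2 d, as
   [bump_near] requires. *)
set (c0 := exp s0 / L).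
assert (Hc0 : 0 < c0) by (apply Rdiv_lt_0_compat; [apply exp_pos|exact HL]).
exists (Rmin d1 (Rmin (1 / 8) (PI / c0))).
assert (HpiC : 0 < PI / c0) by (apply Rdiv_lt_0_compat; lra).
split; [repeat apply Rmin_glb_lt; lra|].
intros d s phi Hd Hs.
assert (M1 := Rmin_l d1 (Rmin (1 / 8) (PI / c0))). assert (M2 := Rmin_r d1 (Rmin (1 / 8) (PI / c0))).
assert (M3 := Rmin_l (1 / 8) (PI / c0)). assert (M4 := Rmin_r (1 / 8) (PI / c0)).
set (c := 425 * B * L * exp (- s0) * e / d ^ 2).
set (u := (RtoC (exp s) * cis phi)%C).
assert (Hes := exp_pos s).
assert (Hesn : RtoC (exp s) <> 0) by (intros E; apply RtoC_inj in E; lra).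
assert (Hu : u <> 0) by (apply Cmult_neq_0; [exact Hesn|apply cis_neq_0]).
assert (Hum : Cmod u = exp s) by (unfold u; rewrite Cmod_mul_cis, Cmod_R, Rabs_pos_eq; lra).
assert (Hx : forall t, (w t * RtoC (exp (- s)) * cis (- phi) = w t / u)%C).
{ intros t. rewrite exp_Ropp, cis_opp, RtoC_inv by lra. unfold u. field.
  split; [apply cis_neq_0|exact Hesn]. }
assert (Hc : 0 < c).
{ apply Rdiv_lt_0_compat; [|now apply pow_lt].
  assert (E0 := exp_pos (- s0)). repeat apply Rmult_lt_0_compat; lra. }
assert (Hd1' : 0 < d < 1) by lra.
assert (Hcont2 := cont2_smoothed_winding d 1 w P s Hd1' Hw HP Hw0).
set (K := fun t => (tkernel d (w t / u) * P t)%C).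
assert (HKc : forall t, rcont K t).
{ intros t. apply rcont_mult; [|apply HP]. apply (rcont_comp (tkernel d) (fun t => w t / u)%C); [apply ccont_tkernel; lra|].
  apply rcont_mult; [apply Hw|apply rcont_const]. }
assert (Hbc : forall t, continuity_pt (fun t => bump d (w t) s phi) t).
{ intros t. apply (continuity_pt_ext (fun t => fst (smoothed_winding d 1 w P s phi t - K t)%C)).
  - intros v. unfold smoothed_winding, K. rewrite Hx. unfold Cminus, Cplus, Copp, RtoC; simpl. ring.
  - apply rcont_fst. apply rcont_minus; [|apply HKc]. intros x Hxp.
    destruct (Hcont2 phi t x Hxp) as [r [Hr Hr']]. exists r. split; [exact Hr|].
    intros y Hy. apply Hr'; [rewrite Rminus_diag, Rabs_R0; exact Hr|exact Hy]. }
assert (HK : is_RInt (fun t => fst (K t)) 0 (2 * PI) (fst (CInt K 0 (2 * PI)))).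
{ apply is_CInt_fst, CInt_correct; [lra|]. intros t _. apply HKc. }
assert (Hb := RInt_correct (V := R_CompleteNormedModule) _ 0 (2 * PI) (ex_RInt_cont _ 0 (2 * PI) Hbc)).
set (Ib := RInt (fun t => bump d (w t) s phi) 0 (2 * PI)) in *.
assert (Hsum := is_RInt_plus (V := R_NormedModule) _ _ _ _ _ _ HK (is_RInt_scal (V := R_NormedModule) _ _ _ c _ Hb)).
replace (RInt _ 0 (2 * PI)) with (fst (CInt K 0 (2 * PI)) + c * Ib).
2:{ symmetry. apply (is_RInt_unique (V := R_CompleteNormedModule)). revert Hsum. apply is_RInt_ext.
    intros t _. unfold smoothed_winding. rewrite Hx. reflexivity. }
assert (HIb0 : 0 <= Ib).
{ apply RInt_ge_0; [lra|now apply ex_RInt_cont|]. intros t _. now apply bump_pos. }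
destruct (classic (exists t0, 0 <= t0 <= 2 * PI /\ Cmod (1 - w t0 / u) < d)) as [[t0 [Ht0 Hnear]]|Hfar].
- assert (HIK : Rabs (fst (CInt K 0 (2 * PI))) <= B * (e / d)).
  { eapply Rle_trans; [apply Rabs_fst_le|].
    apply Rle_trans with (B * RInt (fun t => Cmod (tkernel d (w t / u))) 0 (2 * PI)).
    - apply (is_CInt_bound K (fun t => B * Cmod (tkernel d (w t / u))) 0 (2 * PI)).
      + lra.
      + intros t Ht. unfold K. rewrite Cmod_mult, Rmult_comm.
        apply Rmult_le_compat_r; [apply Cmod_ge_0|now apply HPB].
      + apply CInt_correct; [lra|]. intros t _. apply HKc.
      + apply (is_RInt_scal (V := R_NormedModule)). apply (RInt_correct (V := R_CompleteNormedModule)).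
        apply ex_RInt_cont. intros t. apply (rcont_Cmod (fun t => tkernel d (w t / u))).
        apply (rcont_comp (tkernel d) (fun t => w t / u)%C); [apply ccont_tkernel; lra|].
        apply rcont_mult; [apply Hw|apply rcont_const].
    - apply Rmult_le_compat_l; [lra|]. apply Hsmall; [lra|exact Hu|]. rewrite Hum.
      destruct (Req_dec s s1) as [->|Hne]; [lra|left; apply exp_increasing; lra]. }
  assert (Hcd : 0 < c0 * d <= PI).
  { split; [now apply Rmult_lt_0_compat|]. rewrite Rmult_comm.
    apply (Rmult_le_reg_r (/ c0)); [now apply Rinv_0_lt_compat|].
    rewrite Rmult_assoc, Rinv_r, Rmult_1_r by lra. unfold Rdiv in M4. lra. }
  assert (Hloc : forall t, Rabs (t - t0) <= c0 * d -> / 425 <= bump d (w t) s phi).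
  { intros t Ht. apply bump_near; [lra|apply Hw0|]. rewrite Hx.
    replace (1 - w t / u)%C with ((1 - w t0 / u) - (w t - w t0) / u)%C by (field; exact Hu).
    eapply Rle_lt_trans; [apply Cmod_triangle|]. rewrite Cmod_opp, Cmod_div, Hum by exact Hu.
    assert (Q : Cmod (w t - w t0) / exp s <= d); [|lra].
    apply Rle_div_l; [exact Hes|]. eapply Rle_trans; [apply Hlip|].
    apply Rle_trans with (L * (c0 * d)); [apply Rmult_le_compat_l; lra|].
    replace (L * (c0 * d)) with (d * exp s0) by (unfold c0; field; lra).
    apply Rmult_le_compat_l; [lra|].
    destruct (Req_dec s0 s) as [->|Hne]; [lra|left; apply exp_increasing; lra]. }
  assert (HIb : / 425 * (c0 * d) <= Ib).
  (* The interval of length c0 d is taken on the side of t0 that has room inside [0, 2 pi]; c0 d <=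
     pi guarantees one. *)
  { destruct (Rle_dec t0 PI) as [Ht|Ht].
    - replace (/ 425 * (c0 * d)) with (/ 425 * ((t0 + c0 * d) - t0)) by ring.
      apply RInt_ge_sub; [lra|lra|exact Hbc| |].
      + intros t _. now apply bump_pos.
      + intros t Ht'. apply Hloc. rewrite Rabs_pos_eq; lra.
    - replace (/ 425 * (c0 * d)) with (/ 425 * (t0 - (t0 - c0 * d))) by ring.
      apply RInt_ge_sub; [lra|lra|exact Hbc| |].
      + intros t _. now apply bump_pos.
      + intros t Ht'. apply Hloc. apply Rabs_le. lra. }
  apply Rmult_le_compat_l with (r := c) in HIb; [|lra].
  replace (c * (/ 425 * (c0 * d))) with (B * (e / d)) in HIb.
  + apply Rabs_le_between in HIK. lra.
  + unfold c, c0. rewrite exp_Ropp. assert (E0 := exp_pos s0). field. lra.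
- assert (Hall : forall t, 0 <= t <= 2 * PI -> d <= Cmod (1 - w t / u)).
  { intros t Ht. apply Rnot_lt_le. intros Hlt. apply Hfar. now exists t. }
  replace (CInt K 0 (2 * PI)) with (CInt (fun t => P t / (1 - w t / u))%C 0 (2 * PI)).
  + apply Rplus_le_le_0_compat; [|apply Rmult_le_pos; lra].
    apply Hwind; [exact Hu|]. intros t Ht E. specialize (Hall t Ht). rewrite E in Hall.
    replace (1 - u / u)%C with (RtoC 0) in Hall by (field; exact Hu). rewrite Cmod_0 in Hall. lra.
  + symmetry. apply is_CInt_unique. 
    apply (is_CInt_ext (fun t => P t / (1 - w t / u))%C); [lra| |].
    * intros t Ht. unfold K, tkernel. rewrite tinv_far by (auto; lra). unfold Cdiv. ring.
    * apply CInt_correct; [lra|]. intros t Ht. apply rcont_mult; [apply HP|].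
      apply rcont_inv; [apply Cmod_gt_0; specialize (Hall t Ht); lra|].
      apply rcont_minus; [apply rcont_const|]. apply rcont_mult; [apply Hw|apply rcont_const].
Qed.


(** * The area theorem in integral form *)

Lemma rcont_exp_lin (k s : R) : rcont (fun s => RtoC (exp (k * s))) s.
Proof.
apply rcont_RtoC. continuity_elem.
Qed.

Lemma rcont_scaled_exp (v : C) (s : R) : rcont (fun s => v * RtoC (exp (- s)))%C s.
Proof.
apply rcont_mult; [apply rcont_const|].
apply rcont_RtoC. continuity_elem.
Qed.

Lemma is_CInt_exp_weight (k a b : R) : 0 < k -> a <= b ->
  is_CInt (fun s => RtoC (exp (- k * s))) a b (RtoC ((exp (- k * a) - exp (- k * b)) / k)).
Proof.
intros Hk Hab.
replace (RtoC ((exp (- k * a) - exp (- k * b)) / k)) with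
 (RtoC (- / k * exp (- k * b)) - RtoC (- / k * exp (- k * a)))%C.
- apply (is_CInt_derive (fun s => RtoC (- / k * exp (- k * s)))); [exact Hab| | |].
  + intros t _. simpl. auto_derive; [auto|]. field. lra.
  + intros t _. simpl. apply (is_derive_const (K := R_AbsRing) (V := R_NormedModule)).
  + intros t _. apply rcont_exp_lin.
- rewrite <- RtoC_minus. f_equal. field. lra.
Qed.

(** With sigma = ln |v|, the mean is 0 for s < sigma - 2 d and 2 pi for s > sigma + 2 d, so the
    integral is about 2 pi times that of e^(-k s) from sigma to s1. The window of length 4 d costs 4
    d (e / d), and moving the lower limit by 2 d costs 4 pi d. *)
Lemma kmean_weight (k d e s0 s1 : R) (v : C) : 0 < k -> 0 < e -> 0 < d <= 1 / 4 -> v <> 0 ->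
  s0 + 1 <= ln (Cmod v) <= s1 - 1 ->
  (forall y, 1 / 2 <= Cmod y -> Cmod (kmean d y) <= e / d) ->
  Cmod (CInt (fun s => RtoC (exp (- k * s)) * kmean d (v * RtoC (exp (- s))))%C s0 s1 -
     RtoC (2 * PI * ((exp (- k * ln (Cmod v)) - exp (- k * s1)) / k))) <=
  exp (- k * s0) * (4 * e + 4 * PI * d).
Proof.
intros Hk He Hd Hv Hs Hann. assert (HPI := PI2_pos).
set (sg := ln (Cmod v)) in *. assert (Hvp := Cmod_0_lt v Hv).
assert (Hy : forall s, Cmod (v * RtoC (exp (- s))) = exp (sg - s)).
{ intros s. rewrite Cmod_mult, Cmod_R, Rabs_pos_eq by (left; apply exp_pos).
  unfold Rminus. rewrite exp_plus. unfold sg. now rewrite exp_ln. }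
set (F := fun s => (RtoC (exp (- k * s)) * kmean d (v * RtoC (exp (- s))))%C).
assert (HF : forall s, rcont F s).
{ intros s. apply rcont_mult; [apply rcont_exp_lin|].
  apply (rcont_comp (kmean d)); [apply ccont_kmean; lra|apply rcont_scaled_exp]. }
assert (I1 : is_CInt F s0 (sg - 2 * d) 0).
{ apply (is_CInt_ext (fun _ => RtoC 0)); [lra| |].
  - intros s Hs'. unfold F. rewrite kmean_outside; [ring|lra|]. rewrite Hy.
    assert (P := exp_ineq1_le (sg - s)). lra.
  - assert (P := is_CInt_const 0 s0 (sg - 2 * d)). now rewrite Cmult_0_r in P. }
set (a := sg - 2 * d) in *. set (b := sg + 2 * d).
assert (I2 : is_CInt F a b (CInt F a b)).
{ apply CInt_correct; [unfold a, b; lra|]. intros s _. apply HF. }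
assert (I3 : is_CInt F b s1 (RtoC (2 * PI) * RtoC ((exp (- k * b) - exp (- k * s1)) / k))%C).
{ apply (is_CInt_ext (fun s => RtoC (2 * PI) * RtoC (exp (- k * s)))%C); [unfold b; lra| |].
  - intros s Hs'. unfold F. rewrite kmean_inside; [ring|lra|]. rewrite Hy.
    assert (P := exp_ineq1_le (s - sg)). replace (sg - s) with (- (s - sg)) by ring. rewrite exp_Ropp.
    unfold b in Hs'.
    apply Rle_trans with (/ (1 + 2 * d)); [apply Rinv_le_contravar; lra|].
    apply (Rmult_le_reg_r (1 + 2 * d)); [lra|]. rewrite Rinv_l by lra. nra.
  - apply is_CInt_scal, is_CInt_exp_weight; [exact Hk|unfold b; lra]. }
assert (Itot := is_CInt_unique _ _ _ _ (is_CInt_Chasles _ _ _ _ _ _ (is_CInt_Chasles _ _ _ _ _ _ I1 I2) I3)).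
fold F. rewrite Itot.
assert (HW := exp_pos (- k * s0)).
assert (B2 : Cmod (CInt F a b) <= exp (- k * s0) * (4 * e)).
{ replace (exp (- k * s0) * (4 * e)) with ((b - a) * (exp (- k * s0) * (e / d)))
    by (unfold a, b; field; lra).
  apply (is_CInt_bound_const F a b); [unfold a, b; lra| |exact I2].
  intros s Hs'. unfold F. rewrite Cmod_mult, Cmod_R, Rabs_pos_eq by (left; apply exp_pos).
  apply Rmult_le_compat; [left; apply exp_pos|apply Cmod_ge_0| |].
  - apply exp_weight_le; [exact Hk|]. unfold a in Hs'. lra.
  - apply Hann. rewrite Hy. assert (P := exp_ineq1_le (sg - s)). unfold b in Hs'. lra. }
assert (B3 : Rabs (2 * PI * ((exp (- k * b) - exp (- k * sg)) / k)) <= exp (- k * s0) * (4 * PI * d)).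
{ assert (E : exp (- k * b) = exp (- k * sg) * exp (- (2 * k * d))).
  { rewrite <- exp_plus. f_equal. unfold b. ring. }
  assert (P := exp_ineq1_le (- (2 * k * d))).
  assert (P2 : exp (- (2 * k * d)) <= 1).
  { rewrite <- exp_0. left. apply exp_increasing. nra. }
  assert (P3 : exp (- k * sg) <= exp (- k * s0)) by (apply exp_weight_le; lra).
  assert (P4 := exp_pos (- k * sg)).
  replace (2 * PI * ((exp (- k * b) - exp (- k * sg)) / k)) with
    (- (2 * PI * (exp (- k * sg) * ((1 - exp (- (2 * k * d))) / k)))) by (rewrite E; field; lra).
  rewrite Rabs_Ropp.
  assert (P5 : 0 <= (1 - exp (- (2 * k * d))) / k) by (apply Rdiv_le_0_compat; lra).
  assert (P6 : (1 - exp (- (2 * k * d))) / k <= 2 * d) by (apply Rle_div_l; lra).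
  rewrite Rabs_pos_eq by (apply Rmult_le_pos; [lra|apply Rmult_le_pos; lra]).
  replace (exp (- k * s0) * (4 * PI * d)) with (2 * PI * (exp (- k * s0) * (2 * d))) by ring.
  apply Rmult_le_compat_l; [lra|]. apply Rmult_le_compat; lra. }
replace (0 + CInt F a b + RtoC (2 * PI) * RtoC ((exp (- k * b) - exp (- k * s1)) / k) -
   RtoC (2 * PI * ((exp (- k * sg) - exp (- k * s1)) / k)))%C
 with (CInt F a b + RtoC (2 * PI * ((exp (- k * b) - exp (- k * sg)) / k)))%C.
- eapply Rle_trans; [apply Cmod_triangle|]. rewrite Cmod_R. lra.
- rewrite <- RtoC_mult.
  replace (2 * PI * ((exp (- k * b) - exp (- k * sg)) / k)) with
   (2 * PI * ((exp (- k * b) - exp (- k * s1)) / k) - 2 * PI * ((exp (- k * sg) - exp (- k * s1)) / k)) by (field; lra).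
  rewrite RtoC_minus. ring.
Qed.

(* With [P dt = dw / (i w)], the integral is that of [|w|^(-k) d(arg w)]; by Green's formula it
   is [k] times the integral of [|u|^(-k-2)] over the region outside the curve. *)
Theorem area_theorem_integral (k L : R) (w P : R -> C) : 0 < k -> 0 < L ->
  (forall t, rcont w t) -> (forall t, rcont P t) -> (forall t, w t <> 0) ->
  (forall s t, Cmod (w s - w t) <= L * Rabs (s - t)) ->
  (forall s t, 0 <= s <= 2 * PI -> 0 <= t <= 2 * PI -> w s = w t -> cis s = cis t) ->
  (forall u : C, u <> 0 -> (forall t, 0 <= t <= 2 * PI -> w t <> u) ->
     0 <= fst (CInt (fun t => P t / (1 - w t / u))%C 0 (2 * PI))) ->
  0 <= fst (CInt P 0 (2 * PI)) ->
  0 <= RInt (fun t => exp (- k * ln (Cmod (w t))) * fst (P t)) 0 (2 * PI).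
Proof.
intros Hk HL Hw HP Hw0 Hlip Hinj Hwind HP0. assert (HPI := PI2_pos).
destruct (rcont_bounded w 0 (2 * PI)) as [Mx [HMx HMx']]; [lra|intros t _; apply Hw|].
destruct (rcont_bounded (fun t => / w t)%C 0 (2 * PI)) as [Mi [HMi HMi']];
  [lra|intros t _; now apply rcont_inv|].
destruct (rcont_bounded P 0 (2 * PI)) as [B' [HB' HB'']]; [lra|intros t _; apply HP|].
set (B := B' + 1). assert (HB : 0 < B) by (unfold B; lra).
assert (HPB : forall t, 0 <= t <= 2 * PI -> Cmod (P t) <= B).
{ intros t Ht. specialize (HB'' t Ht). unfold B. lra. }
set (sg := fun t => ln (Cmod (w t))).
(* A range of ln |u| containing all ln |w t| with margin 1, as [kmean_weight] needs. The maximum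
   with s0 keeps s0 <= s1 evident. *)
set (s0 := - ln (Mi + 1) - 1). set (s1 := Rmax (ln (Mx + 1)) s0 + 2).
assert (Hsg : forall t, 0 <= t <= 2 * PI -> s0 + 1 <= sg t <= s1 - 1).
{ intros t Ht. assert (Hp := Cmod_0_lt _ (Hw0 t)). unfold sg. split.
  - unfold s0. replace (- ln (Mi + 1) - 1 + 1) with (- ln (Mi + 1)) by ring.
    rewrite <- ln_Rinv by lra. apply ln_le; [apply Rinv_0_lt_compat; lra|].
    specialize (HMi' t Ht). rewrite Cmod_inv in HMi' by apply Hw0.
    rewrite <- (Rinv_inv (Cmod (w t))). apply Rinv_le_contravar; [now apply Rinv_0_lt_compat|lra].
  - assert (A1 : ln (Cmod (w t)) <= ln (Mx + 1)).
    { apply ln_le; [exact Hp|]. specialize (HMx' t Ht). lra. }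
    assert (A2 := Rmax_l (ln (Mx + 1)) s0). unfold s1. lra. }
assert (Hs01 : s0 <= s1) by (assert (A2 := Rmax_r (ln (Mx + 1)) s0); unfold s1; lra).
clearbody s0 s1.
set (W := exp (- k * s0)). assert (HW : 0 < W) by apply exp_pos.
set (C1 := 425 * B * L * exp (- s0)).
assert (HC1 : 0 < C1).
{ assert (E0 := exp_pos (- s0)). unfold C1. repeat apply Rmult_lt_0_compat; lra. }
(* 2 pi times the integral of e^(-k s) over [sg t, s1]: what the untruncated kernel would give after
   integration over phi and s. In polar coordinates |u|^(-k-2) times the area element is e^(-k s) ds
   dphi. *)
set (V := fun t => 2 * PI * ((exp (- k * sg t) - exp (- k * s1)) / k)).
assert (Hsgc : forall t, continuity_pt sg t).
{ intros t. apply (rcont_fst (fun t => RtoC (ln (Cmod (w t))))). now apply rcont_ln_Cmod. }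
assert (Hexpc : forall t, continuity_pt (fun t => exp (- k * sg t)) t).
{ intros t. apply (continuity_pt_comp sg (fun x => exp (- k * x))); [apply Hsgc|].
  continuity_elem. }
assert (HPc : forall t, continuity_pt (fun t => fst (P t)) t) by (intros; now apply rcont_fst).
set (Q := B * W * (4 + 4 * PI) + 2 * PI ^ 2 * C1 * W).
assert (HQ : 0 < Q).
{ unfold Q. apply Rplus_lt_0_compat.
  { apply Rmult_lt_0_compat; [|lra]. now apply Rmult_lt_0_compat. }
  assert (0 < PI ^ 2) by (apply pow_lt; lra).
  apply Rmult_lt_0_compat; [|exact HW]. apply Rmult_lt_0_compat; [lra|exact HC1]. }
set (X := RInt (fun t => fst (P t) * V t) 0 (2 * PI)).
assert (HVc : forall t, continuity_pt (fun t => fst (P t) * V t) t).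
{ intros t. apply continuity_pt_mult; [apply HPc|]. unfold V.
  apply continuity_pt_mult; [apply continuity_pt_cst|].
  apply continuity_pt_mult; [|apply continuity_pt_cst].
  apply continuity_pt_minus; [apply Hexpc|apply continuity_pt_cst]. }
(* The smoothed windings, nonnegative for each (s, phi), are integrated over phi and over s with
   weight e^(-k s); with the t-integral moved outermost, the result is at most X plus the errors.
   [Q] does not depend on e, so e can tend to 0 afterwards. *)
assert (Hmain : forall e, 0 < e < 1 -> 0 <= X + 2 * PI * (Q * e)).
{ intros e He.
  destruct (smoothed_winding_nonneg w P L B s0 s1 e) as [dA [HdA HA]]; auto; [lra|].
  destruct (kmean_annulus e) as [dB [HdB HBd]]; [lra|].
  set (d0 := Rmin (Rmin dA dB) (Rmin (1 / 4) e)).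
  assert (Hd0 : 0 < d0) by (apply Rmin_glb_lt; apply Rmin_glb_lt; lra).
  assert (m1 := Rmin_l (Rmin dA dB) (Rmin (1 / 4) e)). assert (m2 := Rmin_r (Rmin dA dB) (Rmin (1 / 4) e)).
  assert (m3 := Rmin_l dA dB). assert (m4 := Rmin_r dA dB).
  assert (m5 := Rmin_l (1 / 4) e). assert (m6 := Rmin_r (1 / 4) e). fold d0 in m1, m2.
  clearbody d0. set (d := d0 / 2). assert (Hd : 0 < d < d0) by (unfold d; lra). clearbody d.
  set (c := C1 * e / d ^ 2).
  assert (Hc : 0 < c) by (apply Rdiv_lt_0_compat; [apply Rmult_lt_0_compat; lra|apply pow_lt; lra]).
  set (Kd := 2 * PI * d / (2 - d)).
  assert (HKd : 0 <= Kd <= 2 * PI * d).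
  { assert (Hpd : 0 <= 2 * PI * d) by (apply Rmult_le_pos; lra).
    split; [apply Rdiv_le_0_compat; lra|]. apply Rle_div_l; [lra|].
    rewrite <- (Rmult_1_r (2 * PI * d)) at 1. apply Rmult_le_compat_l; lra. }
  set (N := fun s t => fst (kmean d (w t * RtoC (exp (- s))) * P t)%C + c * (lorentz ((sg t - s) / d) * Kd)).
  assert (Hphi : forall s t, RInt (fun phi => fst (smoothed_winding d c w P s phi t)) 0 (2 * PI) = N s t).
  { intros s t. apply (is_RInt_unique (V := R_CompleteNormedModule)).
    assert (J1 := is_CInt_fst _ _ _ _ (is_CInt_scal (P t) _ _ _ _ (is_CInt_kmean d (w t * RtoC (exp (- s))) ltac:(lra)))).
    assert (J2 := is_RInt_scal _ _ _ c _ (is_RInt_bump d (w t) s ltac:(lra) (Hw0 t))).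
    assert (J3 := is_RInt_plus _ _ _ _ _ _ J1 J2).
    replace (N s t) with (plus (fst (P t * kmean d (w t * RtoC (exp (- s))))%C)
       (scal c (lorentz ((ln (Cmod (w t)) - s) / d) * (2 * PI * d / (2 - d))))).
    - revert J3. apply is_RInt_ext. intros phi _. unfold smoothed_winding.
      rewrite (Cmult_comm (tkernel _ _)). reflexivity.
    - unfold N. rewrite (Cmult_comm (kmean _ _)). reflexivity. }
  assert (HN : forall s, s0 <= s <= s1 -> 0 <= RInt (fun t => N s t) 0 (2 * PI)).
  { intros s Hs. 
    rewrite (RInt_ext (V := R_CompleteNormedModule) (fun t => N s t) (fun t => RInt (fun phi => fst (smoothed_winding d c w P s phi t)) 0 (2 * PI)))
      by (intros t _; symmetry; apply Hphi).
    rewrite <- (fubini (fun phi t => fst (smoothed_winding d c w P s phi t))).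
    - apply RInt_ge_0; [lra| |].
      + apply ex_RInt_cont. intros phi. apply (continuity_RInt_param (fun phi t => fst (smoothed_winding d c w P s phi t))); [lra|].
        intros x y. apply (cont2_fst (fun phi t => smoothed_winding d c w P s phi t)).
        apply cont2_smoothed_winding; auto; lra.
      + intros phi _. apply HA; lra.
    - lra.
    - lra.
    - intros x y. apply (cont2_fst (fun phi t => smoothed_winding d c w P s phi t)).
      apply cont2_smoothed_winding; auto; lra. }
  set (G := fun s t => (RtoC (exp (- k * s)) * (kmean d (w t * RtoC (exp (- s))) * P t +
      RtoC (c * (lorentz ((sg t - s) / d) * Kd))))%C).
  assert (HG : cont2 G).
  { apply cont2_mult; [apply (cont2_l (fun s => RtoC (exp (- k * s)))); intros; apply rcont_exp_lin|].
    apply cont2_plus.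
    - apply cont2_mult; [|apply (cont2_r P), HP]. apply (cont2_comp (kmean d)); [intros; apply ccont_kmean; lra|].
      apply cont2_mult; [apply (cont2_r w), Hw|]. apply (cont2_l (fun s => RtoC (exp (- s)))).
      intros s. apply rcont_RtoC. continuity_elem.
    - assert (Hl : cont2 (fun s t => RtoC (c * (lorentz (fst ((RtoC (sg t) + RtoC (- s)) * RtoC (/ d))%C) * Kd)))).
      { apply (cont2_comp (fun z => RtoC (c * (lorentz (fst z) * Kd)))).
        - intros s t. apply (ccont_real (fun x => c * (lorentz x * Kd))).
          apply continuity_pt_mult; [apply continuity_pt_cst|].
          apply continuity_pt_mult; [apply continuity_lorentz|apply continuity_pt_cst].
        - apply cont2_mult; [|apply cont2_l; intros; apply rcont_const].
          apply cont2_plus; [apply (cont2_r (fun t => RtoC (sg t))); intros; apply rcont_RtoC, Hsgc|].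
          apply (cont2_l (fun s => RtoC (- s))). intros s. apply rcont_RtoC.
          apply (continuity_pt_opp id), continuity_pt_id. }
      intros x y r Hr. destruct (Hl x y r Hr) as [q [Hq Hq']]. exists q. split; [exact Hq|].
      intros x' y' Hx Hy. specialize (Hq' x' y' Hx Hy).
      replace ((sg y' - x') / d) with (fst ((RtoC (sg y') + RtoC (- x')) * RtoC (/ d))%C) by (simpl; unfold Rdiv; ring).
      replace ((sg y - x) / d) with (fst ((RtoC (sg y) + RtoC (- x)) * RtoC (/ d))%C) by (simpl; unfold Rdiv; ring).
      exact Hq'. }
  assert (HGN : forall s t, fst (G s t) = exp (- k * s) * N s t).
  { intros s t. unfold G, N, RtoC, Cmult, Cplus; simpl. ring. }
  assert (HG2 : forall s t, continuity_2d_pt (fun s t => fst (G s t)) s t) by (intros; now apply cont2_fst).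
  assert (HNc : forall s t, continuity_pt (fun t => N s t) t).
  { intros s t. apply (continuity_pt_ext (fun t => exp (k * s) * fst (G s t))).
    - intros u. rewrite HGN. rewrite <- Rmult_assoc, <- exp_plus.
      replace (k * s + - k * s) with 0 by ring. rewrite exp_0. ring.
    - apply continuity_pt_mult; [apply continuity_pt_cst|].
      apply (continuity_2d_pt_l (fun t s => fst (G s t))). apply continuity_2d_pt_swap, HG2. }
  assert (HGpos : 0 <= RInt (fun t => RInt (fun s => fst (G s t)) s0 s1) 0 (2 * PI)).
  { rewrite <- (fubini (fun s t => fst (G s t))) by (auto; lra).
    apply RInt_ge_0; [exact Hs01| |].
    - apply ex_RInt_cont. intros s. apply (continuity_RInt_param (fun s t => fst (G s t))); [lra|apply HG2].
    - intros s Hs. replace (RInt (fun t => fst (G s t)) 0 (2 * PI)) with (exp (- k * s) * RInt (fun t => N s t) 0 (2 * PI)).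
      2:{ symmetry. apply (is_RInt_unique (V := R_CompleteNormedModule)).
          apply (is_RInt_ext (fun t => scal (exp (- k * s)) (N s t))); [intros t _; symmetry; apply HGN|].
          apply (is_RInt_scal (V := R_NormedModule)). apply (RInt_correct (V := R_CompleteNormedModule)).
          apply ex_RInt_cont, HNc. }
      apply Rmult_le_pos; [left; apply exp_pos|apply HN; lra]. }
  assert (Hbound : forall t, 0 <= t <= 2 * PI -> RInt (fun s => fst (G s t)) s0 s1 <= fst (P t) * V t + Q * e).
  { intros t Ht.
    set (F := fun s => (RtoC (exp (- k * s)) * kmean d (w t * RtoC (exp (- s))))%C).
    assert (HFc : forall s, rcont F s).
    { intros s. apply rcont_mult; [apply rcont_exp_lin|].
      apply (rcont_comp (kmean d)); [apply ccont_kmean; lra|apply rcont_scaled_exp]. }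
    assert (HJ := kmean_weight k d e s0 s1 (w t) Hk ltac:(lra) ltac:(lra) (Hw0 t) (Hsg t Ht)
      (fun y Hy => HBd d y ltac:(lra) Hy)).
    fold F in HJ. change (ln (Cmod (w t))) with (sg t) in HJ. fold (V t) in HJ. fold W in HJ.
    assert (Hlc : forall s, continuity_pt (fun s => exp (- k * s) * lorentz ((sg t - s) / d)) s).
    { intros s. apply continuity_pt_mult.
      - continuity_elem.
      - apply (continuity_pt_comp (fun s => (sg t - s) / d) lorentz); [|apply continuity_lorentz].
        continuity_elem. }
    assert (J1 := is_CInt_fst _ _ _ _ (is_CInt_scal (P t) F s0 s1 _ (CInt_correct F s0 s1 Hs01 (fun s _ => HFc s)))).
    assert (J2 := is_RInt_scal _ _ _ (c * Kd) _ (RInt_correct (V := R_CompleteNormedModule) _ _ _ (ex_RInt_cont _ s0 s1 Hlc))).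
    assert (J3 := is_RInt_plus _ _ _ _ _ _ J1 J2).
    replace (RInt (fun s => fst (G s t)) s0 s1) with
      (fst (P t * CInt F s0 s1)%C + c * Kd * RInt (fun s => exp (- k * s) * lorentz ((sg t - s) / d)) s0 s1).
    2:{ symmetry. apply (is_RInt_unique (V := R_CompleteNormedModule)). revert J3. apply is_RInt_ext.
        intros s _. rewrite HGN. unfold N, F.
        change (fst (P t * (RtoC (exp (- k * s)) * kmean d (w t * RtoC (exp (- s)))))%C +
          c * Kd * (exp (- k * s) * lorentz ((sg t - s) / d)) =
          exp (- k * s) * (fst (kmean d (w t * RtoC (exp (- s))) * P t)%C + c * (lorentz ((sg t - s) / d) * Kd))).
        destruct (kmean d (w t * RtoC (exp (- s)))), (P t). unfold RtoC, Cmult; simpl. ring. }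
    assert (A1 : fst (P t * CInt F s0 s1)%C <= fst (P t) * V t + B * (W * (4 * e + 4 * PI * d))).
    { replace (P t * CInt F s0 s1)%C with (P t * RtoC (V t) + P t * (CInt F s0 s1 - RtoC (V t)))%C by ring.
      assert (A2 : Rabs (fst (P t * (CInt F s0 s1 - RtoC (V t)))%C) <= B * (W * (4 * e + 4 * PI * d))).
      { eapply Rle_trans; [apply Rabs_fst_le|]. rewrite Cmod_mult.
        apply Rmult_le_compat; try apply Cmod_ge_0; [now apply HPB|exact HJ]. }
      apply Rabs_le_between in A2.
      change (fst (P t * RtoC (V t))%C + fst (P t * (CInt F s0 s1 - RtoC (V t)))%C <= fst (P t) * V t + B * (W * (4 * e + 4 * PI * d))).
      replace (fst (P t * RtoC (V t))%C) with (fst (P t) * V t) by (unfold RtoC, Cmult; simpl; ring). lra. }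
    assert (A3 : c * Kd * RInt (fun s => exp (- k * s) * lorentz ((sg t - s) / d)) s0 s1 <= c * (2 * PI * d) * (W * (PI * d))).
    { apply Rmult_le_compat.
      - apply Rmult_le_pos; lra.
      - apply RInt_ge_0; [exact Hs01|now apply ex_RInt_cont|]. intros s _.
        apply Rmult_le_pos; left; [apply exp_pos|apply lorentz_pos].
      - apply Rmult_le_compat_l; lra.
      - apply lorentz_weight; lra. }
    (* The bump has mass of order d in phi and again in s, which cancels the d^2 in the denominator
       of [c]. *)
    replace (c * (2 * PI * d) * (W * (PI * d))) with (2 * PI ^ 2 * C1 * W * e) in A3 by (unfold c; field; lra).
    assert (A4 : B * (W * (4 * e + 4 * PI * d)) <= B * W * (4 + 4 * PI) * e).
    { replace (B * W * (4 + 4 * PI) * e) with (B * (W * (4 * e + 4 * PI * e))) by ring.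
      apply Rmult_le_compat_l; [lra|]. apply Rmult_le_compat_l; [lra|].
      assert (PI * d <= PI * e) by (apply Rmult_le_compat_l; lra). lra. }
    unfold Q. lra. }
  eapply Rle_trans; [exact HGpos|].
  apply (is_RInt_le (fun t => RInt (fun s => fst (G s t)) s0 s1) (fun t => fst (P t) * V t + Q * e) 0 (2 * PI)).
  - lra.
  - apply (RInt_correct (V := R_CompleteNormedModule)). apply ex_RInt_cont. intros t.
    apply (continuity_RInt_param (fun t s => fst (G s t))); [exact Hs01|].
    intros x y. apply (continuity_2d_pt_swap (fun s t => fst (G s t))), HG2.
  - replace (2 * PI * (Q * e)) with (scal (2 * PI - 0) (Q * e)) by (unfold scal; simpl; unfold mult; simpl; ring).
    apply (is_RInt_plus (V := R_NormedModule)).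
    + apply (RInt_correct (V := R_CompleteNormedModule)). now apply ex_RInt_cont.
    + apply (is_RInt_const (V := R_NormedModule)).
  - intros t Ht. apply Hbound. lra. }
assert (HX : 0 <= X).
{ apply Rnot_lt_le. intros HX.
  set (e := Rmin (1 / 2) (- X / (4 * PI * Q))).
  assert (HPQ : 0 < 4 * PI * Q) by (apply Rmult_lt_0_compat; lra).
  assert (He : 0 < e) by (apply Rmin_glb_lt; [lra|apply Rdiv_lt_0_compat; lra]).
  assert (He1 : e <= 1 / 2) by apply Rmin_l. assert (He2 : e <= - X / (4 * PI * Q)) by apply Rmin_r.
  specialize (Hmain e ltac:(lra)).
  assert (e * (4 * PI * Q) <= - X).
  { apply Rle_trans with (- X / (4 * PI * Q) * (4 * PI * Q)); [apply Rmult_le_compat_r; lra|].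
    apply Req_le. field. split; lra. }
  lra. }
set (Y := RInt (fun t => exp (- k * ln (Cmod (w t))) * fst (P t)) 0 (2 * PI)).
(* Cutting the range of u at e^(s1) leaves the last term; it has the right sign because the integral
   of Re P is nonnegative. *)
assert (E : X = 2 * PI / k * (Y - exp (- k * s1) * fst (CInt P 0 (2 * PI)))).
{ apply (is_RInt_unique (V := R_CompleteNormedModule)).
  assert (J1 : is_RInt (fun t => exp (- k * ln (Cmod (w t))) * fst (P t)) 0 (2 * PI) Y).
  { apply (RInt_correct (V := R_CompleteNormedModule)). apply ex_RInt_cont. intros t.
    apply continuity_pt_mult; [apply Hexpc|apply HPc]. }
  assert (J2 := is_CInt_fst _ _ _ _ (CInt_correct P 0 (2 * PI) ltac:(lra) (fun t _ => HP t))).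
  assert (J3 := is_RInt_scal _ _ _ (2 * PI / k) _ (is_RInt_minus _ _ _ _ _ _ J1 (is_RInt_scal _ _ _ (exp (- k * s1)) _ J2))).
  revert J3. apply is_RInt_ext. intros t _. unfold V, sg.
  change (2 * PI / k * (exp (- k * ln (Cmod (w t))) * fst (P t) - exp (- k * s1) * fst (P t)) =
    fst (P t) * (2 * PI * ((exp (- k * ln (Cmod (w t))) - exp (- k * s1)) / k))). field. lra. }
assert (Hpk : 0 < 2 * PI / k) by (apply Rdiv_lt_0_compat; lra).
assert (Hes := exp_pos (- k * s1)).
assert (0 <= exp (- k * s1) * fst (CInt P 0 (2 * PI))) by (apply Rmult_le_pos; lra).
apply Rnot_lt_le. intros HY. rewrite E in HX. nra.
Qed.


(** * Parseval's identity and winding numbers *)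

Lemma Cmod_circle (r t : R) : 0 <= r -> Cmod (r * cis t) = r.
Proof. intros Hr. rewrite Cmod_mul_cis, Cmod_R. now apply Rabs_pos_eq. Qed.

Lemma rcont_holo_circle (F : C -> C) (R0 r t : R) : holo F R0 -> 0 <= r < R0 ->
  rcont (fun t => F (r * cis t)%C) t.
Proof.
intros HF Hr. apply (rcont_comp F (fun t => r * cis t)%C).
- apply (holo_cont F R0); [exact HF|]. rewrite Cmod_circle; lra.
- apply rcont_mult; [apply rcont_const|apply rcont_cis].
Qed.

Lemma is_CInt_holo_circle (F : C -> C) (R0 r : R) : holo F R0 -> 0 <= r < R0 ->
  is_CInt (fun t => F (r * cis t)%C) 0 (2 * PI) (CInt (fun t => F (r * cis t)%C) 0 (2 * PI)).
Proof.
intros HF Hr. apply CInt_correct; [assert (P := PI2_pos); lra|].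
intros t _. now apply (rcont_holo_circle F R0).
Qed.

Lemma mean_value (F : C -> C) (R0 r : R) : holo F R0 -> 0 < r < R0 ->
  CInt (fun t => F (r * cis t)%C) 0 (2 * PI) = (2 * PI * F 0)%C.
Proof.
intros HF Hr.
assert (HRn : RtoC R0 <> 0) by (intros E; apply RtoC_inj in E; lra).
set (f := fun z => F (R0 * z)%C).
assert (Hf : holo f 1).
{ apply (holo_comp F (fun z => R0 * z)%C 1 R0); [|exact HF|apply holo_mult; [apply holo_const|apply holo_id]].
  intros z Hz. rewrite Cmod_mult, Cmod_R, Rabs_pos_eq by lra. nra. }
destruct (taylor_unit f Hf) as [a Ha].
assert (Hq : 0 < r / R0 < 1).
{ split; [apply Rdiv_lt_0_compat; lra|apply Rlt_div_l; lra]. }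
assert (E := fourier_psum a f (r / R0) 0 Ha Hq).
assert (Ha0 := psum_0 a f 1 Rlt_0_1 Ha). unfold f in Ha0. rewrite Cmult_0_r in Ha0.
rewrite Ha0. simpl Cpow in E. rewrite Cmult_1_r in E. rewrite <- E. unfold fourier. f_equal.
apply functional_extensionality. intros t. unfold f. simpl Cpow. rewrite Cmult_1_r. f_equal.
rewrite RtoC_div by lra. field. exact HRn.
Qed.

(** The terms are at most M q^n with q = r / rho for some rho between r and R0. The bound is uniform
    in |z| <= r, which is what permits integrating the series over a circle. *)
Lemma psum_tail_bound (a : nat -> C) (F : C -> C) (R0 r : R) : psum a F R0 -> 0 < r < R0 ->
  exists M q, 0 <= q < 1 /\ 0 < M /\ forall N z, Cmod z <= r ->
    Cmod (F z - Csum (fun n => a n * z ^ n)%C N) <= M * q ^ N.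
Proof.
intros Ha Hr. set (rho := (r + R0) / 2).
destruct (psum_coef_bound a F R0 rho Ha) as [M [HM HM']]; [unfold rho; lra|].
assert (Hrho : r < rho) by (unfold rho; lra).
set (q := r / rho).
assert (Hq : 0 <= q < 1).
{ split; [apply Rdiv_le_0_compat; lra|apply Rlt_div_l; lra]. }
exists (M / (1 - q)), q. split; [exact Hq|]. split; [apply Rdiv_lt_0_compat; lra|].
intros N z Hz. assert (Hz0 := Cmod_ge_0 z).
assert (Hterm : forall n, Cmod (a n * z ^ n) <= M * q ^ n).
{ intros n. rewrite Cmod_mult, Cmod_pow.
  assert (Hp : 0 < rho ^ n) by (apply pow_lt; lra).
  apply Rle_trans with (Cmod (a n) * r ^ n).
  - apply Rmult_le_compat_l; [apply Cmod_ge_0|]. apply pow_incr. lra.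
  - replace (r ^ n) with (rho ^ n * q ^ n).
    + rewrite <- Rmult_assoc. apply Rmult_le_compat_r; [now apply pow_le|apply HM'].
    + unfold q. rewrite <- Rpow_mult_distr. f_equal. field. lra. }
set (S := Csum (fun n => a n * z ^ n)%C).
assert (Hpart : forall m, Cmod (S (N + m)%nat - S N) <= M / (1 - q) * (q ^ N - q ^ (N + m))).
{ induction m as [|m IH].
  - rewrite Nat.add_0_r. replace (S N - S N)%C with (RtoC 0) by ring. rewrite Cmod_0. lra.
  - rewrite Nat.add_succ_r. unfold S at 1. rewrite Csum_S. fold (S (N + m)%nat).
    replace (S (N + m)%nat + a (Datatypes.S (N + m)) * z ^ Datatypes.S (N + m) - S N)%C
      with ((S (N + m)%nat - S N) + a (Datatypes.S (N + m)) * z ^ Datatypes.S (N + m))%C by ring.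
    eapply Rle_trans; [apply Cmod_triangle|]. specialize (Hterm (Datatypes.S (N + m))).
    assert (Hqq : q ^ Datatypes.S (N + m) <= q ^ (N + m)).
    { simpl. assert (0 <= q ^ (N + m)) by (now apply pow_le). nra. }
    assert (E : M / (1 - q) * (q ^ N - q ^ Datatypes.S (N + m)) =
       M / (1 - q) * (q ^ N - q ^ (N + m)) + M * q ^ (N + m)) by (simpl; field; lra).
    rewrite E. assert (M * q ^ Datatypes.S (N + m) <= M * q ^ (N + m)) by (apply Rmult_le_compat_l; lra). lra. }
apply le_epsilon. intros e He.
assert (HF := Ha z ltac:(lra)). rewrite Cser_eps in HF. destruct (HF e He) as [n Hn].
specialize (Hn (N + n)%nat ltac:(lia)). specialize (Hpart n). fold S in Hn.
assert (T := Cmod_triangle_sub (F z) (S (N + n)%nat) (S N)).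
rewrite (Cmod_sub_comm (F z) (S (N + n)%nat)) in T.
assert (HMq : 0 < M / (1 - q)) by (apply Rdiv_lt_0_compat; lra).
assert (0 <= M / (1 - q) * q ^ (N + n)) by (apply Rmult_le_pos; [lra|now apply pow_le]).
lra.
Qed.

Lemma holo_bounded_disk (F : C -> C) (R0 r : R) : holo F R0 -> 0 < r < R0 ->
  exists M, 0 < M /\ forall z, Cmod z <= r -> Cmod (F z) <= M.
Proof.
intros HF Hr. destruct (taylor F R0 ltac:(lra) HF) as [a Ha].
destruct (psum_tail_bound a F R0 r Ha Hr) as [M [q [Hq [HM H]]]].
assert (Ha0 := Cmod_ge_0 (a 0%nat)).
exists (M + Cmod (a 0%nat)). split; [lra|]. intros z Hz. specialize (H 0%nat z Hz).
rewrite Csum_0 in H. simpl in H. rewrite Cmult_1_r, Rmult_1_r in H.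
assert (T := Cmod_triangle_inv (F z) (a 0%nat)). lra.
Qed.

Lemma Cconj_mult (a b : C) : Cconj (a * b) = (Cconj a * Cconj b)%C.
Proof. unfold Cconj, Cmult; simpl; f_equal; ring. Qed.

Lemma Cconj_plus (a b : C) : Cconj (a + b) = (Cconj a + Cconj b)%C.
Proof. unfold Cconj, Cplus; simpl; f_equal; ring. Qed.

(** Only [F] is expanded: each conjugate monomial integrated against [G] is a Fourier coefficient of
    [G], so a single series is enough. *)
Lemma parseval (a b : nat -> C) (F G : C -> C) (r : R) : psum a F 1 -> psum b G 1 -> 0 < r < 1 ->
  Cser (fun n => 2 * PI * (Cconj (a n) * b n * (r ^ n * r ^ n)))%C
    (CInt (fun t => Cconj (F (r * cis t)%C) * G (r * cis t)%C)%C 0 (2 * PI)).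
Proof.
intros Ha Hb Hr. assert (HP := PI2_pos).
assert (HFh := psum_holo _ _ _ Ha). assert (HGh := psum_holo _ _ _ Hb).
destruct (psum_tail_bound a F 1 r Ha Hr) as [M [q [Hq [HM HMq]]]].
destruct (holo_bounded_disk G 1 r HGh Hr) as [B [HB HBG]].
set (FN := fun N z => Csum (fun n => a n * z ^ n)%C N).
assert (HI : forall N, is_CInt (fun t => Cconj (FN N (r * cis t)) * G (r * cis t))%C 0 (2 * PI)
   (Csum (fun n => 2 * PI * (Cconj (a n) * b n * (r ^ n * r ^ n)))%C N)).
{ assert (H1 : forall n, is_CInt (fun t => Cconj (a n * (r * cis t) ^ n) * G (r * cis t))%C 0 (2 * PI)
     (2 * PI * (Cconj (a n) * b n * (r ^ n * r ^ n)))%C).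
  { intros n.
    replace (2 * PI * (Cconj (a n) * b n * (r ^ n * r ^ n)))%C with
      (Cconj (a n) * r ^ n * (2 * PI * b n * r ^ n))%C by ring.
    rewrite <- (fourier_psum b G r n Hb Hr).
    apply (is_CInt_ext (fun t => Cconj (a n) * r ^ n * (G (r * cis t) * cis (- t) ^ n))%C); [lra| |].
    - intros t _. rewrite Cconj_mult, Cpow_conj, Cconj_mult, cis_conj.
      replace (Cconj (RtoC r)) with (RtoC r) by (unfold Cconj, RtoC; simpl; f_equal; ring).
      rewrite Cpow_mult_l. ring.
    - apply is_CInt_scal. apply CInt_correct; [lra|]. intros t _. apply rcont_mult.
      + apply (rcont_holo_circle G 1); [exact HGh|lra].
      + apply rcont_pow, rcont_cis_opp. }
  induction N as [|N IH].
  - rewrite Csum_0. apply (is_CInt_ext (fun t => Cconj (a 0%nat * (r * cis t) ^ 0) * G (r * cis t))%C); [lra| |apply H1].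
    intros t _. unfold FN. now rewrite Csum_0.
  - rewrite Csum_S.
    apply (is_CInt_ext (fun t => Cconj (FN N (r * cis t)) * G (r * cis t) +
       Cconj (a (S N) * (r * cis t) ^ S N) * G (r * cis t))%C); [lra| |apply is_CInt_plus; auto].
    intros t _. unfold FN. rewrite Csum_S, Cconj_plus. ring. }
assert (HFG : is_CInt (fun t => Cconj (F (r * cis t)) * G (r * cis t))%C 0 (2 * PI)
  (CInt (fun t => Cconj (F (r * cis t)%C) * G (r * cis t)%C)%C 0 (2 * PI))).
{ apply CInt_correct; [lra|]. intros t _. apply rcont_mult.
  - apply rcont_conj. apply (rcont_holo_circle F 1); [exact HFh|lra].
  - apply (rcont_holo_circle G 1); [exact HGh|lra]. }
apply Cser_eps. intros e He.
destruct (pow_small q (e / (2 * PI * (M * B) + 1)) Hq) as [N HN].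
{ apply Rdiv_lt_0_compat; [exact He|]. assert (0 < M * B) by now apply Rmult_lt_0_compat. nra. }
exists N. intros n Hn. specialize (HN n Hn).
assert (HMB : 0 < 2 * PI * (M * B)) by (apply Rmult_lt_0_compat; [lra|now apply Rmult_lt_0_compat]).
apply Rlt_div_r in HN; [|lra].
assert (Hqn : 0 <= q ^ n) by (apply pow_le; lra).
apply Rle_lt_trans with ((2 * PI - 0) * (M * q ^ n * B)); [|nra].
apply (is_CInt_bound_const (fun t => Cconj (FN n (r * cis t)) * G (r * cis t) -
   Cconj (F (r * cis t)) * G (r * cis t))%C 0 (2 * PI)).
- lra.
- intros t _.
  replace (Cconj (FN n (r * cis t)) * G (r * cis t) - Cconj (F (r * cis t)) * G (r * cis t))%C
    with (Cconj (FN n (r * cis t) - F (r * cis t)) * G (r * cis t))%C.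
  + rewrite Cmod_mult, Cmod_conj, Cmod_sub_comm. apply Rmult_le_compat; try apply Cmod_ge_0.
    * apply HMq. rewrite Cmod_circle; lra.
    * apply HBG. rewrite Cmod_circle; lra.
  + replace (FN n (r * cis t) - F (r * cis t))%C with (FN n (r * cis t) + - F (r * cis t))%C by ring.
    rewrite Cconj_plus. replace (Cconj (- F (r * cis t)%C)) with (- Cconj (F (r * cis t)%C))%C; [ring|].
    unfold Cconj, Copp; simpl; reflexivity.
- apply is_CInt_minus; [apply HI|exact HFG].
Qed.

(** The difference quotient, with the derivative as value at z0, agrees near z0 with the shifted
    Taylor series of G there, so the singularity is removable. *)
Lemma divide_zero (G G1 : C -> C) (z0 : C) : holo G 1 -> Cmod z0 < 1 -> cderiv G z0 (G1 z0) ->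
  exists q, holo q 1 /\ q z0 = G1 z0 /\ forall z, (G z - G z0 = (z - z0) * q z)%C.
Proof.
intros HG Hz0 HG1.
set (q := fun z => if Ceq_dec z z0 then G1 z0 else ((G z - G z0) * / (z - z0))%C).
exists q. assert (Hq0 : q z0 = G1 z0) by (unfold q; destruct (Ceq_dec z0 z0); [reflexivity|congruence]).
assert (Hsub : forall z, z <> z0 -> (z - z0)%C <> 0).
{ intros z Hne E. apply Hne. replace z with (z - z0 + z0)%C by ring. rewrite E. ring. }
assert (Hqz : forall z, (G z - G z0 = (z - z0) * q z)%C).
{ intros z. unfold q. destruct (Ceq_dec z z0) as [->|Hne]; [ring|]. field. now apply Hsub. }
split; [|now split]. intros z Hz. destruct (Ceq_dec z z0) as [->|Hne].
- set (r := 1 - Cmod z0). assert (Hr : 0 < r) by (unfold r; lra).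
  set (F := fun y => G (z0 + y)%C).
  assert (HFh : holo F r).
  { intros y Hy. destruct (HG (z0 + y)%C) as [l Hl].
    - eapply Rle_lt_trans; [apply Cmod_triangle|]. unfold r in Hy. lra.
    - exists l. now apply cderiv_translate. }
  destruct (taylor F r Hr HFh) as [b Hb]. destruct (psum_tail b F r Hb) as [Q [HQ HFQ]].
  assert (Hb0 : b 0%nat = G z0) by (rewrite <- (psum_0 b F r Hr Hb); unfold F; f_equal; ring).
  assert (HQh := psum_holo _ _ _ HQ).
  assert (Hq : forall y : C, y <> 0 -> Cmod y < r -> q (z0 + y)%C = Q y).
  { intros y Hy Hyr. apply (Cmult_cancel_l y); [exact Hy|].
    assert (E1 := Hqz (z0 + y)%C). assert (E2 := HFQ y Hyr). unfold F in E2. rewrite E2, Hb0 in E1.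
    replace (z0 + y - z0)%C with y in E1 by ring. rewrite <- E1. ring. }
  assert (HQ0 : Q 0 = G1 z0).
  { destruct (psum_derive b F r Hb) as [F1 [H1 H2]].
    rewrite (psum_0 _ _ _ Hr HQ).
    replace (b 1%nat) with (F1 0) by (rewrite (psum_0 _ _ _ Hr H1); unfold dcoef; simpl; ring).
    apply (cderiv_unique F 0); [apply H2; now rewrite Cmod_0|].
    apply cderiv_translate. replace (z0 + 0)%C with z0 by ring. exact HG1. }
  destruct (HQh 0) as [l Hl]; [now rewrite Cmod_0|]. exists l.
  apply (cderiv_ext_loc (fun z => Q (- z0 + z)%C) q z0 l r Hr).
  + intros w Hw. destruct (Ceq_dec w z0) as [->|Hwne].
    * rewrite Hq0, <- HQ0. f_equal. ring.
    * rewrite <- Hq.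
      -- f_equal. ring.
      -- intros E. apply Hwne. replace w with (z0 + (- z0 + w))%C by ring. rewrite E. ring.
      -- replace (- z0 + w)%C with (w - z0)%C by ring. exact Hw.
  + apply cderiv_translate. replace (- z0 + z0)%C with (RtoC 0) by ring. exact Hl.
- destruct (HG z Hz) as [l Hl]. eexists.
  apply (cderiv_ext_loc (fun z => (G z - G z0) * / (z - z0))%C q z) with (r := Cmod (z - z0)).
  + now apply Cmod_gt_0, Hsub.
  + intros w Hw. unfold q. destruct (Ceq_dec w z0) as [->|Hwne]; [|reflexivity].
    rewrite Cmod_sub_comm in Hw. lra.
  + apply cderiv_mult.
    * apply cderiv_minus; [exact Hl|apply cderiv_const].
    * apply cderiv_inv; [now apply Hsub|]. apply cderiv_minus; [apply cderiv_id|apply cderiv_const].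
Qed.

Lemma polar_unit (z : C) : Cmod z = 1 -> exists t, 0 <= t <= 2 * PI /\ z = cis t.
Proof.
intros Hz. assert (HP := PI_RGT_0). destruct z as [x y].
assert (E : x ^ 2 + y ^ 2 = 1).
{ assert (H := Cmod2_alt (x, y)). rewrite Hz in H. simpl in *. lra. }
assert (Hx : -1 <= x <= 1) by (split; nra).
assert (Hs : sin (acos x) = Rabs y).
{ rewrite sin_acos by exact Hx. rewrite <- sqrt_Rsqr_abs. f_equal. unfold Rsqr. simpl in E. lra. }
assert (Hb := acos_bound x). assert (Hc := cos_acos x Hx).
destruct (Rle_dec 0 y) as [Hy|Hy].
- exists (acos x). split; [lra|]. unfold cis. rewrite Hc, Hs, Rabs_pos_eq by exact Hy. reflexivity.
- exists (2 * PI - acos x). split; [lra|]. unfold cis.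
  replace (2 * PI - acos x) with (- acos x + 2 * PI) by ring.
  rewrite cos_plus, sin_plus, cos_2PI, sin_2PI, cos_neg, sin_neg, Hc, Hs, Rabs_left by lra.
  f_equal; ring.
Qed.

(* The integral is [2 pi (1 - n)] with [n] the number of solutions of [G z = u] in [|z| < r]. *)
Lemma winding_deficit (G G1 p : C -> C) (r : R) (u : C) : 0 < r < 1 ->
  holo G 1 -> holo G1 1 -> holo p 1 -> (forall z, Cmod z < 1 -> cderiv G z (G1 z)) ->
  (forall z w, Cmod z < 1 -> Cmod w < 1 -> G z = G w -> z = w) ->
  (forall z, Cmod z < 1 -> G1 z <> 0) ->
  (forall z, Cmod z < 1 -> p z * G z = z * G1 z)%C -> p 0 = 1 ->
  (forall t, G (r * cis t)%C <> 0) ->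
  u <> 0 -> (forall t, 0 <= t <= 2 * PI -> G (r * cis t)%C <> u) ->
  0 <= fst (CInt (fun t => p (r * cis t)%C / (1 - G (r * cis t)%C / u))%C 0 (2 * PI)).
Proof.
intros Hr HG HG1h Hp HG1 Hinj HG1n HpG Hp0 HGn Hu Hwu. assert (HP := PI2_pos).
assert (Ip := is_CInt_holo_circle p 1 r Hp ltac:(lra)). rewrite (mean_value p 1 r Hp Hr), Hp0 in Ip.
assert (Hneq : forall a b : C, (a - b)%C = 0 -> a = b).
{ intros a b E. replace a with (a - b + b)%C by ring. rewrite E. ring. }
(* Since p G = z G', one has p / (1 - G / u) = p - z G' / (G - u). The mean of p is p(0) = 1, and
   [g] is the second fraction, to be integrated case by case. *)
assert (Hsplit : forall g v, (forall t, 0 <= t <= 2 * PI -> g t * (G (r * cis t) - u) = (r * cis t) * G1 (r * cis t))%C ->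
   is_CInt g 0 (2 * PI) v ->
   CInt (fun t => p (r * cis t)%C / (1 - G (r * cis t)%C / u))%C 0 (2 * PI) = (2 * PI * 1 - v)%C).
{ intros g v Hg Iv. apply is_CInt_unique.
  apply (is_CInt_ext (fun t => p (r * cis t) - g t)%C); [lra| |now apply is_CInt_minus].
  intros t Ht. set (z := (r * cis t)%C).
  assert (Hz : Cmod z < 1) by (unfold z; rewrite Cmod_circle; lra).
  assert (E1 := HpG z Hz). assert (E2 := Hg t Ht). fold z in E2.
  assert (Hd : (G z - u)%C <> 0) by (intros E; apply (Hwu t Ht); now apply Hneq).
  assert (Hd2 : (u - G z)%C <> 0) by (intros E; apply (Hwu t Ht); symmetry; now apply Hneq).
  apply (Cmult_cancel_l (G z - u)); [exact Hd|].
  replace ((G z - u) * (p z - g t))%C with ((G z - u) * p z - g t * (G z - u))%C by ring.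
  rewrite E2, <- E1. field. split; [exact Hu|].
  exact Hd2. }
destruct (classic (exists z0, Cmod z0 < 1 /\ G z0 = u)) as [[z0 [Hz0 HGz0]]|Hno].
- destruct (divide_zero G G1 z0 HG Hz0 (HG1 z0 Hz0)) as [q [Hq [Hq0 HGq]]]. rewrite HGz0 in HGq.
  assert (Hqn : forall z, Cmod z < 1 -> q z <> 0).
  { intros z Hz. destruct (Ceq_dec z z0) as [->|Hne]; [rewrite Hq0; now apply HG1n|].
    intros E. apply Hne, Hinj; auto. rewrite HGz0. apply Hneq. rewrite HGq, E. ring. }
  destruct (holo_derive q 1 Rlt_0_1 Hq) as [q1 [Hq1 Hq1']].
  (* From G - u = (z - z0) q, z G' / (G - u) = z / (z - z0) + z q' / q. By univalence q has no zero,
     and the last term vanishes at 0, so it integrates to 0 over the circle. *)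
  set (h := fun z => (z * q1 z * / q z)%C).
  assert (Hh : holo h 1).
  { apply holo_mult; [apply holo_mult; [apply holo_id|exact Hq1]|now apply holo_inv]. }
  assert (Ih := is_CInt_holo_circle h 1 r Hh ltac:(lra)). rewrite (mean_value h 1 r Hh Hr) in Ih.
  assert (EG1 : forall z, Cmod z < 1 -> G1 z = (q z + (z - z0) * q1 z)%C).
  { intros z Hz. apply (cderiv_unique G z); [now apply HG1|].
    apply (cderiv_ext (fun z => (z - z0) * q z + u)%C _ _ ((1 - 0) * q z + (z - z0) * q1 z + 0)%C).
    - intros w. rewrite <- HGq. ring.
    - ring.
    - apply cderiv_plus; [|apply cderiv_const]. apply (cderiv_mult (fun z => z - z0)%C q); [|now apply Hq1'].
      apply cderiv_minus; [apply cderiv_id|apply cderiv_const]. }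
  assert (Hon : forall t, 0 <= t <= 2 * PI -> (r * cis t - z0)%C <> 0).
  { intros t Ht E. apply (Hwu t Ht). apply Hneq in E. now rewrite E. }
  assert (HnR : Cmod z0 <> r).
  { intros E. destruct (polar_unit (z0 / r)) as [t [Ht Hzt]].
    - rewrite Cmod_div by (intros E'; apply RtoC_inj in E'; lra).
      rewrite E, Cmod_R, Rabs_pos_eq by lra. field. lra.
    - apply (Hon t Ht). rewrite <- Hzt. field. intros E'; apply RtoC_inj in E'; lra. }
  assert (Hgen : forall v, is_CInt (fun t => (r * cis t) / (r * cis t - z0))%C 0 (2 * PI) v ->
     CInt (fun t => p (r * cis t)%C / (1 - G (r * cis t)%C / u))%C 0 (2 * PI) = (2 * PI * 1 - v)%C).
  { intros v Iv. rewrite (Hsplit (fun t => (r * cis t) / (r * cis t - z0) + h (r * cis t))%C (v + 2 * PI * h 0)%C).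
    - unfold h. ring.
    - intros t Ht. rewrite HGq, EG1 by (rewrite Cmod_circle; lra). unfold h. field. split.
      + apply Hqn. rewrite Cmod_circle; lra.
      + now apply Hon.
    - now apply is_CInt_plus. }
  (* Inside the circle z / (z - z0) is a Cauchy kernel with integral 2 pi, so the deficit is 0;
     outside it is holomorphic on |z| < |z0| and vanishes at 0, so the deficit is 2 pi. *)
  destruct (Rlt_dec (Cmod z0) r) as [Hlt|Hge].
  + rewrite (Hgen (RtoC (2 * PI))).
    * rewrite RtoC_mult. replace (2 * PI * 1 - 2 * PI)%C with (RtoC 0) by ring. simpl. lra.
    * assert (Hrn : RtoC r <> 0) by (intros E; apply RtoC_inj in E; lra).
      apply (is_CInt_ext (fun t => / (1 - z0 / r * cis (- t)))%C); [lra| |].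
      -- intros t Ht. rewrite cis_opp. field. assert (Hc := cis_neq_0 t). assert (Ho := Hon t Ht).
         assert (cis t * r - z0 <> 0)%C by (rewrite (Cmult_comm (cis t)); exact Ho).
         repeat split; auto.
      -- apply mean_cauchy_kernel. rewrite Cmod_div, Cmod_R, Rabs_pos_eq by (assumption || lra).
         apply Rlt_div_l; lra.
  + set (k := fun z => (z * / (z - z0))%C).
    assert (Hk : holo k (Cmod z0)).
    { apply holo_mult; [apply holo_id|]. apply holo_inv; [|apply holo_minus; [apply holo_id|apply holo_const]].
      intros z Hz E. apply Hneq in E. rewrite E in Hz. lra. }
    assert (Ik := is_CInt_holo_circle k (Cmod z0) r Hk ltac:(lra)).
    rewrite (mean_value k (Cmod z0) r Hk ltac:(lra)) in Ik.
    rewrite (Hgen _ Ik). unfold k.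
    replace (2 * PI * 1 - 2 * PI * (0 * / (0 - z0)))%C with (RtoC (2 * PI)) by (rewrite RtoC_mult; ring).
    simpl. lra.
- assert (Hd : forall z, Cmod z < 1 -> (G z - u)%C <> 0).
  { intros z Hz E. apply Hno. exists z. split; [exact Hz|now apply Hneq]. }
  set (k := fun z => (z * G1 z * / (G z - u))%C).
  assert (Hk : holo k 1).
  { apply holo_mult; [apply holo_mult; [apply holo_id|exact HG1h]|]. apply holo_inv; [exact Hd|].
    apply holo_minus; [exact HG|apply holo_const]. }
  assert (Ik := is_CInt_holo_circle k 1 r Hk ltac:(lra)). rewrite (mean_value k 1 r Hk Hr) in Ik.
  rewrite (Hsplit _ _) with (2 := Ik).
  + unfold k. replace (2 * PI * 1 - 2 * PI * (0 * G1 0 * / (G 0 - u)))%C with (RtoC (2 * PI)) by (rewrite RtoC_mult; ring).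
    simpl. lra.
  + intros t Ht. unfold k. field. apply Hd. rewrite Cmod_circle; lra.
Qed.

Lemma circle_lipschitz (G G1 : C -> C) (r : R) : 0 < r < 1 -> holo G1 1 ->
  (forall z, Cmod z < 1 -> cderiv G z (G1 z)) ->
  exists L, 0 < L /\ forall s t, Cmod (G (r * cis s)%C - G (r * cis t)%C) <= L * Rabs (s - t).
Proof.
intros Hr HG1h HG1. destruct (holo_bounded_disk G1 1 r HG1h Hr) as [M [HM HM']].
exists M. split; [exact HM|].
assert (Hcis : forall t, rderiv (fun t => r * cis t)%C t (r * (Ci * cis t))%C).
{ intros t. assert (E : forall w, cderiv (fun w => r * Cexp w)%C w (r * Cexp w)%C).
  { intros w. apply cderiv_scal, cderiv_Cexp. }
  assert (Hc : forall t : R, (Cexp (t * Ci) = cis t)%C).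
  { intros u. unfold Cexp, cis. simpl. replace (u * 0 - 0 * 1) with 0 by ring.
    replace (u * 1 + 0 * 0) with u by ring. rewrite exp_0. f_equal; ring. }
  assert (D := rderiv_comp (fun w => r * Cexp w)%C (fun t => t * Ci)%C t Ci _ (E _) (rderiv_linear Ci t)).
  intros e He. destruct (D e He) as [d [Hd Hd']]. exists d. split; [exact Hd|]. intros s Hs.
  specialize (Hd' s Hs). rewrite !Hc in Hd'.
  replace (r * (Ci * cis t))%C with (Ci * (r * cis t))%C by ring. exact Hd'. }
assert (HD : forall t, rderiv (fun t => G (r * cis t)%C) t (r * (Ci * cis t) * G1 (r * cis t))%C).
{ intros t. apply (rderiv_comp G (fun t => r * cis t)%C); [|apply Hcis]. apply HG1. rewrite Cmod_circle; lra. }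
assert (Hle : forall s t, s <= t -> Cmod (G (r * cis t)%C - G (r * cis s)%C) <= M * (t - s)).
{ intros s t Hst. rewrite Rmult_comm.
  apply (is_CInt_bound_const (fun t => r * (Ci * cis t) * G1 (r * cis t))%C s t); [exact Hst| |].
  - intros v _. rewrite !Cmod_mult, Cmod_Ci, Cmod_cis, Cmod_R, Rabs_pos_eq by lra.
    assert (P := HM' (r * cis v)%C ltac:(rewrite Cmod_circle; lra)).
    assert (P0 := Cmod_ge_0 (G1 (r * cis v)%C)). nra.
  - apply (is_CInt_derive (fun t => G (r * cis t)%C)); [exact Hst| | |].
    + intros v _. apply (rderiv_fst (fun t => G (r * cis t)%C)), HD.
    + intros v _. apply (rderiv_snd (fun t => G (r * cis t)%C)), HD.
    + intros v _. apply rcont_mult; [|apply (rcont_holo_circle G1 1); [exact HG1h|lra]].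
      apply rcont_mult; [apply rcont_const|]. apply rcont_mult; [apply rcont_const|apply rcont_cis]. }
intros s t. destruct (Rle_dec s t) as [Hst|Hst].
- rewrite Cmod_sub_comm, Rabs_minus_sym, Rabs_pos_eq by lra. now apply Hle.
- rewrite Rabs_pos_eq by lra. apply Hle. lra.
Qed.

(** Near 0 the difference l1 - l2 is small, hence in the strip where [Clog] inverts [Cexp], and its
    exponential is 1. *)
Lemma log_unique_near_0 (l1 l2 : C -> C) (r : R) : 0 < r -> holo l1 r -> holo l2 r ->
  l1 0 = 0 -> l2 0 = 0 -> (forall z, Cmod z < r -> Cexp (l1 z) = Cexp (l2 z)) ->
  exists r', 0 < r' <= r /\ forall z, Cmod z < r' -> l1 z = l2 z.
Proof.
intros Hr H1 H2 H10 H20 He.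
destruct (Cpower_Cexp (fun z => l1 z - l2 z)%C 1 r Hr) as [r' [Hr' H]].
{ now apply holo_minus. }
{ rewrite H10, H20. ring. }
destruct (holo_cont (fun z => l1 z - l2 z)%C r 0) with (e := 1) as [d [Hd Hd']];
  [now apply holo_minus|now rewrite Cmod_0|lra|].
exists (Rmin d r). split; [split; [now apply Rmin_glb_lt|apply Rmin_r]|]. intros z Hz.
assert (Hzd : Cmod z < d) by (eapply Rlt_le_trans; [exact Hz|apply Rmin_l]).
assert (Hzr : Cmod z < r) by (eapply Rlt_le_trans; [exact Hz|apply Rmin_r]).
assert (HP := PI2_1).
assert (E1 : Cexp (l1 z - l2 z) = Cexp 0).
{ unfold Cminus. rewrite Cexp_plus, Cexp_opp, He, Cexp_0 by exact Hzr. field. apply Cexp_neq_0. }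
assert (E2 : (l1 z - l2 z)%C = 0).
{ rewrite <- (Clog_Cexp (l1 z - l2 z)), E1.
  - apply Clog_Cexp. simpl. lra.
  - specialize (Hd' z). rewrite H10, H20 in Hd'. replace (z - 0)%C with z in Hd' by ring.
    replace (l1 z - l2 z - (0 - 0))%C with (l1 z - l2 z)%C in Hd' by ring.
    assert (A := Rabs_snd_le (l1 z - l2 z)). specialize (Hd' Hzd).
    assert (B := Rabs_def2 (snd (l1 z - l2 z)%C) PI ltac:(lra)). unfold Im. lra. }
replace (l1 z) with (l1 z - l2 z + l2 z)%C by ring. rewrite E2. ring.
Qed.

Lemma mobius_derive (zeta z : C) : Cmod zeta < 1 -> Cmod z < 1 ->
  exists m : C, m <> 0 /\ cderiv (mobius zeta) z m.
Proof.
intros Hz H. assert (N := one_plus_conj_neq_0 zeta z Hz H).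
set (v := (1 + Cconj zeta * z)%C) in *.
exists (RtoC (1 - Cmod zeta ^ 2) * / (v * v))%C. split.
- apply Cmult_neq_0.
  + intros E. apply RtoC_inj in E. assert (P := Cmod_ge_0 zeta). nra.
  + intros E. assert (E1 : (1 : C) = 0).
    { replace (RtoC 1) with (/ (v * v) * (v * v))%C by (field; exact N). rewrite E. ring. }
    apply RtoC_inj in E1. lra.
- apply (cderiv_ext (fun z => (z + zeta) * / (1 + Cconj zeta * z))%C _ _
    ((1 + 0) * / v + (z + zeta) * (- (0 + Cconj zeta * 1) / (v * v)))%C); [reflexivity| |].
  + rewrite RtoC_1_minus_Cmod2. unfold v. field. exact N.
  + apply (cderiv_mult (fun z => z + zeta)%C (fun z => / (1 + Cconj zeta * z))%C).
    * apply cderiv_plus; [apply cderiv_id|apply cderiv_const].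
    * apply (cderiv_inv (fun z => 1 + Cconj zeta * z)%C z (0 + Cconj zeta * 1)%C N).
      apply cderiv_plus; [apply cderiv_const|]. apply cderiv_scal, cderiv_id.
Qed.


(** * Necessity *)

(* For the Koebe transform [G] of [f] at [zeta]: [H] is the branch of [(gamma0 z / G)^lambda]
   whose Taylor coefficients are the [A n], and [p = z G' / G]. *)
Lemma koebe_transform (lambda : R) (f : C -> C) (zeta : C) :
  locally_univalent f -> univalent f -> Cmod zeta < 1 ->
  exists (G G1 p H : C -> C) (gamma0 : C), 
   (holo G 1 /\ holo G1 1 /\ holo p 1) /\ gamma0 <> 0 /\
   (forall z, Cmod z < 1 -> cderiv G z (G1 z)) /\
   (forall z w, Cmod z < 1 -> Cmod w < 1 -> G z = G w -> z = w) /\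
   (forall z, Cmod z < 1 -> G1 z <> 0) /\
   (forall z : C, Cmod z < 1 -> z <> 0 -> G z <> 0) /\
   (forall z, Cmod z < 1 -> p z * G z = z * G1 z)%C /\ p 0 = 1 /\
   psum (A lambda f zeta) H 1 /\
   psum (fun n => RtoC (INR n - lambda) * A lambda f zeta n)%C (fun z => - lambda * (H z * p z))%C 1 /\
   (forall z, Cmod z < 1 -> exists l, H z = Cexp (lambda * l) /\ Cexp l * G z = gamma0 * z)%C.
Proof.
intros Hf Hu Hzeta.
destruct (A_expansion lambda f zeta Hf Hzeta) as [r0 [l [K [Hr0 [Hl [Hl0 [HK [HlG HA]]]]]]]].
set (G := fun z => (f (mobius zeta z) - f zeta)%C).
assert (HfT : forall z, Cmod z < 1 -> Cmod (mobius zeta z) < 1) by (intros; now apply Cmod_mobius).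
assert (HG : holo G 1).
{ apply holo_minus; [|apply holo_const].
  apply (holo_comp f (mobius zeta) 1 1); [exact HfT|now apply locally_univalent_holo|now apply holo_mobius]. }
assert (HG0 : G 0 = 0) by (unfold G; rewrite mobius_0; ring).
assert (Hinj : forall z w, Cmod z < 1 -> Cmod w < 1 -> G z = G w -> z = w).
{ intros z w Hz Hw E. apply (mobius_inj zeta); auto. apply Hu; [now apply HfT|now apply HfT|].
  unfold G in E. replace (f (mobius zeta z)) with (f (mobius zeta z) - f zeta + f zeta)%C by ring.
  rewrite E. ring. }
assert (H01 : Cmod 0 < 1) by (rewrite Cmod_0; lra).
assert (HGn : forall z : C, Cmod z < 1 -> z <> 0 -> G z <> 0).
{ intros z Hz Hz0 E. apply Hz0. apply Hinj; auto. now rewrite HG0. }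
destruct (holo_derive G 1 Rlt_0_1 HG) as [G1 [HG1 HG1']].
assert (HG1n : forall z, Cmod z < 1 -> G1 z <> 0).
{ intros z Hz. destruct (mobius_derive zeta z Hzeta Hz) as [m [Hm Hm']].
  assert (D : cderiv G z (m * C_derive f (mobius zeta z) - 0)%C).
  { apply (cderiv_minus (fun z => f (mobius zeta z))); [|apply cderiv_const].
    apply (cderiv_comp f (mobius zeta)); [|exact Hm']. apply cderiv_C_derive; auto. }
  rewrite (cderiv_unique _ _ _ _ (HG1' z Hz) D).
  replace (m * C_derive f (mobius zeta z) - 0)%C with (m * C_derive f (mobius zeta z))%C by ring.
  apply Cmult_neq_0; [exact Hm|]. apply Hf. now apply HfT. }
destruct (taylor G 1 Rlt_0_1 HG) as [b Hb]. destruct (psum_tail b G 1 Hb) as [g [Hg HGg']].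
assert (HGg : forall z, Cmod z < 1 -> G z = (z * g z)%C).
{ intros z Hz. rewrite HGg', <- (psum_0 b G 1 Rlt_0_1 Hb), HG0 by exact Hz. ring. }
assert (Hgh := psum_holo _ _ _ Hg).
assert (Hg0 : g 0 = G1 0).
{ destruct (psum_derive b G 1 Hb) as [F1 [H1 H2]].
  rewrite (cderiv_unique _ _ _ _ (HG1' 0 H01) (H2 0 H01)).
  rewrite (psum_0 _ _ _ Rlt_0_1 Hg), (psum_0 _ _ _ Rlt_0_1 H1). unfold dcoef. simpl. ring. }
assert (Hgn : forall z, Cmod z < 1 -> g z <> 0).
{ intros z Hz. destruct (Ceq_dec z 0) as [->|Hne]; [rewrite Hg0; now apply HG1n|].
  intros E. apply (HGn z Hz Hne). rewrite HGg, E by exact Hz. ring. }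
set (g0 := g 0) in *. assert (Hg0n : g0 <> 0) by (apply Hgn; exact H01).
(* Univalence makes g = G / z zero-free on the whole disc, so the logarithm that [A_expansion]
   provides near 0 has a global counterpart [Lg]. *)
set (q := fun z => (g0 * / g z)%C).
assert (Hq : holo q 1) by (apply holo_mult; [apply holo_const|now apply holo_inv]).
destruct (holo_derive q 1 Rlt_0_1 Hq) as [q1 [Hq1 Hq1']].
assert (Hqn : forall z, Cmod z < 1 -> q z <> 0).
{ intros z Hz E. apply Hg0n. replace g0 with (q z * g z)%C by (unfold q; field; auto). rewrite E. ring. }
destruct (holo_log q q1 1 Rlt_0_1 Hq1 Hq1' Hqn) as [Lg [HLg0 [HLg1 HLge]]].
{ unfold q. fold g0. field. exact Hg0n. }
assert (HLgh : holo Lg 1) by (intros z Hz; eexists; now apply HLg1).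
assert (HLG : forall z, Cmod z < 1 -> (Cexp (Lg z) * G z = g0 * z)%C).
{ intros z Hz. rewrite HLge, HGg by exact Hz. unfold q. field. auto. }
(* Off 0, exp(l) z g = K z gives exp(l) g = K; letting z tend to 0 identifies the constant. *)
assert (HKg : K = g0).
{ assert (E : (Cexp (l 0) * g 0)%C = K).
  { apply (ccont_eq_0 (fun z => Cexp (l z) * g z)%C (fun _ => K) r0); [lra| | |].
    - apply (holo_cont _ r0); [|rewrite Cmod_0; lra].
      apply holo_mult; [now apply holo_Cexp|]. apply (holo_le _ 1); [lra|exact Hgh].
    - apply ccont_const.
    - intros z Hz Hzr. apply (Cmult_cancel_l z); [exact Hz|].
      replace (z * (Cexp (l z) * g z))%C with (Cexp (l z) * (z * g z))%C by ring.
      rewrite <- HGg by lra. unfold G. rewrite HlG by exact Hzr. ring. }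
  rewrite Hl0, Cexp_0 in E. fold g0 in E. rewrite <- E. ring. }
destruct (log_unique_near_0 l Lg r0) as [r1 [Hr1 HlL]]; auto; [lra|apply (holo_le _ 1); [lra|exact HLgh]| |].
{ intros z Hz. rewrite HLge by lra. unfold q.
  destruct (Ceq_dec z 0) as [->|Hne].
  - rewrite Hl0, Cexp_0. fold g0. field. exact Hg0n.
  - apply (Cmult_cancel_l (G z)); [apply HGn; [lra|exact Hne]|].
    rewrite Cmult_comm. unfold G at 1. rewrite HlG, HKg, HGg by lra. field. apply Hgn; lra. }
set (H := fun z => Cexp (lambda * Lg z)).
assert (HH : holo H 1) by (apply holo_Cexp, holo_mult; [apply holo_const|exact HLgh]).
(* The [A n] are known as coefficients only on a small disc; uniqueness there identifies them with
   the Taylor coefficients of [H] on the unit disc. *)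
assert (HAH : psum (A lambda f zeta) H 1).
{ destruct (taylor H 1 Rlt_0_1 HH) as [a Ha]. apply (psum_coef_ext a); [|exact Ha].
  assert (HA' : psum (A lambda f zeta) H r1).
  { apply (psum_ext _ (fun z => Cexp (lambda * l z))); [|apply (psum_le _ _ r0); [lra|exact HA]].
    intros z Hz. unfold H. now rewrite HlL. }
  apply (psum_unique _ _ H r1); [lra| |exact HA']. apply (psum_le _ _ 1); [lra|exact Ha]. }
set (p := fun z => (G1 z * / g z)%C).
assert (Hp : holo p 1) by (apply holo_mult; [exact HG1|now apply holo_inv]).
assert (HpG : forall z, Cmod z < 1 -> (p z * G z = z * G1 z)%C).
{ intros z Hz. rewrite HGg by exact Hz. unfold p. field. auto. }
assert (Hp0 : p 0 = 1).
{ unfold p. fold g0. rewrite <- Hg0. field. exact Hg0n. }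
(* The left-hand coefficients are those of z H' - lambda H. As H' = lambda Lg' H and z Lg' G = G - z
   G' = (1 - p) G, this function is - lambda H p. *)
assert (Hcoef : psum (fun n => RtoC (INR n - lambda) * A lambda f zeta n)%C (fun z => - lambda * (H z * p z))%C 1).
{ destruct (psum_derive _ H 1 HAH) as [H1 [HH1 HH1']].
  assert (E := psum_plus _ _ _ _ _ (psum_shift _ _ _ HH1) (psum_scal (- lambda) _ _ _ HAH)).
  apply (psum_ext _ (fun z => z * H1 z + - lambda * H z)%C).
  - intros z Hz.
    assert (EH : H1 z = (lambda * (q1 z / q z) * H z)%C).
    { apply (cderiv_unique H z); [now apply HH1'|].
      apply (cderiv_comp Cexp (fun u => lambda * Lg u)%C); [exact (cderiv_Cexp _)|].
      apply cderiv_scal. now apply HLg1. }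
    assert (EG := log_derivative_identity Lg G g0 z _ _ 1 Hz HLG (HLg1 z Hz) (HG1' z Hz)).
    destruct (Ceq_dec z 0) as [->|Hne]; [rewrite Hp0; ring|].
    apply (Cmult_cancel_l (G z)); [now apply HGn|]. rewrite EH.
    replace (G z * (z * (lambda * (q1 z / q z) * H z) + - lambda * H z))%C
      with (lambda * H z * (z * (q1 z / q z) * G z - G z))%C by ring.
    rewrite EG, <- HpG by exact Hz. ring.
  - revert E. apply psum_coef_ext. intros n. rewrite RtoC_minus.
    destruct n as [|n]; [cbn [shift_coef]; change (INR 0) with 0; ring|unfold dcoef; cbn [shift_coef]; ring]. }
exists G, G1, p, H, g0.
refine (conj (conj HG (conj HG1 Hp)) (conj Hg0n (conj HG1' (conj Hinj (conj HG1n (conj HGn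
  (conj HpG (conj Hp0 (conj HAH (conj Hcoef _)))))))))).
intros z Hz. exists (Lg z). split; [reflexivity|now apply HLG].
Qed.

(** Parseval for H and - lambda H p shows that the full weighted series sums to a nonpositive
    number. Past N >= lambda its terms are nonnegative, so the partial sums increase and stay below
    that number. *)
Lemma prawitz_weighted (lambda : R) (f : C -> C) (zeta : C) (r : R) (N : nat) :
  0 < lambda -> locally_univalent f -> univalent f -> Cmod zeta < 1 -> 0 < r < 1 -> lambda <= INR N ->
  sum_n (fun n => area_term lambda f zeta n * (r ^ n * r ^ n)) N <= 0.
Proof.
intros Hlam Hf Hu Hzeta Hr HN. assert (HP := PI2_pos).
destruct (koebe_transform lambda f zeta Hf Hu Hzeta) as
  [G [G1 [p [H [g0 [[HG [HG1 Hp]] [Hg0 [HG1' [Hinj [HG1n [HGn [HpG [Hp0 [HA [HB HHl]]]]]]]]]]]]]]].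
set (T := sum_n (fun n => area_term lambda f zeta n * (r ^ n * r ^ n))).
set (w := fun t => G (r * cis t)%C). set (P := fun t => p (r * cis t)%C).
assert (Hrn : RtoC r <> 0) by (intros E; apply RtoC_inj in E; lra).
assert (Hz : forall t, Cmod (r * cis t) < 1) by (intros; rewrite Cmod_circle; lra).
assert (Hw0 : forall t, w t <> 0).
{ intros t. apply HGn; [apply Hz|]. apply Cmult_neq_0; [exact Hrn|apply cis_neq_0]. }
destruct (circle_lipschitz G G1 r Hr HG1 HG1') as [L [HL HLip]].
assert (HPc : forall t, rcont P t) by (intros; apply (rcont_holo_circle p 1); [exact Hp|lra]).
assert (Hwc : forall t, rcont w t) by (intros; apply (rcont_holo_circle G 1); [exact HG|lra]).
assert (Harea : 0 <= RInt (fun t => exp (- (2 * lambda) * ln (Cmod (w t))) * fst (P t)) 0 (2 * PI)).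
{ apply (area_theorem_integral (2 * lambda) L w P); auto; [lra| | |].
  - intros s t _ _ E. apply (Cmult_cancel_l r _ _ Hrn). apply Hinj; auto.
  - intros u Hun Hwu. apply (winding_deficit G G1 p r u); auto.
  - unfold P. rewrite (mean_value p 1 r Hp Hr), Hp0. simpl. lra. }
set (X := CInt (fun t => Cconj (H (r * cis t)%C) * (- lambda * (H (r * cis t)%C * p (r * cis t)%C)))%C 0 (2 * PI)).
assert (HX : fst X <= 0).
(* On the circle |H|^2 = c |w|^(-2 lambda), by taking moduli in exp(l) G = g0 z; this produces the
   weight of the area integral with k = 2 lambda. *)
{ set (c := exp (2 * lambda * ln (Cmod g0 * r))).
  assert (Hc : 0 < c) by apply exp_pos.
  assert (EX : fst X = - lambda * c * RInt (fun t => exp (- (2 * lambda) * ln (Cmod (w t))) * fst (P t)) 0 (2 * PI)).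
  { assert (J1 : is_CInt (fun t => Cconj (H (r * cis t)) * (- lambda * (H (r * cis t) * p (r * cis t))))%C 0 (2 * PI) X).
    { apply CInt_correct; [lra|]. intros t _.
      assert (HHc : rcont (fun t => H (r * cis t)%C) t).
      { apply (rcont_holo_circle H 1); [eapply psum_holo; eassumption|lra]. }
      apply rcont_mult; [now apply rcont_conj|]. apply rcont_mult; [apply rcont_const|].
      apply rcont_mult; [exact HHc|apply HPc]. }
    apply is_CInt_fst in J1. rewrite <- (is_RInt_unique (V := R_CompleteNormedModule) _ _ _ _ J1).
    assert (Hex : ex_RInt (fun t => exp (- (2 * lambda) * ln (Cmod (w t))) * fst (P t)) 0 (2 * PI)).
    { apply ex_RInt_cont. intros t. apply continuity_pt_mult; [|now apply rcont_fst].
      apply (continuity_pt_comp (fun t => ln (Cmod (w t))) (fun x => exp (- (2 * lambda) * x))).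
      - apply (rcont_fst (fun t => RtoC (ln (Cmod (w t))))). now apply rcont_ln_Cmod.
      - continuity_elem. }
    assert (J2 := is_RInt_scal _ _ _ (- lambda * c) _ (RInt_correct (V := R_CompleteNormedModule) _ _ _ Hex)).
    apply (is_RInt_unique (V := R_CompleteNormedModule)). revert J2. apply is_RInt_ext. intros t _.
    set (z := (r * cis t)%C). destruct (HHl z (Hz t)) as [l [El1 El2]].
    assert (Em : Cmod (H z) ^ 2 = c * exp (- (2 * lambda) * ln (Cmod (w t)))).
    { rewrite El1, Cmod_Cexp. unfold c. rewrite <- exp_plus. simpl pow. rewrite Rmult_1_r, <- exp_plus. f_equal.
      assert (E := f_equal Cmod El2). rewrite !Cmod_mult, Cmod_Cexp in E.
      unfold z in E at 2. rewrite Cmod_circle in E by lra. rewrite <- E.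
      change (G z) with (w t). rewrite ln_mult, ln_exp by (try apply exp_pos; now apply Cmod_0_lt).
      destruct l as [l1 l2]. unfold Re, RtoC, Cmult; simpl. ring. }
    replace (Cconj (H z) * (- lambda * (H z * p z)))%C with (RtoC (- lambda * Cmod (H z) ^ 2) * p z)%C.
    - rewrite Em. change (P t) with (p z).
      change (- lambda * c * (exp (- (2 * lambda) * ln (Cmod (w t))) * fst (p z)) =
        fst (RtoC (- lambda * (c * exp (- (2 * lambda) * ln (Cmod (w t))))) * p z)%C).
      unfold RtoC, Cmult; simpl. ring.
    - rewrite RtoC_mult, Cmod2_conj, RtoC_opp. ring. }
  rewrite EX. assert (0 < lambda * c) by now apply Rmult_lt_0_compat. nra. }
assert (HS := parseval _ _ _ _ r HA HB Hr). cbv beta in HS. fold X in HS.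
assert (HST : forall n, fst (Csum (fun n => 2 * PI * (Cconj (A lambda f zeta n) *
     (RtoC (INR n - lambda) * A lambda f zeta n) * (r ^ n * r ^ n)))%C n) = 2 * PI * T n).
{ assert (Ht : forall n, (2 * PI * (Cconj (A lambda f zeta n) *
     (RtoC (INR n - lambda) * A lambda f zeta n) * (r ^ n * r ^ n)))%C =
     RtoC (2 * PI * (area_term lambda f zeta n * (r ^ n * r ^ n)))).
  { intros n. unfold area_term. rewrite !RtoC_mult, Cmod2_conj, !RtoC_pow. ring. }
  induction n as [|n IH].
  - unfold T. rewrite Csum_0, sum_O, Ht. reflexivity.
  - unfold T. rewrite Csum_S, sum_Sn, Ht. fold T.
    change (fst (Csum (fun n => 2 * PI * (Cconj (A lambda f zeta n) *
     (RtoC (INR n - lambda) * A lambda f zeta n) * (r ^ n * r ^ n)))%C n) +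
       2 * PI * (area_term lambda f zeta (S n) * (r ^ S n * r ^ S n)) =
       2 * PI * (T n + area_term lambda f zeta (S n) * (r ^ S n * r ^ S n))).
    rewrite IH. ring. }
assert (Hmono : forall m, T N <= T (N + m)%nat).
{ induction m as [|m IH]; [rewrite Nat.add_0_r; lra|].
  rewrite Nat.add_succ_r. unfold T at 2. rewrite sum_Sn. fold T.
  change (T N <= T (N + m)%nat + area_term lambda f zeta (S (N + m)) * (r ^ S (N + m) * r ^ S (N + m))).
  assert (0 <= area_term lambda f zeta (S (N + m)) * (r ^ S (N + m) * r ^ S (N + m))); [|lra].
  apply Rmult_le_pos.
  - apply Rmult_le_pos; [|apply pow2_ge_0].
    assert (INR N <= INR (S (N + m))) by (apply le_INR; lia). lra.
  - assert (0 <= r ^ S (N + m)) by (apply pow_le; lra). nra. }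
apply Rnot_lt_le. intros Hpos. fold T in Hpos.
rewrite Cser_eps in HS. destruct (HS (2 * PI * T N)) as [n Hn]; [apply Rmult_lt_0_compat; lra|].
specialize (Hn (N + n)%nat ltac:(lia)). specialize (Hmono n).
assert (Q := Rabs_fst_le (Csum (fun n => 2 * PI * (Cconj (A lambda f zeta n) *
     (RtoC (INR n - lambda) * A lambda f zeta n) * (r ^ n * r ^ n)))%C (N + n) - X)%C).
apply Rabs_le_between in Q. 
assert (Q2 : fst (Csum (fun n => 2 * PI * (Cconj (A lambda f zeta n) *
     (RtoC (INR n - lambda) * A lambda f zeta n) * (r ^ n * r ^ n)))%C (N + n) - X)%C = 2 * PI * T (N + n)%nat - fst X).
{ rewrite <- HST. reflexivity. }
rewrite Q2 in Q. assert (2 * PI * T N <= 2 * PI * T (N + n)%nat) by (apply Rmult_le_compat_l; lra). lra.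
Qed.

(** For fixed N the weighted sum is a polynomial in r, so letting r tend to 1 is mere continuity. *)
Lemma prawitz_partial (lambda : R) (f : C -> C) (zeta : C) (N : nat) :
  0 < lambda -> locally_univalent f -> univalent f -> Cmod zeta < 1 -> lambda <= INR N ->
  sum_n (area_term lambda f zeta) N <= 0.
Proof.
intros Hlam Hf Hu Hzeta HN.
set (T := fun r => sum_n (fun n => area_term lambda f zeta n * (r ^ n * r ^ n)) N).
assert (HT1 : T 1 = sum_n (area_term lambda f zeta) N).
{ assert (E : forall n, area_term lambda f zeta n * (1 ^ n * 1 ^ n) = area_term lambda f zeta n)
    by (intros n; rewrite pow1; ring).
  exact (sum_n_ext _ _ N E). }
rewrite <- HT1.
assert (Hc : forall r, continuity_pt T r).
{ assert (Ht : forall n r, continuity_pt (fun r => area_term lambda f zeta n * (r ^ n * r ^ n)) r).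
  { intros n r. apply continuity_pt_mult; [apply continuity_pt_cst|].
    assert (Hp : continuity_pt (fun r => r ^ n) r) by (apply derivable_continuous_pt, derivable_pt_pow).
    now apply continuity_pt_mult. }
  intros r. unfold T. clear HN T HT1. induction N as [|n IH].
  - apply (continuity_pt_ext (fun r => area_term lambda f zeta 0 * (r ^ 0 * r ^ 0))); [|apply Ht].
    intros x. now rewrite sum_O.
  - apply (continuity_pt_ext (fun r => sum_n (fun n => area_term lambda f zeta n * (r ^ n * r ^ n)) n +
       area_term lambda f zeta (S n) * (r ^ S n * r ^ S n))).
    + intros x. now rewrite sum_Sn.
    + apply continuity_pt_plus; [apply IH|apply Ht]. }
apply Rnot_lt_le. intros Hpos. destruct (Hc 1 (T 1) Hpos) as [d [Hd Hd']].
set (r := Rmax (1 / 2) (1 - d / 2)).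
assert (H1 : 1 / 2 <= r) by apply Rmax_l. assert (H2 : 1 - d / 2 <= r) by apply Rmax_r.
assert (H3 : r < 1) by (apply Rmax_lub_lt; lra).
assert (Hle := prawitz_weighted lambda f zeta r N Hlam Hf Hu Hzeta ltac:(lra) HN). fold (T r) in Hle.
assert (Hdist : Rabs (r - 1) < d) by (apply Rabs_def1; lra).
assert (Hne : 1 <> r) by lra.
specialize (Hd' r (conj (conj I Hne) Hdist)). simpl in Hd'. unfold R_dist in Hd'.
apply Rabs_def2 in Hd'. lra.
Qed.

Lemma A_0 (lambda : R) (f : C -> C) (zeta : C) : locally_univalent f -> Cmod zeta < 1 ->
  A lambda f zeta 0 = 1.
Proof.
intros Hf Hzeta. destruct (A_expansion lambda f zeta Hf Hzeta) as [r [l [K [Hr [_ [Hl0 [_ [_ HA]]]]]]]].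
rewrite <- (psum_0 _ _ _ (proj1 Hr) HA), Hl0, Cmult_0_r. apply Cexp_0.
Qed.

(** Since A 0 = 1, the term of index 0 is - lambda; moving it to the other side turns the bound 0
    for the sums from 0 into the bound lambda for the sums from 1. *)
Theorem area_inequality_of_univalent (lambda : R) (f : C -> C) (zeta : C) :
  0 < lambda -> locally_univalent f -> univalent f -> Cmod zeta < 1 ->
  ex_series (fun n : nat => area_term lambda f zeta (S n)) /\
  Series (fun n : nat => area_term lambda f zeta (S n)) <= lambda.
Proof.
intros Hlam Hf Hu Hzeta.
set (s := sum_n (fun n => area_term lambda f zeta (S n))).
assert (Hs : forall n, sum_n (area_term lambda f zeta) (S n) = s n - lambda).
{ assert (H0 : area_term lambda f zeta 0 = - lambda).
  { unfold area_term. rewrite A_0 by assumption. rewrite Cmod_1. simpl. ring. }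
  induction n as [|n IH].
  - unfold s. rewrite sum_Sn, !sum_O, H0. change (- lambda + area_term lambda f zeta 1 = area_term lambda f zeta 1 - lambda). ring.
  - rewrite sum_Sn, IH. unfold s at 2. rewrite sum_Sn. fold s.
    change (s n - lambda + area_term lambda f zeta (S (S n)) = s n + area_term lambda f zeta (S (S n)) - lambda). ring. }
(* Terms with n < lambda can be negative, so the partial sums are bounded and monotone only after a
   shift by N. *)
destruct (INR_unbounded lambda) as [N HN].
assert (Hub : forall n, s (n + N)%nat <= lambda).
{ intros n. assert (P : lambda <= INR (S (n + N))).
  { assert (INR N <= INR (S (n + N))) by (apply le_INR; lia). lra. }
  assert (Q := prawitz_partial lambda f zeta (S (n + N)) Hlam Hf Hu Hzeta P). rewrite Hs in Q. lra. }
assert (Hinc : forall n, s (n + N)%nat <= s (S n + N)%nat).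
{ intros n. simpl. unfold s at 2. rewrite sum_Sn. fold s.
  change (s (n + N)%nat <= s (n + N)%nat + area_term lambda f zeta (S (S (n + N)))).
  assert (INR N <= INR (S (S (n + N)))) by (apply le_INR; lia).
  assert (0 <= area_term lambda f zeta (S (S (n + N)))); [|lra].
  apply Rmult_le_pos; [lra|apply pow2_ge_0]. }
destruct (ex_finite_lim_seq_incr (fun n => s (n + N)%nat) lambda Hinc Hub) as [l Hl].
assert (Hsl : is_series (fun n => area_term lambda f zeta (S n)) l).
{ apply (is_lim_seq_incr_n s N l). exact Hl. }
split; [now exists l|]. rewrite (is_series_unique _ _ Hsl).
exact (is_lim_seq_le _ (fun _ => lambda) l lambda Hub Hl (is_lim_seq_const lambda)).
Qed.

Theorem theorem2p8 (lambda : R) (hlambda : 0 < lambda) (f : C -> C)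
  (hf : locally_univalent f) :
  univalent f <->
  (forall zeta : C, in_disk zeta ->
     ex_series (fun n : nat => area_term lambda f zeta (S n)) /\
     Series (fun n : nat => area_term lambda f zeta (S n)) <= lambda).
Proof.
split.
- intros Hu zeta Hzeta. now apply area_inequality_of_univalent.
- intros H. apply (univalent_of_area lambda f hlambda hf). intros zeta Hzeta. now apply H.
Qed.
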